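(* If $T$ is a $\Sigma^{\boldsymbol{\alpha}}_1$-sound, $\Pi^{\boldsymbol{\alpha}}_1$-definable extension of $\mathsf{KP}_1+\mathsf{Exists}(\boldsymbol{\alpha})$, then $T\nvdash\mathsf{RFN}_{\Sigma^{\boldsymbol{\alpha}}_1}(T)$.
   Context: All theories are in the language $\{\in\}$ of set theory. $\Delta_0$-formulas are the formulas with only bounded quantifiers; $\Sigma_1$-formulas are those of the form $\exists x\,\psi$ with $\psi\in\Delta_0$, and $\Pi_1$-formulas those of the form $\forall x\,\psi$ with $\psi\in\Delta_0$ (free variables allowed). $\mathsf{KP}_1$ is the theory with axioms Extensionality, Union, Pairing, Infinity, $\Delta_0$-Separation, $\Sigma_1$-Collection ($\forall x\in a\,\exists y\,\phi(x,y)\to\exists b\,\forall x\in a\,\exists y\in b\,\phi(x,y)$ for $\phi\in\Sigma_1$, parameters allowed), and $\in$-induction ($\forall x[\forall y\in x\,\phi(y)\to\phi(x)]\to\forall x\,\phi(x)$) for $\phi\in\Sigma_1\cup\Pi_1$. $\mathsf{KP}$ is the same with $\in$-induction for all formulas. An ordinal $\xi$ is admissible if $L_\xi\models\mathsf{KP}$. A representation is a $\Sigma_1$-formula $R(x)$ such that $\mathsf{KP}_1\vdash\forall x\forall y(R(x)\wedge R(y)\to x=y)$. A boldface letter $\boldsymbol{\alpha}$ denotes a representation, with formula $R^{\boldsymbol{\alpha}}$; it represents the ordinal $\alpha$ if $R^{\boldsymbol{\alpha}}$ defines $\alpha$ over $L$. $\varphi(\boldsymbol{\alpha})$ abbreviates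 $\forall x(R^{\boldsymbol{\alpha}}(x)\to\varphi(x))$, and $\mathsf{Exists}(\boldsymbol{\alpha})$ abbreviates $\exists x R^{\boldsymbol{\alpha}}(x)$. A representation $\boldsymbol{\alpha}$ is $\mathsf{KP}_1$-provably admissible if $\mathsf{KP}_1\vdash\forall\xi[R^{\boldsymbol{\alpha}}(\xi)\to\xi\text{ is admissible}]$. Standing assumptions: $\boldsymbol{\alpha}$ is a fixed $\mathsf{KP}_1$-provably admissible representation, the metatheory satisfies $V=L$ and $\mathsf{Exists}(\boldsymbol{\alpha})$, and $\alpha$ is the represented ordinal. $F^z$ is obtained from $F$ by restricting all unrestricted quantifiers to $z$. A formula is $\Sigma^{\boldsymbol{\alpha}}_1$ ($\Pi^{\boldsymbol{\alpha}}_1$) if it is of the form $F^{L_{\boldsymbol{\alpha}}}$ with $F$ a $\Sigma_1$ ($\Pi_1$) formula. $T$ is $\Sigma^{\boldsymbol{\alpha}}_1$-sound if for every $\Sigma_1$ sentence $\varphi$, $T\vdash\varphi^{L_{\boldsymbol{\alpha}}}$ implies $L_\alpha\models\varphi$. $T$ is $\Pi^{\boldsymbol{\alpha}}_1$-definable if the set of codes of its axioms is defined by a $\Pi^{\boldsymbol{\alpha}}_1$ formula; the formalized provability predicate $\mathsf{Pr}_T$ is built from such a defining formula. $\mathsf{RFN}_{\Sigma^{\boldsymbol{\alpha}}_1}(T)$ is the sentence $$\forall\varphi\in\Delta_0\Big(\mathsf{Pr}_T\big(\exists x\in L_{\boldsymbol{\alpha}}\;\varphi(x)\big)\to L_{\boldsymbol{\alpha}}\models_{\Sigma_1}\exists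 x\,\varphi(x)\Big),$$ where the quantifier ranges over codes of $\Delta_0$-formulas $\varphi(x)$ and $\models_{\Sigma_1}$ is the formalized truth predicate for $\Sigma_1$ sentences. *)

(* Defs.v *)
From Stdlib Require Import List.

Declare Scope fm_scope.
Delimit Scope fm_scope with fm.

(* De Bruijn indices: index 0 is the variable bound by the nearest enclosing
   [All].  Throughout, a formula F(x) with one free variable is a formula whose
   only free index is 0. *)
Inductive form : Set :=
| Mem (i j : nat)
| Equ (i j : nat)
| Bot
| Imp (A B : form)
| All (A : form).

Bind Scope fm_scope with form.

Definition Neg A := Imp A Bot.
Definition And A B := Neg (Imp A (Neg B)).
Definition Or A B := Imp (Neg A) B.
Definition Iff A B := And (Imp A B) (Imp B A).
Definition Ex A := Neg (All (Neg A)).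

(* Bounded quantifiers; the bound y lives outside the quantifier. *)
Definition AllIn (y : nat) A := All (Imp (Mem 0 (S y)) A).
Definition ExIn (y : nat) A := Neg (AllIn y (Neg A)).

Notation "¬ A" := (Neg A) (at level 75, right associativity) : fm_scope.
Notation "A ∧ B" := (And A B) (at level 80, right associativity) : fm_scope.
Notation "A ∨ B" := (Or A B) (at level 85, right associativity) : fm_scope.
Notation "A ⇒ B" := (Imp A B) (at level 90, right associativity) : fm_scope.
Notation "A ⇔ B" := (Iff A B) (at level 95, no associativity) : fm_scope.

Local Open Scope fm_scope.

Fixpoint fv_lt (n : nat) (A : form) : Prop :=
  match A with
  | Mem i j | Equ i j => i < n /\ j < n
  | Bot => True
  | Imp A B => fv_lt n A /\ fv_lt n B
  | All A => fv_lt (S n) A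
  end.

Definition sentence (A : form) : Prop := fv_lt 0 A.

Inductive Delta0 : form -> Prop :=
| D0_Mem i j : Delta0 (Mem i j)
| D0_Equ i j : Delta0 (Equ i j)
| D0_Bot : Delta0 Bot
| D0_Imp A B : Delta0 A -> Delta0 B -> Delta0 (A ⇒ B)
| D0_AllIn y A : Delta0 A -> Delta0 (AllIn y A).

Definition Sigma1 (A : form) : Prop := exists B, Delta0 B /\ A = Ex B.
Definition Pi1 (A : form) : Prop := exists B, Delta0 B /\ A = All B.

(* [shift c] makes room for one more variable at index c. *)
Definition shift_var (c i : nat) : nat := if Nat.ltb i c then i else S i.

Fixpoint shift (c : nat) (A : form) : form :=
  match A with
  | Mem i j => Mem (shift_var c i) (shift_var c j)
  | Equ i j => Equ (shift_var c i) (shift_var c j)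
  | Bot => Bot
  | Imp A B => shift c A ⇒ shift c B
  | All A => All (shift (S c) A)
  end.

(* F^z : all quantifiers restricted to (the variable) z. *)
Fixpoint rel (z : nat) (A : form) : form :=
  match A with
  | Mem i j => Mem i j
  | Equ i j => Equ i j
  | Bot => Bot
  | Imp A B => rel z A ⇒ rel z B
  | All A => AllIn z (rel (S z) A)
  end.

(* Tarski's substitution-free axiomatization of first-order logic with
   equality: instantiation is derived from [L_ex] and [L_vac].  Free variables
   of axioms are read universally. *)
Inductive logical : form -> Prop :=
| L_K A B : logical (A ⇒ B ⇒ A)
| L_S A B C : logical ((A ⇒ B ⇒ C) ⇒ (A ⇒ B) ⇒ A ⇒ C)
| L_DN A : logical (((A ⇒ Bot) ⇒ Bot) ⇒ A)
| L_dist A B : logical (All (A ⇒ B) ⇒ All A ⇒ All B)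
| L_vac A : logical (A ⇒ All (shift 0 A))
| L_ex i : logical (Ex (Equ 0 (S i)))
| L_eq i j k : logical (Equ i j ⇒ Equ i k ⇒ Equ j k)
| L_meml i j k : logical (Equ i j ⇒ Mem i k ⇒ Mem j k)
| L_memr i j k : logical (Equ i j ⇒ Mem k i ⇒ Mem k j).

Inductive prv (T : form -> Prop) : form -> Prop :=
| P_ax A : T A -> prv T A
| P_log A : logical A -> prv T A
| P_mp A B : prv T (A ⇒ B) -> prv T A -> prv T B
| P_gen A : prv T A -> prv T (All A).

Definition Ext := All (All (All (Mem 0 2 ⇔ Mem 0 1) ⇒ Equ 1 0)).
Definition Pairing := All (All (Ex (All (Mem 0 1 ⇔ Equ 0 3 ∨ Equ 0 2)))).
Definition Union := All (Ex (All (Mem 0 1 ⇔ ExIn 2 (Mem 1 0)))).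
Definition Infinity :=
  Ex (ExIn 0 (AllIn 0 Bot)
      ∧ AllIn 0 (ExIn 1 (All (Mem 0 1 ⇔ Mem 0 2 ∨ Equ 0 2)))).

(* Schema instances; A may have parameters, beyond those displayed:
   Sep  : A = A(x, a), Coll : A = A(y, x, a), Ind : A = A(x). *)
Definition Sep (A : form) :=
  All (Ex (All (Mem 0 1 ⇔ Mem 0 2 ∧ shift 1 A))).
Definition Coll (A : form) :=
  All (AllIn 0 (Ex A) ⇒ Ex (AllIn 1 (ExIn 1 (shift 2 A)))).
Definition Ind (A : form) :=
  All (AllIn 0 (shift 1 A) ⇒ A) ⇒ All A.

(* The argument is the class of formulas allowed in ∈-induction. *)
Inductive KP_with (Cl : form -> Prop) : form -> Prop :=
| KP_Ext : KP_with Cl Ext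
| KP_Pairing : KP_with Cl Pairing
| KP_Union : KP_with Cl Union
| KP_Infinity : KP_with Cl Infinity
| KP_Sep A : Delta0 A -> KP_with Cl (Sep A)
| KP_Coll A : Sigma1 A -> KP_with Cl (Coll A)
| KP_Ind A : Cl A -> KP_with Cl (Ind A).

Definition KP : form -> Prop := KP_with (fun _ => True).
Definition KP1 : form -> Prop := KP_with (fun A => Sigma1 A \/ Pi1 A).

(* The metatheoretic universe: well-founded trees up to bisimilarity.  The
   assumption V = L is rendered by evaluating formulas in its class L. *)
Inductive V : Type := sup (X : Type) (f : X -> V).

Fixpoint veq (x y : V) : Prop :=
  match x, y with
  | sup X f, sup Y g =>
      (forall i, exists j, veq (f i) (g j)) /\
      (forall j, exists i, veq (f i) (g j))
  end.

Definition vmem (x y : V) : Prop :=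
  match y with sup Y g => exists j, veq x (g j) end.

Definition vempty : V := sup Empty_set (fun e => match e with end).
Definition vupair (x y : V) : V := sup bool (fun b => if b then x else y).
Definition vpair (x y : V) : V := vupair (vupair x x) (vupair x y).
Definition vsucc (x : V) : V :=
  match x with
  | sup X f => sup (option X) (fun o => match o with Some i => f i | None => x end)
  end.

Definition vtrans (x : V) : Prop :=
  forall y z, vmem z y -> vmem y x -> vmem z x.
Definition ordinal (x : V) : Prop :=
  vtrans x /\ forall y, vmem y x -> vtrans y.

Definition scons (x : V) (s : nat -> V) (i : nat) : V :=
  match i with 0 => x | S j => s j end.

(* (P, ∈) ⊨ A[s] for a class P of sets. *)
Fixpoint holds (P : V -> Prop) (s : nat -> V) (A : form) : Prop :=
  match A with
  | Mem i j => vmem (s i) (s j)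
  | Equ i j => veq (s i) (s j)
  | Bot => False
  | Imp A B => holds P s A -> holds P s B
  | All A => forall x, P x -> holds P (scons x s) A
  end.

(* A formula A(x, p1, ..., pn) together with parameters p1, ..., pn. *)
Definition def_index (X : Type) : Type :=
  {Ap : form * list X | fv_lt (S (length (snd Ap))) (fst Ap)}.

(* Def(x), the set of subsets of x definable over (x, ∈) with parameters. *)
Definition Def (x : V) : V :=
  match x with
  | sup X f =>
      sup (def_index X) (fun d =>
        let '(A, ps) := proj1_sig d in
        let s n := nth n (map f ps) vempty in
        sup {i : X | holds (fun y => vmem y x) (scons (f i) s) A}
            (fun i => f (proj1_sig i)))
  end.

Definition index (x : V) : Type := match x with sup Y _ => Y end.
Definition elt (x : V) : index x -> V := match x with sup _ f => f end.

(* L_a = ⋃_{b ∈ a} Def(L_b). *)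
Fixpoint Lev (a : V) : V :=
  match a with
  | sup X f =>
      sup {i : X & index (Def (Lev (f i)))}
          (fun p => elt (Def (Lev (f (projT1 p)))) (projT2 p))
  end.

Definition inL (x : V) : Prop := exists a, ordinal a /\ vmem x (Lev a).

(* [hvar i] stands for the variable i of the ambient formula; via the coercion
   a bare number used as a term is such a variable, whereas the number n itself
   is the term [num n]. *)
Inductive hterm : Set :=
| hvar (i : nat)
| hzero
| hsucc (t : hterm)
| hpair (t u : hterm).

Coercion hvar : nat >-> hterm.

Fixpoint num (n : nat) : hterm :=
  match n with 0 => hzero | S m => hsucc (num m) end.

Fixpoint hval (s : nat -> V) (t : hterm) : V :=
  match t with
  | hvar i => s i
  | hzero => vempty
  | hsucc t => vsucc (hval s t)
  | hpair t u => vpair (hval s t) (hval s u)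
  end.

Definition cMem (i j : hterm) := hpair (num 0) (hpair i j).
Definition cEqu (i j : hterm) := hpair (num 1) (hpair i j).
Definition cBot := hpair (num 2) (num 0).
Definition cImp (A B : hterm) := hpair (num 3) (hpair A B).
Definition cAll (A : hterm) := hpair (num 4) A.

Definition cNeg A := cImp A cBot.
Definition cAnd A B := cNeg (cImp A (cNeg B)).
Definition cIff A B := cAnd (cImp A B) (cImp B A).
Definition cEx A := cNeg (cAll (cNeg A)).
Definition cAllIn (y : nat) A := cAll (cImp (cMem (num 0) (num (S y))) A).
Definition cExIn (y : nat) A := cNeg (cAllIn y (cNeg A)).

Fixpoint quote (A : form) : hterm :=
  match A with
  | Mem i j => cMem (num i) (num j)
  | Equ i j => cEqu (num i) (num j)
  | Bot => cBot
  | Imp A B => cImp (quote A) (quote B)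
  | All A => cAll (quote A)
  end.

Definition code (A : form) : V := hval (fun _ => vempty) (quote A).

(* A' stands for the appropriate shift of A. *)
Definition cSep (A' : hterm) :=
  cAll (cEx (cAll (cIff (cMem (num 0) (num 1))
                        (cAnd (cMem (num 0) (num 2)) A')))).
Definition cColl (A A' : hterm) :=
  cAll (cImp (cAllIn 0 (cEx A)) (cEx (cAllIn 1 (cExIn 1 A')))).
Definition cInd (A A' : hterm) :=
  cImp (cAll (cImp (cAllIn 0 A') A)) (cAll A).

Lemma quote_Sep A : quote (Sep A) = cSep (quote (shift 1 A)).
Proof. reflexivity. Qed.
Lemma quote_Coll A : quote (Coll A) = cColl (quote A) (quote (shift 2 A)).
Proof. reflexivity. Qed.
Lemma quote_Ind A : quote (Ind A) = cInd (quote A) (quote (shift 1 A)).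
Proof. reflexivity. Qed.

(* Set-theoretic notions expressed in the object language: [fName] is a formula,
   and its arguments are variables (indices) of the ambient
   context.  Comments such as [b; a | ..] list the context inside the
   quantifiers, index 0 first. *)

Definition fTrans (x : nat) := AllIn x (AllIn 0 (Mem 0 (2 + x))).
Definition fOrd (x : nat) := fTrans x ∧ AllIn x (fTrans 0).

(* z = {x, y}, p = (x, y) and y = x ∪ {x} *)
Definition fUPair (z x y : nat) :=
  All (Mem 0 (S z) ⇔ Equ 0 (S x) ∨ Equ 0 (S y)).
Definition fPair (p x y : nat) :=
  All (Mem 0 (S p) ⇔ fUPair 0 (S x) (S x) ∨ fUPair 0 (S x) (S y)).
Definition fSucc (y x : nat) :=
  All (Mem 0 (S y) ⇔ Mem 0 (S x) ∨ Equ 0 (S x)).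

(* x = t, where t is read in a context with k fewer variables. *)
Fixpoint fIs (k x : nat) (t : hterm) : form :=
  match t with
  | hvar i => Equ x (k + i)
  | hzero => AllIn x Bot
  | hsucc t => Ex (fIs (1 + k) 0 t ∧ fSucc (1 + x) 0)
  | hpair t u =>
      Ex (Ex (fIs (2 + k) 1 t ∧ fIs (2 + k) 0 u ∧ fPair (2 + x) 1 0))
  end.

Notation "x ≐ t" := (fIs 0 x t) (at level 60) : fm_scope.
Notation "t ∊ y" := (Ex (fIs 1 0 t ∧ Mem 0 (S y))) (at level 60) : fm_scope.

Definition fNat (n : nat) :=
  let zero_or_succ m := m ≐ hzero ∨ ExIn m (fSucc (S m) 0) in
  fOrd n ∧ zero_or_succ n ∧ AllIn n (zero_or_succ 0).

(* s is a function with domain n; its values are in z *)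
Definition fFun (s n : nat) :=
  AllIn s (Ex (Ex (* [y; i; q | ..] *) (Mem 1 (3 + n) ∧ 2 ≐ hpair 1 0)))
  ∧ AllIn n (Ex (* [y; i | ..] *)
      (hpair 1 0 ∊ (2 + s) ∧ All (hpair 2 0 ∊ (3 + s) ⇒ Equ 0 1))).
Definition fInto (s z : nat) :=
  All (All (* [y; i | ..] *) (hpair 1 0 ∊ (2 + s) ⇒ Mem 0 (2 + z))).

(* The inductively defined syntactic and semantic relations below are all
   expressed as "P belongs to some set S each of whose elements is justified by
   elements of S".  The premises always concern immediate subformulas, so that
   by ∈-induction this amounts to the inductive definition. *)

(* f codes a formula all of whose free variables are < n *)
Definition fFvLt (n f : nat) :=
  Ex (hpair (S n) (S f) ∊ 0 ∧ AllIn 0 (Ex (Ex (* [g; m; p; S | ..] *)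
    (2 ≐ hpair 1 0 ∧ fNat 1 ∧
      ( ExIn 1 (ExIn 2 (* [j; i; g; m; p; S | ..] *)
          (2 ≐ cMem 1 0 ∨ 2 ≐ cEqu 1 0))
      ∨ 0 ≐ cBot
      ∨ Ex (Ex (* [v; u; g; m; p; S | ..] *)
          (2 ≐ cImp 1 0 ∧ hpair 3 1 ∊ 5 ∧ hpair 3 0 ∊ 5))
      ∨ Ex (* [u; g; m; p; S | ..] *)
          (1 ≐ cAll 0 ∧ hpair (hsucc 2) 0 ∊ 4)))))).

Definition fForm (f : nat) := Ex (fFvLt 0 (S f)).
Definition fFormIn (n f : nat) := Ex (0 ≐ num n ∧ fFvLt 0 (S f)).

(* f codes a Δ0 formula *)
Definition fDelta0 (f : nat) :=
  fForm f ∧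
  Ex (Mem (S f) 0 ∧ AllIn 0 (* [g; S | ..] *)
    ( Ex (Ex (* [j; i; g; S | ..] *) (2 ≐ cMem 1 0 ∨ 2 ≐ cEqu 1 0))
    ∨ 0 ≐ cBot
    ∨ Ex (Ex (* [v; u; g; S | ..] *) (Mem 1 3 ∧ Mem 0 3 ∧ 2 ≐ cImp 1 0))
    ∨ Ex (Ex (* [u; i; g; S | ..] *)
        (Mem 0 3 ∧ 2 ≐ cAll (cImp (cMem (num 0) (hsucc 1)) 0))))).

(* j = shift_var d i *)
Definition fShiftVar (d i j : nat) :=
  (Mem i d ∧ Equ j i) ∨ (¬ Mem i d ∧ j ≐ hsucc i).

(* f and g code formulas A and shift c A *)
Definition fShift (c f g : nat) :=
  fForm f ∧
  Ex (hpair (S c) (hpair (S f) (S g)) ∊ 0 ∧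
    AllIn 0 (Ex (Ex (Ex (* [v; u; d; p; S | ..] *)
    (3 ≐ hpair 2 (hpair 1 0) ∧
      ( Ex (Ex (Ex (Ex (* [j'; i'; j; i; v; u; d; p; S | ..] *)
          (fShiftVar 6 3 1 ∧ fShiftVar 6 2 0 ∧
            ( (5 ≐ cMem 3 2 ∧ 4 ≐ cMem 1 0)
            ∨ (5 ≐ cEqu 3 2 ∧ 4 ≐ cEqu 1 0))))))
      ∨ (1 ≐ cBot ∧ 0 ≐ cBot)
      ∨ Ex (Ex (Ex (Ex (* [v2; v1; u2; u1; v; u; d; p; S | ..] *)
          (5 ≐ cImp 3 2 ∧ 4 ≐ cImp 1 0
           ∧ hpair 6 (hpair 3 1) ∊ 8 ∧ hpair 6 (hpair 2 0) ∊ 8))))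
      ∨ Ex (Ex (* [v1; u1; v; u; d; p; S | ..] *)
          (3 ≐ cAll 1 ∧ 2 ≐ cAll 0 ∧ hpair (hsucc 4) (hpair 1 0) ∊ 6)))))))).
Definition fShiftNum (c f g : nat) :=
  Ex (0 ≐ num c ∧ fShift 0 (S f) (S g)).

(* Assignments are functions with domain a natural number; t' is the
   assignment with t'(0) = a and t'(i+1) = t(i). *)
Definition fCons (t' a t : nat) :=
  All (Mem 0 (S t') ⇔
    0 ≐ hpair (num 0) (S a)
    ∨ Ex (Ex (* [y; i; q | ..] *)
        (hpair 1 0 ∊ (3 + t) ∧ 2 ≐ hpair (hsucc 1) 0))).

(* (b, (g, t)) records that g has truth value b under the assignment t *)
Definition hev (b : nat) (g t : hterm) := hpair (num b) (hpair g t).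

(* (z, ∈) ⊨ f[s] *)
Definition fSat (z f s : nat) :=
  Ex (hev 1 (S f) (S s) ∊ 0 ∧
    AllIn 0 (Ex (Ex (* [t; g; p; S | ..] *)
      ( Ex (Ex (Ex (Ex (* [b; a; j; i; t; g; p; S | ..] *)
          (hpair 3 1 ∊ 4 ∧ hpair 2 0 ∊ 4 ∧
            ( (5 ≐ cMem 3 2 ∧ ( (6 ≐ hev 1 5 4 ∧ Mem 1 0)
                              ∨ (6 ≐ hev 0 5 4 ∧ ¬ Mem 1 0)))
            ∨ (5 ≐ cEqu 3 2 ∧ ( (6 ≐ hev 1 5 4 ∧ Equ 1 0)
                              ∨ (6 ≐ hev 0 5 4 ∧ ¬ Equ 1 0))))))))
      ∨ (1 ≐ cBot ∧ 2 ≐ hev 0 1 0)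
      ∨ Ex (Ex (* [v; u; t; g; p; S | ..] *)
          (3 ≐ cImp 1 0 ∧
            ( (4 ≐ hev 1 3 2 ∧ (hev 0 1 2 ∊ 5 ∨ hev 1 0 2 ∊ 5))
            ∨ (4 ≐ hev 0 3 2 ∧ hev 1 1 2 ∊ 5 ∧ hev 0 0 2 ∊ 5))))
      ∨ Ex (* [u; t; g; p; S | ..] *)
          (2 ≐ cAll 0 ∧
            ( (3 ≐ hev 1 2 1 ∧ AllIn (5 + z) (Ex
                (* [t'; a; u; t; g; p; S | ..] *)
                (fCons 0 1 3 ∧ hev 1 2 0 ∊ 6)))
            ∨ (3 ≐ hev 0 2 1 ∧ ExIn (5 + z) (Ex
                (fCons 0 1 3 ∧ hev 0 2 0 ∊ 6))))))))).

(* y ∈ Def(x) *)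
Definition fDef (x y : nat) :=
  Ex (Ex (Ex (Ex (* [s; f; m; n | ..] *)
    (fSucc 2 3 ∧ fFvLt 2 1 ∧ fFun 0 3 ∧ fInto 0 (4 + x) ∧
     All (* [w; s; f; m; n | ..] *)
       (Mem 0 (5 + y) ⇔ Mem 0 (5 + x) ∧
          Ex (* [s'; w; s; f; m; n | ..] *)
            (fCons 0 1 2 ∧ fSat (6 + x) 3 0)))))).

(* z = L_a *)
Definition fL (a z : nat) :=
  fOrd a ∧
  Ex (Ex (* [h; d | ..] *)
    (fSucc 1 (2 + a) ∧ fFun 0 1 ∧ hpair (2 + a) (2 + z) ∊ 0 ∧
     All (All (* [w; b; h; d | ..] *)
       (hpair 1 0 ∊ 2 ⇒
        All (Mem 0 1 ⇔ ExIn 2 (Ex (* [v; c; y; w; b; h; d | ..] *)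
               (hpair 1 0 ∊ 5 ∧ fDef 0 2))))))).

(* f codes an axiom of KP *)
Definition fKP (f : nat) :=
  f ≐ quote Ext ∨ f ≐ quote Pairing ∨ f ≐ quote Union ∨ f ≐ quote Infinity
  ∨ Ex (Ex (* [g'; g | ..] *)
      (fDelta0 1 ∧ fShiftNum 1 1 0 ∧ 2 + f ≐ cSep 0))
  ∨ Ex (Ex (Ex (* [g'; g; e | ..] *)
      (fDelta0 2 ∧ 1 ≐ cEx 2 ∧ fShiftNum 2 1 0 ∧ 3 + f ≐ cColl 1 0)))
  ∨ Ex (Ex (* [g'; g | ..] *)
      (fForm 1 ∧ fShiftNum 1 1 0 ∧ 2 + f ≐ cInd 1 0)).

Definition fAdmissible (x : nat) :=
  fOrd x ∧
  Ex (* [z | ..] *) (fL (S x) 0 ∧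
    All (* [f; z | ..] *) (fKP 0 ⇒
      All (All (* [s; n; f; z | ..] *)
        (fFvLt 1 2 ∧ fFun 0 1 ∧ fInto 0 3 ⇒ fSat 3 2 0)))).

Definition representation (R : form) : Prop :=
  Sigma1 R /\ fv_lt 1 R /\
  prv KP1 (All (All (shift 0 R ∧ R ⇒ Equ 1 0))).

Definition Exists (R : form) : form := Ex R.

Definition provably_admissible (R : form) : Prop :=
  prv KP1 (All (R ⇒ fAdmissible 0)).

Definition represents (R : form) (a : V) : Prop :=
  ordinal a /\ inL a /\
  forall x, inL x -> (holds inL (fun _ => x) R <-> veq x a).

(* F^{L_α}, where α is represented by R and F may have free variables *)
Definition atL (R F : form) : form :=
  All (R ⇒ Ex (* [z; a | ..] *) (fL 1 0 ∧ rel 0 (shift 0 (shift 0 F)))).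

(* ∃x∈L_α A(x), and the code of that formula in terms of the code of A *)
Definition ExInL (R A : form) : form :=
  All (R ⇒ Ex (* [z; a] *) (fL 1 0 ∧ ExIn 0 A)).
Definition cExInL (R : form) (A : hterm) : hterm :=
  cAll (cImp (quote R) (cEx (cAnd (quote (fL 1 0)) (cExIn 0 A)))).

Lemma quote_ExInL R A : quote (ExInL R A) = cExInL R (quote A).
Proof. reflexivity. Qed.

(* f codes a logical axiom *)
Definition fLogical (f : nat) :=
  Ex (Ex (* [B; A | ..] *)
    (fForm 1 ∧ fForm 0 ∧ 2 + f ≐ cImp 1 (cImp 0 1)))
  ∨ Ex (Ex (Ex (* [C; B; A | ..] *)
    (fForm 2 ∧ fForm 1 ∧ fForm 0 ∧
     3 + f ≐ cImp (cImp 2 (cImp 1 0)) (cImp (cImp 2 1) (cImp 2 0)))))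
  ∨ Ex (* [A | ..] *)
    (fForm 0 ∧ 1 + f ≐ cImp (cImp (cImp 0 cBot) cBot) 0)
  ∨ Ex (Ex (* [B; A | ..] *)
    (fForm 1 ∧ fForm 0 ∧
     2 + f ≐ cImp (cAll (cImp 1 0)) (cImp (cAll 1) (cAll 0))))
  ∨ Ex (Ex (* [A'; A | ..] *)
    (fShiftNum 0 1 0 ∧ 2 + f ≐ cImp 1 (cAll 0)))
  ∨ Ex (* [i | ..] *)
    (fNat 0 ∧ 1 + f ≐ cEx (cEqu (num 0) (hsucc 0)))
  ∨ Ex (Ex (Ex (* [k; j; i | ..] *)
    (fNat 2 ∧ fNat 1 ∧ fNat 0 ∧
      ( 3 + f ≐ cImp (cEqu 2 1) (cImp (cEqu 2 0) (cEqu 1 0))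
      ∨ 3 + f ≐ cImp (cEqu 2 1) (cImp (cMem 2 0) (cMem 1 0))
      ∨ 3 + f ≐ cImp (cEqu 2 1) (cImp (cMem 0 2) (cMem 0 1)))))).

(* Pr_T(f), for T the theory whose axioms are the sentences satisfying tau:
   there is a proof p(0), ..., p(m) with p(m) = f *)
Definition fPr (tau : form) (f : nat) :=
  Ex (Ex (Ex (* [p; n; m | ..] *)
    (fNat 1 ∧ fSucc 1 2 ∧ fFun 0 1 ∧ hpair 2 (3 + f) ∊ 0 ∧
     AllIn 1 (All (* [g; i; p; n; m | ..] *)
       (hpair 1 0 ∊ 2 ⇒
         fLogical 0
         ∨ (fFormIn 0 0 ∧ Ex (Equ 0 1 ∧ tau))
         ∨ ExIn 1 (ExIn 2 (Ex (* [e; k; j; g; i; p; n; m | ..] *)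
             (hpair 2 (cImp 0 3) ∊ 5 ∧ hpair 1 0 ∊ 5)))
         ∨ ExIn 1 (Ex (* [e; j; g; i; p; n; m | ..] *)
             (hpair 1 0 ∊ 4 ∧ 2 ≐ cAll 0))))))).

(* L_α ⊨ ∃x A(x), for f the code of A *)
Definition fTrueEx (R : form) (f : nat) :=
  Ex (* [e | ..] *) (0 ≐ cEx (S f) ∧
    All (R ⇒ Ex (* [z; a; e | ..] *) (fL 1 0 ∧
      Ex (* [s; z; a; e | ..] *) (0 ≐ hzero ∧ fSat 1 3 0)))).

(* RFN for Σ1^α formulas, T being defined by the formula F^{L_α} *)
Definition RFN (R F : form) : form :=
  All (* [f] *) (fFormIn 1 0 ∧ fDelta0 0 ⇒
    All (* [g; f] *) (0 ≐ cExInL R 1 ⇒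
      fPr (atL R F) 0 ⇒ fTrueEx R 1)).

Definition theory (T : form -> Prop) : Prop := forall A, T A -> sentence A.

Definition extends (T U : form -> Prop) : Prop := forall A, U A -> prv T A.

Definition KP1_Exists (R : form) (A : form) : Prop := KP1 A \/ A = Exists R.

Definition Sigma1_sound (R : form) (alpha : V) (T : form -> Prop) : Prop :=
  forall F, Sigma1 F -> sentence F -> prv T (atL R F) ->
    holds (fun x => vmem x (Lev alpha)) (fun _ => vempty) F.

(* F is a Π1 formula such that the set of codes of axioms of T is
   {c ∈ L_α : L_α ⊨ F(c)}. *)
Definition Pi1_defines (alpha : V) (F : form) (T : form -> Prop) : Prop :=
  Pi1 F /\ fv_lt 1 F /\
  forall c, vmem c (Lev alpha) ->
    (holds (fun x => vmem x (Lev alpha)) (fun _ => c) F <->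
     exists A, T A /\ veq c (code A)).

(* Main.v *)
From Stdlib Require Import List Arith Lia Classical ClassicalEpsilon
  FunctionalExtensionality PropExtensionality Cantor.
Require Import Defs.
Import ListNotations.

(* A Goedel sentence argument that needs no derivability conditions.  Write F as
   forall w, F0(w, c).  As L_alpha is admissible, Delta0-collection turns
   "some sequence is a T-proof of the sentence" into a Pi1 condition on L_alpha,
   so there is a Sigma1^alpha sentence gamma expressing its own unprovability:
   for some u in L_alpha closed under adjunction, every sequence in u ending
   with gamma has a line which is not justified by logic and violates F0(w, .)
   for some w in L_alpha.  Then T proves [¬ gamma ⇒ Pr_T(gamma)], while
   reflection gives [Pr_T(gamma) ⇒ gamma]; hence T proves gamma.  The codes of an
   actual proof of gamma belong to every such u, so T proves that one of the
   finitely many axioms A used in it satisfies ∃w ¬F0(w, A) in L_alpha.  By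
   soundness this is true, and A is not an axiom after all.

   Provability in T is replaced by truth in all models of T, where the argument
   becomes ordinary set theory. *)

Local Open Scope fm_scope.

(** * Renaming, satisfaction and soundness *)

(** Reflection speaks about codes of Δ0 formulas, so the matrix of gamma must be Δ0; hence its
    syntax is evaluated inside a set u and not in the universe. A transitive u containing ∅ and
    closed under a ∪ {b} contains the codes of all standard formulas and of finite sequences of
    them, and a syntactic fact with witnesses in u also holds in the universe. These two directions
    suffice, so codes that are nonstandard in a model of T are never analysed. Such a u in L_alpha
    is a level L_l with l a limit below alpha, obtained from Infinity in L_alpha. The bound b
    produced by collection must be named by gamma together with u, whence the single witness x = {u,
    b}. Self-reference does without a substitution function: the code v of the matrix is pinned down
    by a bounded formula built along the term for v, and the code of gamma is composed from v and
    the code of that formula. *)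

Definition up (r : nat -> nat) (i : nat) : nat :=
  match i with 0 => 0 | S j => S (r j) end.

Fixpoint ren (r : nat -> nat) (A : form) : form :=
  match A with
  | Mem i j => Mem (r i) (r j)
  | Equ i j => Equ (r i) (r j)
  | Bot => Bot
  | Imp A B => ren r A ⇒ ren r B
  | All A => All (ren (up r) A)
  end.

Definition ncons (i : nat) (r : nat -> nat) (k : nat) : nat :=
  match k with 0 => i | S j => r j end.

Definition inst (i : nat) : form -> form := ren (ncons i (fun k => k)).

Lemma ren_ext r r' A : (forall i, r i = r' i) -> ren r A = ren r' A.
Proof.
  revert r r'; induction A; simpl; intros r r' H; f_equal; auto.
  apply IHA; intros [|i]; simpl; auto.
Qed.

Lemma ren_ren r r' A : ren r (ren r' A) = ren (fun i => r (r' i)) A.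
Proof.
  revert r r'; induction A; simpl; intros r r'; f_equal; auto.
  rewrite IHA; apply ren_ext; intros [|i]; reflexivity.
Qed.

Lemma ren_id A : ren (fun i => i) A = A.
Proof.
  induction A; simpl; f_equal; auto.
  rewrite <- IHA at 2; apply ren_ext; intros [|i]; reflexivity.
Qed.

Lemma shift_ren c A : shift c A = ren (shift_var c) A.
Proof.
  revert c; induction A; simpl; intros c; f_equal; auto.
  rewrite IHA; apply ren_ext; intros [|i]; unfold shift_var; simpl; auto.
  change (S i <? S c) with (i <? c). destruct (i <? c); auto.
Qed.

Lemma shift0_ren A : shift 0 A = ren S A.
Proof. rewrite shift_ren; apply ren_ext; reflexivity. Qed.

Lemma ren_shift0 r A : ren (up r) (shift 0 A) = shift 0 (ren r A).
Proof. rewrite !shift0_ren, !ren_ren; reflexivity. Qed.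

Lemma ren_ext_fv n r r' A :
  fv_lt n A -> (forall i, i < n -> r i = r' i) -> ren r A = ren r' A.
Proof.
  revert n r r'; induction A; simpl; intros n r r' H Hr; f_equal; auto; try (apply Hr; tauto).
  - apply (IHA1 n); tauto.
  - apply (IHA2 n); tauto.
  - apply (IHA (S n)); auto. intros [|i] Hi; simpl; auto. f_equal; apply Hr; lia.
Qed.

Lemma ren_fv_id n r A : fv_lt n A -> (forall i, i < n -> r i = i) -> ren r A = A.
Proof. intros H Hr. rewrite <- (ren_id A) at 2. apply (ren_ext_fv n); auto. Qed.

Lemma ren_sentence r A : sentence A -> ren r A = A.
Proof. intros H; apply (ren_fv_id 0); auto; lia. Qed.

Lemma fv_lt_ren_range m r A : (forall i, r i < m) -> fv_lt m (ren r A).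
Proof.
  revert m r; induction A; simpl; intros m r Hr; auto.
  apply IHA. intros [|i]; simpl; [lia|]. apply -> Nat.succ_lt_mono; apply Hr.
Qed.

Lemma fv_lt_mono n m A : n <= m -> fv_lt n A -> fv_lt m A.
Proof.
  revert n m; induction A; simpl; intros n m Hnm H; try tauto; try lia.
  - destruct H; eauto.
  - apply (IHA (S n) (S m)); auto; lia.
Qed.

Lemma fv_lt_And n A B : fv_lt n A -> fv_lt n B -> fv_lt n (A ∧ B).
Proof. simpl; tauto. Qed.

Lemma fv_lt_ExIn n y A : y < n -> fv_lt (S n) A -> fv_lt n (ExIn y A).
Proof. intros Hy HA; simpl; repeat split; auto; lia. Qed.

Lemma fv_lt_bound A : exists n, fv_lt n A.
Proof.
  induction A.
  - exists (S (i + j)); simpl; lia.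
  - exists (S (i + j)); simpl; lia.
  - exists 0; exact I.
  - destruct IHA1 as [n Hn], IHA2 as [m Hm]. exists (n + m). simpl.
    split; [apply (fv_lt_mono n) | apply (fv_lt_mono m)]; auto; lia.
  - destruct IHA as [n Hn]. exists n. simpl. apply (fv_lt_mono n); auto.
Qed.

Lemma Delta0_ren r A : Delta0 A -> Delta0 (ren r A).
Proof.
  intros H; revert r; induction H; intros r; simpl; try constructor; auto.
Qed.

Lemma Delta0_Neg A : Delta0 A -> Delta0 (¬ A).
Proof. intros; repeat constructor; auto. Qed.
Lemma Delta0_And A B : Delta0 A -> Delta0 B -> Delta0 (A ∧ B).
Proof. intros; repeat constructor; auto. Qed.
Lemma Delta0_Or A B : Delta0 A -> Delta0 B -> Delta0 (A ∨ B).
Proof. intros; repeat constructor; auto. Qed.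
Lemma Delta0_ExIn y A : Delta0 A -> Delta0 (ExIn y A).
Proof. intros; repeat constructor; auto. Qed.
Lemma Delta0_rel z A : Delta0 (rel z A).
Proof. revert z; induction A; intros z; simpl; constructor; auto. Qed.

Definition env_cons {M : Type} (x : M) (s : nat -> M) (i : nat) : M :=
  match i with 0 => x | S j => s j end.

Infix "▹" := env_cons (at level 60, right associativity).

Section Truth.
Variables (M : Type) (E : M -> M -> Prop) (P : M -> Prop).

(** Equality is read as identity, unlike in [holds], where it is bisimilarity. Quantifiers range
    over a class [P], so that one definition covers truth in a model, truth in one of its elements,
    and relativized formulas. *)
Fixpoint hold (s : nat -> M) (A : form) : Prop :=
  match A with
  | Mem i j => E (s i) (s j)
  | Equ i j => s i = s j
  | Bot => False
  | Imp A B => hold s A -> hold s B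
  | All A => forall x, P x -> hold (x ▹ s) A
  end.

End Truth.

Arguments hold {M} E P s A.

Notation sat E := (hold E (fun _ => True)).

Lemma forall_iff {X : Type} (P Q : X -> Prop) :
  (forall x, P x <-> Q x) -> (forall x, P x) <-> (forall x, Q x).
Proof. firstorder. Qed.

Section Hold.
Variables (M : Type) (E : M -> M -> Prop).
Implicit Types (P : M -> Prop) (s : nat -> M).

Lemma hold_ren P s r A : hold E P s (ren r A) <-> hold E P (fun i => s (r i)) A.
Proof.
  revert s r; induction A; simpl; intros s r; try tauto.
  - rewrite IHA1, IHA2; tauto.
  - apply forall_iff; intros x. rewrite IHA.
    replace (fun i => (x ▹ s) (up r i)) with (x ▹ (fun i => s (r i))); [tauto|].
    extensionality i; destruct i; reflexivity.
Qed.

Lemma hold_shift P x s A : hold E P (x ▹ s) (shift 0 A) <-> hold E P s A.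
Proof. rewrite shift0_ren, hold_ren; reflexivity. Qed.

Lemma hold_fv P n s s' A :
  fv_lt n A -> (forall i, i < n -> s i = s' i) ->
  hold E P s A <-> hold E P s' A.
Proof.
  revert n s s'; induction A; simpl; intros n s s' H Hs; try tauto.
  - rewrite !Hs by tauto; tauto.
  - rewrite !Hs by tauto; tauto.
  - rewrite (IHA1 n s s'), (IHA2 n s s'); tauto.
  - apply forall_iff; intros x. rewrite (IHA (S n) (x ▹ s) (x ▹ s')); [tauto|auto|].
    intros [|i] Hi; simpl; auto. apply Hs; lia.
Qed.

Lemma hold_rel P z s A :
  (forall x, E x (s z) -> P x) ->
  hold E P s (rel z A) <-> hold E (fun x => E x (s z)) s A.
Proof.
  intros HP; revert z s HP; induction A; simpl; intros z s HP; try tauto.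
  - rewrite IHA1, IHA2 by auto; tauto.
  - split; intros H x; [intros Hx | intros Px Hx]; specialize (H x).
    + apply (IHA (S z) (x ▹ s)) in H; auto.
    + apply (IHA (S z) (x ▹ s)); auto.
Qed.

Lemma hold_And P s A B : hold E P s (A ∧ B) <-> hold E P s A /\ hold E P s B.
Proof. simpl; tauto. Qed.
Lemma hold_Or P s A B : hold E P s (A ∨ B) <-> hold E P s A \/ hold E P s B.
Proof. simpl; tauto. Qed.
Lemma hold_Neg P s A : hold E P s (¬ A) <-> ~ hold E P s A.
Proof. simpl; tauto. Qed.
Lemma hold_Iff P s A B : hold E P s (A ⇔ B) <-> (hold E P s A <-> hold E P s B).
Proof. simpl; tauto. Qed.
Lemma hold_Ex P s A : hold E P s (Ex A) <-> exists x, P x /\ hold E P (x ▹ s) A.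
Proof.
  simpl; split.
  - intros H; apply NNPP; intros N; apply H; intros x Px Hx; apply N; eauto.
  - intros (x & Px & Hx) H; eapply H; eauto.
Qed.
Lemma hold_AllIn P s y A :
  hold E P s (AllIn y A) <-> forall x, P x -> E x (s y) -> hold E P (x ▹ s) A.
Proof. reflexivity. Qed.
Lemma hold_ExIn P s y A :
  hold E P s (ExIn y A) <-> exists x, P x /\ E x (s y) /\ hold E P (x ▹ s) A.
Proof.
  simpl; split.
  - intros H; apply NNPP; intros N; apply H; intros x Px Hx HA; apply N; eauto.
  - intros (x & Px & Hx & HA) H; eapply H; eauto.
Qed.

(** A bounded quantifier ranges over the elements of a value of the assignment, and both classes
    contain all of these by downward closure. *)
Lemma Delta0_absolute P Q s A :
  Delta0 A -> (forall i, P (s i)) -> (forall i, Q (s i)) ->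
  (forall x y, E x y -> P y -> P x) -> (forall x y, E x y -> Q y -> Q x) ->
  hold E P s A <-> hold E Q s A.
Proof.
  intros H; revert s; induction H; intros s HP HQ TP TQ; try (simpl; tauto).
  - simpl. rewrite IHDelta0_1, IHDelta0_2; tauto.
  - rewrite !hold_AllIn.
    split; intros H1 x Px Hx; apply IHDelta0; auto; try (intros [|i]; simpl; eauto); eauto.
Qed.

Lemma logical_sound s A : logical A -> sat E s A.
Proof.
  intros H; destruct H; simpl; auto.
  - intros H; apply NNPP; auto.
  - intros H x _. apply hold_shift; auto.
  - intros H. apply (H (s i)); auto.
  - intros -> ->; auto.
  - intros ->; auto.
  - intros ->; auto.
Qed.

Lemma soundness (T : form -> Prop) A :
  prv T A -> (forall B, T B -> forall s, sat E s B) -> forall s, sat E s A.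
Proof.
  intros H HT; induction H; intros s; auto.
  - apply logical_sound; auto.
  - apply (IHprv1 s), IHprv2.
  - intros x _; auto.
Qed.

End Hold.

(** * Completeness *)

Section Hilbert.
Variable T : form -> Prop.
Hypothesis HT : theory T.

Lemma logical_ren r A : logical A -> logical (ren r A).
Proof.
  intros H; destruct H; simpl; try constructor.
  rewrite ren_shift0; constructor.
Qed.

(** The axioms of T are sentences and hence fixed by renaming; the logical axioms are closed under
    it. *)
Lemma prv_ren r A : prv T A -> prv T (ren r A).
Proof.
  intros H; revert r; induction H; intros r; simpl.
  - rewrite ren_sentence by auto. apply P_ax; auto.
  - apply P_log, logical_ren; auto.
  - apply (P_mp _ (ren r A)); [apply (IHprv1 r) | auto].
  - apply P_gen; auto.
Qed.

(** The head of the list becomes the innermost premise. The deduction theorem is then a conversion,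
    [D (B :: G) A] being [D G (B ⇒ A)], which the later uses of [change] exploit. *)
Fixpoint imps (G : list form) (A : form) : form :=
  match G with [] => A | B :: G => imps G (B ⇒ A) end.

Definition D (G : list form) (A : form) : Prop := prv T (imps G A).

Lemma D_prv G A : prv T A -> D G A.
Proof.
  revert A; induction G; unfold D; simpl; auto. intros A H. apply IHG.
  eapply P_mp; [apply P_log, L_K | auto].
Qed.

Lemma D_log G A : logical A -> D G A.
Proof. intros; apply D_prv, P_log; auto. Qed.

Lemma D_mp G A B : D G (A ⇒ B) -> D G A -> D G B.
Proof.
  revert A B; induction G; unfold D; simpl.
  - intros; eapply P_mp; eauto.
  - intros A0 B0 H1 H2.
    apply (IHG (a ⇒ A0)); auto. apply (IHG (a ⇒ A0 ⇒ B0)); auto.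
    apply D_log, L_S.
Qed.

Lemma D_weaken G A B : D G A -> D G (B ⇒ A).
Proof. apply D_mp, D_log, L_K. Qed.

Lemma D_hyp G A : In A G -> D G A.
Proof.
  revert A; induction G; simpl; [tauto|]. intros A [->|H].
  - change (D G (A ⇒ A)).
    apply D_mp with (A ⇒ A ⇒ A); [|apply D_log, L_K].
    apply D_mp with (A ⇒ (A ⇒ A) ⇒ A); [apply D_log, L_S|apply D_log, L_K].
  - apply (D_weaken G); auto.
Qed.

Lemma D_incl G G' A : incl G G' -> D G A -> D G' A.
Proof.
  revert A; induction G; intros A Hi H.
  - apply D_prv; auto.
  - apply D_mp with a; [apply IHG; auto | apply D_hyp; apply Hi; left; auto].
    intros x Hx; apply Hi; right; auto.
Qed.

Lemma D_tail G A B : D G A -> D (B :: G) A.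
Proof. apply D_incl; red; simpl; auto. Qed.

Lemma D_raa G A : D ((¬ A) :: G) Bot -> D G A.
Proof. intros H. apply D_mp with ((A ⇒ Bot) ⇒ Bot); auto. apply D_log, L_DN. Qed.

Lemma D_exfalso G A : D G Bot -> D G A.
Proof. intros H; apply D_raa, D_tail; auto. Qed.

(** The hypotheses are discharged one at a time: [L_dist] moves the quantifier onto each of them,
    and [L_vac] supplies the quantified shifted hypothesis. *)
Lemma D_gen G A : D (map (shift 0) G) A -> D G (All A).
Proof.
  revert A; induction G; simpl; intros A H.
  - apply P_gen; auto.
  - apply IHG in H. change (D G (a ⇒ All A)). change (D (a :: G) (All A)).
    apply D_mp with (All (shift 0 a)).
    + apply D_tail. eapply D_mp; [apply D_log, L_dist|]; auto.
    + eapply D_mp; [apply D_log, L_vac|]. apply D_hyp; simpl; auto.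
Qed.

Lemma D_ren r G A : D G A -> D (map (ren r) G) (ren r A).
Proof.
  revert A; induction G; simpl; intros A H.
  - apply prv_ren; auto.
  - apply (IHG (a ⇒ A)); auto.
Qed.

Lemma D_shift G A : D G A -> D (map (shift 0) G) (shift 0 A).
Proof.
  intros H. rewrite (map_ext _ _ shift0_ren), shift0_ren. apply D_ren; auto.
Qed.

Lemma D_ex_elim G A B : D (A :: map (shift 0) G) (shift 0 B) -> D G (Ex A) -> D G B.
Proof.
  intros H1 H2. apply D_raa. apply D_mp with (All (¬ A)); [apply D_tail; auto|].
  apply D_gen. simpl. change (D (A :: (shift 0 B ⇒ Bot) :: map (shift 0) G) Bot).
  apply D_mp with (shift 0 B); [apply D_hyp; simpl; auto|].
  eapply D_incl; [|apply H1]. red; simpl; intuition.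
Qed.

(** [L_ex] gives some x equal to i, and [L_eq] with this equation as both premises gives i = i. *)
Lemma D_refl G i : D G (Equ i i).
Proof.
  apply D_ex_elim with (Equ 0 (S i)); [|apply D_log, L_ex].
  simpl. eapply D_mp; [eapply D_mp; [apply D_log, (L_eq 0)|]|]; apply D_hyp; simpl; auto.
Qed.

Lemma D_sym G i j : D G (Equ i j) -> D G (Equ j i).
Proof.
  intros H. eapply D_mp; [eapply D_mp; [apply D_log, (L_eq i)|auto]|]. apply D_refl.
Qed.

Lemma D_trans G i j k : D G (Equ i j) -> D G (Equ j k) -> D G (Equ i k).
Proof.
  intros H H'. eapply D_mp; [eapply D_mp; [apply D_log, (L_eq j)|]|auto].
  apply D_sym; auto.
Qed.

Lemma D_mem G i j i' j' :
  D G (Equ i i') -> D G (Equ j j') -> D G (Mem i j) -> D G (Mem i' j').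
Proof.
  intros H1 H2 H3.
  eapply D_mp; [eapply D_mp; [apply D_log, (L_memr j)|auto]|].
  eapply D_mp; [eapply D_mp; [apply D_log, (L_meml i)|auto]|]. auto.
Qed.

(** Comparing two pointwise equal renamings, instead of replacing one variable, lets the induction
    pass under quantifiers, where both renamings are lifted. *)
Lemma D_leibniz A : forall G r r',
  (forall i, D G (Equ (r i) (r' i))) -> D G (ren r A ⇒ ren r' A).
Proof.
  induction A; simpl; intros G r r' H.
  - change (D (Mem (r i) (r j) :: G) (Mem (r' i) (r' j))).
    eapply D_mem; [apply D_tail; auto .. | apply D_hyp; simpl; auto].
  - change (D (Equ (r i) (r j) :: G) (Equ (r' i) (r' j))).
    apply D_trans with (r i); [apply D_sym, D_tail; auto|].
    apply D_trans with (r j); [|apply D_tail; auto]. apply D_hyp; simpl; auto.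
  - apply (D_hyp (Bot :: G)); simpl; auto.
  - change (D (ren r' A1 :: (ren r A1 ⇒ ren r A2) :: G) (ren r' A2)).
    apply D_mp with (ren r A2); [apply D_tail, D_tail; auto|].
    apply D_mp with (ren r A1); [apply D_hyp; simpl; auto|].
    apply D_mp with (ren r' A1); [|apply D_hyp; simpl; auto].
    apply D_tail, D_tail, IHA1. intros i; apply D_sym; auto.
  - eapply D_mp; [apply D_log, L_dist|]. apply D_gen, IHA.
    intros [|i]; simpl; [apply D_refl|]. apply (D_shift G (Equ (r i) (r' i))); auto.
Qed.

(** By Leibniz, A(x) and x = i imply A(i), in which x does not occur. If A(i) failed, then x ≠ i
    would hold for all x, against [L_ex]. *)
Lemma D_inst G A i : D G (All A) -> D G (inst i A).
Proof.
  intros H. set (E := Equ 0 (S i)). set (B := inst i A).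
  assert (HB : shift 0 B = ren (ncons (S i) S) A).
  { unfold B, inst. rewrite shift0_ren, ren_ren. apply ren_ext; intros [|k]; auto. }
  assert (H1 : prv T (A ⇒ E ⇒ shift 0 B)).
  { change (D [E; A] (shift 0 B)). apply D_mp with A; [|apply D_hyp; simpl; auto].
    rewrite HB. rewrite <- (ren_id A) at 2. apply D_leibniz.
    intros [|k]; simpl; [apply D_hyp; simpl; auto | apply D_refl]. }
  assert (H2 : D G (All (E ⇒ shift 0 B))).
  { eapply D_mp; [|exact H]. eapply D_mp; [apply D_log, L_dist|].
    apply D_prv, P_gen; auto. }
  apply D_raa. apply D_mp with (All (¬ E)); [apply D_log, L_ex|].
  apply D_mp with (All (shift 0 (¬ B))).
  - eapply D_mp; [apply D_log, L_dist|].
    apply D_mp with (All (E ⇒ shift 0 B)); [|apply D_tail; auto].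
    eapply D_mp; [apply D_log, L_dist|]. apply D_prv, P_gen.
    change (D [E; shift 0 (¬ B); E ⇒ shift 0 B] Bot). simpl.
    apply D_mp with (shift 0 B); [apply D_hyp; simpl; auto|].
    apply D_mp with E; apply D_hyp; simpl; auto.
  - eapply D_mp; [apply D_log, L_vac|]. apply D_hyp; simpl; auto.
Qed.

Definition consistent (G : list form) : Prop := ~ D G Bot.

(* A variable k not free in G plays the role of a Henkin constant: the renaming
   k |-> 0, i |-> i + 1 turns [inst k B] back into B. *)
Lemma consistent_henkin G B k :
  In (¬ All B) G -> fv_lt (S k) B -> (forall A, In A G -> fv_lt k A) ->
  consistent G -> consistent ((¬ inst k B) :: G).
Proof.
  intros HB Hk HG HC H. apply HC.
  apply D_mp with (All B); [apply D_hyp; auto|].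
  apply D_gen. apply D_raa.
  set (r := fun i => if Nat.eq_dec i k then 0 else S i).
  apply (D_ren r) in H. simpl in H.
  replace (ren r (inst k B)) with B in H.
  - replace (map (shift 0) G) with (map (ren r) G); auto.
    apply map_ext_in; intros A HA. rewrite shift0_ren.
    apply (ren_ext_fv k); auto. intros i Hi; unfold r.
    destruct (Nat.eq_dec i k); [lia|auto].
  - unfold inst. rewrite ren_ren. symmetry. apply (ren_fv_id (S k)); auto.
    intros [|i] Hi; unfold r; simpl.
    + destruct (Nat.eq_dec k k); [auto|tauto].
    + destruct (Nat.eq_dec i k); [lia|auto].
Qed.

End Hilbert.

(** * An enumeration of all formulas *)

Fixpoint decode_form (fuel n : nat) : form :=
  match fuel with
  | 0 => Bot
  | S fuel =>
      let (c, m) := Cantor.of_nat n in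
      let (a, b) := Cantor.of_nat m in
      match c with
      | 0 => Mem a b
      | 1 => Equ a b
      | 2 => decode_form fuel a ⇒ decode_form fuel b
      | 3 => All (decode_form fuel m)
      | _ => Bot
      end
  end.

Lemma decode_form_onto A :
  exists k, forall fuel, k <= fuel -> exists n, decode_form fuel n = A.
Proof.
  induction A.
  - exists 1; intros [|f] Hf; [lia|]. exists (to_nat (0, to_nat (i, j))).
    cbn [decode_form]; rewrite !cancel_of_to; auto.
  - exists 1; intros [|f] Hf; [lia|]. exists (to_nat (1, to_nat (i, j))).
    cbn [decode_form]; rewrite !cancel_of_to; auto.
  - exists 1; intros [|f] Hf; [lia|]. exists (to_nat (4, 0)).
    cbn [decode_form]; rewrite !cancel_of_to; destruct (of_nat 0); auto.
  - destruct IHA1 as [k1 H1], IHA2 as [k2 H2]. exists (S (k1 + k2)).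
    intros [|f] Hf; [lia|].
    destruct (H1 f) as [n1 <-], (H2 f) as [n2 <-]; try lia.
    exists (to_nat (2, to_nat (n1, n2))).
    cbn [decode_form]; rewrite !cancel_of_to; auto.
  - destruct IHA as [k H]. exists (S k). intros [|f] Hf; [lia|].
    destruct (H f) as [n <-]; try lia. exists (to_nat (3, n)).
    cbn [decode_form]; rewrite !cancel_of_to; destruct (of_nat n); auto.
Qed.

Definition enum_form (k : nat) : form :=
  let (fuel, n) := Cantor.of_nat k in decode_form fuel n.

Lemma enum_form_onto A : exists k, enum_form k = A.
Proof.
  destruct (decode_form_onto A) as [k H]. destruct (H k) as [n Hn]; auto.
  exists (to_nat (k, n)). unfold enum_form; rewrite cancel_of_to; auto.
Qed.

(** * The Henkin construction and the term model *)

Section Henkin.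
Variables (T : form -> Prop) (A0 : form).
Hypotheses (HT : theory T) (HA0 : ~ prv T A0).

Definition fresh (G : list form) : nat :=
  proj1_sig (constructive_indefinite_description _
    (fv_lt_bound (fold_right Imp Bot G))).

Lemma fresh_spec G A : In A G -> fv_lt (fresh G) A.
Proof.
  unfold fresh. destruct (constructive_indefinite_description _ _) as [n Hn]; simpl.
  induction G; simpl in *; [tauto|]. intros [<-|H]; tauto.
Qed.

(** A negated universal formula is accepted together with a counterexample named by a fresh
    variable, so that a single pass through the enumeration yields both completeness and Henkin
    witnesses. *)
Definition add (A : form) (G : list form) : list form :=
  if excluded_middle_informative (consistent T (A :: G)) then
    match A with
    | Imp (All B) Bot => (¬ inst (fresh (A :: G)) B) :: A :: G
    | _ => A :: G
    end
  else G.

Lemma add_consistent A G : consistent T G -> consistent T (add A G).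
Proof.
  intros HG; unfold add. destruct excluded_middle_informative as [c|]; auto.
  destruct A as [| | |A B|]; auto. destruct A; auto. destruct B; auto.
  assert (F := fresh_spec ((All A ⇒ Bot) :: G)).
  apply consistent_henkin; auto.
  - simpl; auto.
  - apply (F (¬ All A)); simpl; auto.
Qed.

Fixpoint stage (n : nat) : list form :=
  match n with
  | 0 => [¬ A0]
  | S n => add (enum_form n) (stage n)
  end.

Lemma stage_consistent n : consistent T (stage n).
Proof.
  induction n; simpl; [|apply add_consistent; auto].
  intros H. apply HA0. apply (D_raa T [] A0 H).
Qed.

Lemma add_incl A G : incl G (add A G).
Proof.
  unfold add. destruct excluded_middle_informative; [|apply incl_refl].
  destruct A as [| | |A B|]; try apply incl_tl, incl_refl.
  destruct A, B; try apply incl_tl, incl_refl. apply incl_tl, incl_tl, incl_refl.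
Qed.

Lemma stage_mono n m : n <= m -> incl (stage n) (stage m).
Proof.
  induction 1; [apply incl_refl|]. eapply incl_tran; [eauto|]. apply add_incl.
Qed.

Definition henkin (A : form) : Prop := exists n, In A (stage n).

(** When the turn of A comes it cannot be rejected: otherwise a stage beyond both that point and [n]
    would derive A and refute it. *)
Lemma henkin_D n A : D T (stage n) A -> henkin A.
Proof.
  intros H. destruct (enum_form_onto A) as [m Hm].
  exists (S m). simpl. rewrite Hm. unfold add.
  destruct excluded_middle_informative as [c|c].
  - destruct A as [| | |A B|]; try (left; reflexivity).
    destruct A, B; simpl; auto.
  - exfalso. apply c. intros H1.
    apply (stage_consistent (n + m)).
    apply D_mp with A; [|apply D_incl with (stage n); auto; apply stage_mono; lia].
    apply D_incl with (stage m); [apply stage_mono; lia|auto].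
Qed.

Lemma henkin_D2 A B C :
  henkin A -> henkin B -> D T [A; B] C -> henkin C.
Proof.
  intros [n Hn] [m Hm] H. apply (henkin_D (n + m)).
  apply D_incl with [A; B]; auto. intros x [<-|[<-|[]]].
  - apply (stage_mono n); auto; lia.
  - apply (stage_mono m); auto; lia.
Qed.

Lemma henkin_D1 A C : henkin A -> D T [A] C -> henkin C.
Proof. intros H1 H2; apply (henkin_D2 A A C); auto. apply D_tail; auto. Qed.

Lemma henkin_prv A : prv T A -> henkin A.
Proof. intros H. apply (henkin_D 0), D_prv; auto. Qed.

Lemma henkin_not_bot : ~ henkin Bot.
Proof. intros [n H]. apply (stage_consistent n). apply D_hyp; auto. Qed.

Lemma henkin_imp A B : henkin (A ⇒ B) <-> (henkin A -> henkin B).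
Proof.
  split.
  - intros H1 H2. apply (henkin_D2 (A ⇒ B) A); auto.
    apply D_mp with A; apply D_hyp; simpl; auto.
  - intros H. destruct (classic (henkin A)) as [HA|HA].
    + apply (henkin_D1 B); auto. apply D_weaken, D_hyp; simpl; auto.
    (* A formula that never enters was rejected at its own stage as inconsistent, so that stage
       derives its negation. *)
    + assert (HN : henkin (¬ A)).
      { destruct (enum_form_onto A) as [m Hm].
        apply (henkin_D m). apply NNPP; intros c. apply HA. exists (S m). simpl.
        rewrite Hm. unfold add. destruct excluded_middle_informative as [c'|c'].
        - destruct A as [| | |A1 B1|]; try (left; reflexivity).
          destruct A1, B1; simpl; auto.
        - exfalso; apply c', c. }
      apply (henkin_D1 (¬ A)); auto. change (D T [A; ¬ A] B).
      apply D_exfalso. apply D_mp with A; apply D_hyp; simpl; auto.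
Qed.

(** If [All A] is absent, its negation was accepted at some stage, and that same stage received a
    negated instance. *)
Lemma henkin_all A : henkin (All A) <-> forall i, henkin (inst i A).
Proof.
  split.
  - intros H i. apply (henkin_D1 (All A)); auto. apply D_inst; auto. apply D_hyp; simpl; auto.
  - intros H. apply NNPP; intros HA.
    assert (HN : henkin (¬ All A)) by (apply henkin_imp; tauto).
    destruct (enum_form_onto (¬ All A)) as [m Hm].
    assert (c : consistent T ((¬ All A) :: stage m)).
    { intros c. apply HA, (henkin_D m), D_raa; auto. }
    apply henkin_not_bot.
    apply (proj1 (henkin_imp (inst (fresh ((¬ All A) :: stage m)) A) Bot)); [|apply H].
    exists (S m). simpl. rewrite Hm. unfold add.
    destruct excluded_middle_informative; [|tauto]. simpl; auto.
Qed.

Lemma henkin_refl i : henkin (Equ i i).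
Proof. apply henkin_prv. apply (D_refl T []). Qed.
Lemma henkin_sym i j : henkin (Equ i j) -> henkin (Equ j i).
Proof. intros H; apply (henkin_D1 _ _ H). apply D_sym, D_hyp; simpl; auto. Qed.
Lemma henkin_trans i j k : henkin (Equ i j) -> henkin (Equ j k) -> henkin (Equ i k).
Proof.
  intros H1 H2; apply (henkin_D2 _ _ _ H1 H2).
  apply D_trans with j; auto; apply D_hyp; simpl; auto.
Qed.

(** Since [hold] reads equality as identity, variables have to be identified when their equality
    belongs to [henkin]. Classes are taken as predicates, which coincide by functional and
    propositional extensionality. *)
Definition cls_fun (i : nat) : nat -> Prop := fun j => henkin (Equ i j).
Definition term_model : Type := {c : nat -> Prop | exists i, c = cls_fun i}.
Definition cls (i : nat) : term_model := exist _ (cls_fun i) (ex_intro _ i eq_refl).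
Definition term_mem (c d : term_model) : Prop :=
  exists i j, c = cls i /\ d = cls j /\ henkin (Mem i j).

Lemma cls_onto c : exists i, c = cls i.
Proof.
  destruct c as [c [i ->]]. exists i. reflexivity.
Qed.

Lemma cls_eq i j : cls i = cls j <-> henkin (Equ i j).
Proof.
  split.
  - intros H. apply (f_equal (@proj1_sig _ _)) in H; simpl in H.
    change (cls_fun i j). rewrite H. apply henkin_refl.
  - intros H. assert (X : cls_fun i = cls_fun j).
    { extensionality k. apply propositional_extensionality. unfold cls_fun; split; intros H'.
      - apply henkin_trans with i; auto; apply henkin_sym; auto.
      - apply henkin_trans with j; auto. }
    apply eq_sig_hprop; auto. intros; apply proof_irrelevance.
Qed.

Lemma term_model_truth r A : sat term_mem (fun i => cls (r i)) A <-> henkin (ren r A).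
Proof.
  revert r; induction A; simpl; intros r.
  - split; [|intros H; exists (r i), (r j); auto].
    intros (i' & j' & Hi & Hj & H). rewrite cls_eq in Hi, Hj.
    apply henkin_sym in Hi, Hj.
    destruct Hi as [n Hi], Hj as [m Hj], H as [k H].
    apply (henkin_D (n + m + k)). apply D_mem with i' j'; auto;
      apply D_hyp; eapply stage_mono; try eassumption; lia.
  - apply cls_eq.
  - split; [tauto|]. apply henkin_not_bot.
  - rewrite henkin_imp, IHA1, IHA2; tauto.
  - rewrite henkin_all.
    assert (X : forall i, sat term_mem (cls i ▹ (fun i => cls (r i))) A <->
                     henkin (inst i (ren (up r) A))).
    { intros i. unfold inst; rewrite ren_ren.
      replace (cls i ▹ (fun i => cls (r i)))
        with (fun k => cls (ncons i r k)) by (extensionality k; destruct k; auto).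
      rewrite IHA. erewrite ren_ext; [reflexivity|]. intros [|k]; reflexivity. }
    split.
    + intros H i. apply X; auto.
    + intros H x _. destruct (cls_onto x) as [i ->]. apply X; auto.
Qed.

Lemma term_model_theory B s : T B -> sat term_mem s B.
Proof.
  intros HB. apply (hold_fv _ _ _ 0 s (fun i => cls i)); [apply HT; auto|lia|].
  apply (term_model_truth (fun i => i)). rewrite ren_id. apply henkin_prv, P_ax; auto.
Qed.

Lemma term_model_refutes : ~ sat term_mem (fun i => cls i) A0.
Proof.
  rewrite (term_model_truth (fun i => i)), ren_id. intros H. apply henkin_not_bot.
  apply (proj1 (henkin_imp A0 Bot)); auto. exists 0; simpl; auto.
Qed.

End Henkin.

Theorem completeness (T : form -> Prop) A :
  theory T ->
  (forall (M : Type) (E : M -> M -> Prop),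
     (forall B, T B -> forall s, sat E s B) -> forall s, sat E s A) ->
  prv T A.
Proof.
  intros HT H. apply NNPP; intros HA. apply (term_model_refutes T A HT HA).
  apply H. intros B HB s; apply term_model_theory; auto.
Qed.

(** * The fixed point *)

(** [fSucc], [fUPair] and [fPair] quantify over the universe. Bounded variants are required here,
    since they become part of the Δ0 matrix of [gamma]. *)
Definition succ_bounded (y x : nat) : form :=
  AllIn y (Mem 0 (S x) ∨ Equ 0 (S x)) ∧ AllIn x (Mem 0 (S y)) ∧ Mem x y.
Definition upair_bounded (z x y : nat) : form :=
  AllIn z (Equ 0 (S x) ∨ Equ 0 (S y)) ∧ Mem x z ∧ Mem y z.
Definition pair_bounded (p x y : nat) : form :=
  AllIn p (upair_bounded 0 (S x) (S x) ∨ upair_bounded 0 (S x) (S y))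
  ∧ ExIn p (upair_bounded 0 (S x) (S x)) ∧ ExIn p (upair_bounded 0 (S x) (S y)).

(* A Delta0 formula defining the closed term t. All quantifiers are bounded by
   elements of the transitive closure of variable 0, its only free variable, so
   that its code is computed from those for the subterms of t without shifts. *)
Fixpoint theta (t : hterm) : form :=
  match t with
  | hvar _ => Bot
  | hzero => AllIn 0 Bot
  | hsucc t => ExIn 0 (theta t ∧ succ_bounded 1 0)
  | hpair t u =>
      ExIn 0 (ExIn 0 (* [a; c; v] *) (theta t ∧
        ExIn 2 (ExIn 0 (* [b; d; a; c; v] *) (theta u ∧ pair_bounded 4 2 0))))
  end.

Definition cThetaSucc (q : hterm) : hterm := cExIn 0 (cAnd q (quote (succ_bounded 1 0))).
Definition cThetaPair (q r : hterm) : hterm :=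
  cExIn 0 (cExIn 0 (cAnd q (cExIn 2 (cExIn 0 (cAnd r (quote (pair_bounded 4 2 0))))))).

(* Terms in which successors are only applied to numerals; this makes the
   decomposition of their values unambiguous. *)
Fixpoint canonical (t : hterm) : Prop :=
  match t with
  | hvar _ => False
  | hzero => True
  | hsucc t => exists n, t = num n
  | hpair t u => canonical t /\ canonical u
  end.

Lemma canonical_num n : canonical (num n).
Proof. destruct n; simpl; eauto. Qed.

Lemma canonical_quote A : canonical (quote A).
Proof.
  assert (N := canonical_num).
  induction A; simpl; repeat split; eauto; try (exists 0; reflexivity);
    try (exists 1; reflexivity); try (exists 2; reflexivity); exists 3; reflexivity.
Qed.

Lemma Delta0_theta t : Delta0 (theta t).
Proof.
  induction t; simpl; repeat (apply Delta0_ExIn || apply Delta0_And); auto;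
    repeat constructor.
Qed.

Lemma fv_lt_theta t : fv_lt 1 (theta t).
Proof.
  induction t; simpl; repeat split; auto; try lia;
    try (apply (fv_lt_mono 1); auto; lia).
Qed.

(* q is the code of the formula defining (the term with value) v *)
Definition fQuoteRel (v q : nat) : form :=
  Ex (hpair (S v) (S q) ∊ 0 ∧ AllIn 0 (Ex (Ex (* [q; e; r; S | ..] *)
    (2 ≐ hpair 1 0 ∧
      ( (1 ≐ hzero ∧ 0 ≐ quote (theta hzero))
      ∨ Ex (Ex (* [q1; e1; q; e; r; S | ..] *)
          (3 ≐ hsucc 1 ∧ 2 ≐ cThetaSucc 0 ∧ hpair 1 0 ∊ 5 ∧ hzero ∊ 3))
      ∨ Ex (Ex (Ex (Ex (* [q2; e2; q1; e1; q; e; r; S | ..] *)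
          (5 ≐ hpair 3 1 ∧ 4 ≐ cThetaPair 2 0 ∧ hpair 3 2 ∊ 7 ∧ hpair 1 0 ∊ 7))))))))).

(** A Δ0 condition under which u contains every standard code and, with given elements, every finite
    set or sequence formed from them. The last clause makes c equal to a ∪ {b}. *)
Definition fClosed (u : nat) : form :=
  fTrans u ∧ ExIn u (AllIn 0 Bot) ∧
  AllIn u (AllIn (S u) (ExIn (2 + u) (* [c; b; a | ..] *)
    (AllIn 0 (Mem 0 3 ∨ Equ 0 2) ∧ AllIn 2 (Mem 0 1) ∧ Mem 1 0))).

Section FixedPoint.
Variables R F0 : form.

(** With e the code of [beta] and q the code of [theta (quote beta)], this is the code of
    [gamma]. *)
Definition cGamma (q e : hterm) : hterm :=
  cExInL R (cExIn 0 (cExIn 0 (cAnd q e))).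

(* p is a sequence of formulas ending with the sentence that speaks about v *)
Definition fSeqFor (p v : nat) : form :=
  Ex (Ex (* [f; q | ..] *) (fQuoteRel (2 + v) 1 ∧ 0 ≐ cGamma 1 (2 + v) ∧
    Ex (Ex (* [n; m; f; q | ..] *)
      (fNat 0 ∧ fSucc 0 1 ∧ fFun (4 + p) 0 ∧ hpair 1 2 ∊ (4 + p))))).

(* the line (i, g) of p (variables 1 and 0) is not justified by logic *)
Definition fNonLogicalLine (p : nat) : form :=
  hpair 1 0 ∊ p ∧ ¬ fLogical 0
  ∧ ¬ ExIn 1 (ExIn 2 (Ex (* [e; k; j; g; i | ..] *)
        (hpair 2 (cImp 0 3) ∊ (3 + p) ∧ hpair 1 0 ∊ (3 + p))))
  ∧ ¬ ExIn 1 (Ex (* [e; j; g; i | ..] *) (hpair 1 0 ∊ (2 + p) ∧ 2 ≐ cAll 0)).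

(* Before relativizing a formula to u, its irrelevant variables are renamed so
   that all of them have values in u. *)
Definition pick3 (a b c i : nat) : nat :=
  match i with 0 => a | 1 => b | _ => c end.

(* some line of p is neither justified by logic nor an axiom satisfying
   F0(w, .) for all w in y *)
Definition fBadLine (y p u : nat) : form :=
  ExIn u (ExIn (S u) (* [g; i | ..] *)
    (rel (2 + u) (ren (pick3 0 1 (2 + p)) (fNonLogicalLine 2))
     ∧ ¬ (rel (2 + u) (ren (pick3 0 0 0) (fFormIn 0 0)) ∧ AllIn (2 + y) F0))).

(* [v; u; x] *)
Definition beta0 : form :=
  fClosed 1 ∧ ExIn 2 (AllIn 2 (* [p; b; v; u; x] *)
    (rel 3 (ren (pick3 0 2 2) (fSeqFor 0 1)) ⇒ ExIn 1 (fBadLine 0 1 4))).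
(* The renaming only serves to make it evident that 0, 1, 2 are the only free
   variables. *)
Definition beta : form := ren (fun i => Nat.min i 2) beta0.
(** The intended x is {u, b}, with b the set in which [beta] looks for the bounds y. The
    diagonalization consists in letting [theta] force v to be the code of [beta], while [beta]
    computes from v the code of the whole sentence. *)
Definition delta : form := ExIn 0 (ExIn 0 (* [v; u; x] *) (theta (quote beta) ∧ beta)).
Definition gamma : form := ExInL R delta.

(* The instance of collection for "p is not a proof in view of y", [y; p; u; v]. *)
Definition coll_matrix : form :=
  rel 2 (ren (pick3 1 3 3) (fSeqFor 0 1)) ⇒ fBadLine 0 1 2.

Hypothesis HF0 : Delta0 F0.

Lemma Delta0_fBadLine y p u : Delta0 (fBadLine y p u).
Proof.
  unfold fBadLine. apply Delta0_ExIn, Delta0_ExIn, Delta0_And; [apply Delta0_rel|].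
  apply Delta0_Neg, Delta0_And; [apply Delta0_rel|constructor; auto].
Qed.

Lemma Delta0_coll_matrix : Delta0 coll_matrix.
Proof. constructor; [apply Delta0_rel|apply Delta0_fBadLine]. Qed.

Lemma Delta0_beta : Delta0 beta.
Proof.
  apply Delta0_ren. apply Delta0_And.
  - unfold fClosed. repeat (apply Delta0_ExIn || apply Delta0_And || constructor).
  - apply Delta0_ExIn. constructor. constructor; [apply Delta0_rel|].
    apply Delta0_ExIn, Delta0_fBadLine.
Qed.

Lemma Delta0_delta : Delta0 delta.
Proof.
  apply Delta0_ExIn, Delta0_ExIn, Delta0_And; [apply Delta0_theta|apply Delta0_beta].
Qed.

Lemma fv_lt_delta : fv_lt 1 delta.
Proof.
  assert (H1 : fv_lt 3 (theta (quote beta))) by (apply (fv_lt_mono 1); [lia|apply fv_lt_theta]).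
  assert (H2 : fv_lt 3 beta) by (apply fv_lt_ren_range; intros; lia).
  unfold delta. apply fv_lt_ExIn; [lia|]. apply fv_lt_ExIn; [lia|].
  apply fv_lt_And; assumption.
Qed.

End FixedPoint.

(** The axiom that fails may vary from one model of T to another, so T proves only a disjunction. In
    each disjunct, x contains both the code of the axiom and the witness w against it. *)
Definition fRefuted (F0 : form) (l : list form) : form :=
  fold_right (fun A B => ExIn 0 (theta (quote A) ∧ ExIn 1 (* [w; g; x] *) (¬ F0)) ∨ B) Bot l.

Lemma Delta0_fRefuted F0 l : Delta0 F0 -> Delta0 (fRefuted F0 l).
Proof.
  intros H; induction l; simpl; [constructor|]. apply Delta0_Or; auto.
  apply Delta0_ExIn, Delta0_And; [apply Delta0_theta|]. apply Delta0_ExIn, Delta0_Neg; auto.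
Qed.

Lemma fv_lt_fRefuted F0 l : fv_lt 2 F0 -> fv_lt 1 (fRefuted F0 l).
Proof.
  intros H; induction l; [exact I|].
  assert (X : fv_lt 1 (ExIn 0 (theta (quote a) ∧ ExIn 1 (¬ F0)))).
  { apply fv_lt_ExIn; [lia|]. apply fv_lt_And.
    - apply (fv_lt_mono 1); [lia|apply fv_lt_theta].
    - apply fv_lt_ExIn; [lia|]. split; [apply (fv_lt_mono 2); auto|exact I]. }
  split; [split; [exact X|exact I]|exact IHl].
Qed.

(** * Actual proofs *)

(** The premises of a line are given by earlier positions, exactly as in [fPr] and
    [fNonLogicalLine], so that a list of this kind can be read line by line inside a model. *)
Definition proof_seq (T : form -> Prop) (l : list form) : Prop :=
  forall i A, nth_error l i = Some A ->
    logical A \/ T A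
    \/ (exists j k B, j < i /\ k < i /\ nth_error l j = Some (B ⇒ A) /\ nth_error l k = Some B)
    \/ (exists j B, j < i /\ nth_error l j = Some B /\ A = All B).

Lemma proof_seq_app T l1 l2 : proof_seq T l1 -> proof_seq T l2 -> proof_seq T (l1 ++ l2).
Proof.
  intros H1 H2 i A HA.
  assert (S1 : forall j B, nth_error l1 j = Some B -> nth_error (l1 ++ l2) j = Some B).
  { intros j B HB. rewrite nth_error_app1; auto. apply nth_error_Some; congruence. }
  assert (S2 : forall j B, nth_error l2 j = Some B -> nth_error (l1 ++ l2) (length l1 + j) = Some B).
  { intros j B HB. rewrite nth_error_app2 by lia.
    replace (length l1 + j - length l1) with j by lia; auto. }
  destruct (Nat.lt_ge_cases i (length l1)) as [Hi|Hi].
  - rewrite nth_error_app1 in HA by auto.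
    destruct (H1 i A HA) as [H|[H|[(j & k & B & Hj & Hk & X & Y)|(j & B & Hj & X & Y)]]]; auto.
    + do 2 right; left. exists j, k, B; auto.
    + do 3 right. exists j, B; auto.
  - rewrite nth_error_app2 in HA by auto.
    destruct (H2 _ A HA) as [H|[H|[(j & k & B & Hj & Hk & X & Y)|(j & B & Hj & X & Y)]]]; auto.
    + do 2 right; left. exists (length l1 + j), (length l1 + k), B. repeat split; auto; lia.
    + do 3 right. exists (length l1 + j), B. repeat split; auto; lia.
Qed.

Lemma proof_seq_snoc T l A : proof_seq T l ->
  (logical A \/ T A \/ (exists B, In (B ⇒ A) l /\ In B l) \/ (exists B, In B l /\ A = All B)) ->
  proof_seq T (l ++ [A]).
Proof.
  intros Hl H i B HB.
  assert (S1 : forall C, In C l -> exists j, j < length l /\ nth_error (l ++ [A]) j = Some C).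
  { intros C HC. apply In_nth_error in HC as [j Hj].
    assert (j < length l) by (apply nth_error_Some; congruence).
    exists j; split; auto. rewrite nth_error_app1; auto. }
  destruct (Nat.lt_ge_cases i (length l)) as [Hi|Hi].
  - rewrite nth_error_app1 in HB by auto.
    destruct (Hl i B HB) as [X|[X|[(j & k & C & Hj & Hk & X & Y)|(j & C & Hj & X & Y)]]]; auto.
    + do 2 right; left. exists j, k, C. rewrite !nth_error_app1 by lia. auto.
    + do 3 right. exists j, C. rewrite nth_error_app1 by lia. auto.
  - assert (i = length l) as ->.
    { assert (i < length (l ++ [A])) by (apply nth_error_Some; congruence).
      rewrite length_app in H0; simpl in H0; lia. }
    rewrite nth_error_app2, Nat.sub_diag in HB by lia. injection HB as <-.
    destruct H as [X|[X|[(C & X & Y)|(C & X & Y)]]]; auto.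
    + apply S1 in X as (j & Hj & X). apply S1 in Y as (k & Hk & Y).
      do 2 right; left. exists j, k, C; auto.
    + apply S1 in X as (j & Hj & X). do 3 right. exists j, C; auto.
Qed.

Lemma prv_proof_seq T A : prv T A -> exists l, proof_seq T (l ++ [A]).
Proof.
  assert (N : proof_seq T []) by (intros [|i] A' H; discriminate).
  assert (L : forall l (B : form), In B (l ++ [B])) by (intros; apply in_or_app; simpl; auto).
  intros H; induction H.
  - exists []. apply proof_seq_snoc; auto.
  - exists []. apply proof_seq_snoc; auto.
  - destruct IHprv1 as [l1 H1], IHprv2 as [l2 H2].
    exists ((l1 ++ [A ⇒ B]) ++ (l2 ++ [A])).
    apply proof_seq_snoc; [apply proof_seq_app; auto|].
    do 2 right; left. exists A. split; apply in_or_app; auto.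
  - destruct IHprv as [l Hl]. exists (l ++ [A]). apply proof_seq_snoc; auto.
    do 3 right. exists A; auto.
Qed.

(** * Adjunctive models *)

(** The part of set theory on which the coding of syntax rests. Having the empty set and adjunction
    as chosen operations turns terms and codes into elements of M that can be computed with. *)
Record adjunctive (M : Type) (E : M -> M -> Prop) := {
  zero : M;
  adj : M -> M -> M;
  ext : forall x y, (forall w, E w x <-> E w y) -> x = y;
  zero_spec : forall w, ~ E w zero;
  adj_spec : forall w a b, E w (adj a b) <-> E w a \/ w = b }.

Arguments zero {M E} _.
Arguments adj {M E} _ _ _.

Lemma hold_shift1 {M : Type} (E : M -> M -> Prop) P x y s A :
  hold E P (x ▹ y ▹ s) (shift 1 A) <-> hold E P (x ▹ s) A.
Proof.
  rewrite shift_ren, hold_ren.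
  replace (fun i => (x ▹ y ▹ s) (shift_var 1 i)) with (x ▹ s); [reflexivity|].
  extensionality i. destruct i; reflexivity.
Qed.

Section KP1Basics.
Variables (M : Type) (E : M -> M -> Prop).
Hypothesis HKP : forall A, KP1 A -> forall s, sat E s A.

(** The empty set is read off from Infinity, and x ∪ {y} is the union of {x, {y}}. *)
Lemma KP1_adjunctive : inhabited M -> inhabited (adjunctive M E).
Proof.
  intros [m]. set (s := fun _ : nat => m).
  assert (Hext : forall x y, (forall w, E w x <-> E w y) -> x = y).
  { intros x y H. apply (HKP Ext (KP_Ext _) s x I y I).
    intros w _. apply hold_Iff. exact (H w). }
  assert (Hpair : forall x y, exists p, forall w, E w p <-> w = x \/ w = y).
  { intros x y. assert (H := HKP Pairing (KP_Pairing _) s x I y I).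
    apply hold_Ex in H as (p & _ & H). exists p. intros w. specialize (H w I).
    apply hold_Iff in H. rewrite hold_Or in H. exact H. }
  assert (Hunion : forall x, exists p, forall w, E w p <-> exists y, E y x /\ E w y).
  { intros x. assert (H := HKP Union (KP_Union _) s x I).
    apply hold_Ex in H as (p & _ & H). exists p. intros w. specialize (H w I).
    apply hold_Iff in H. rewrite hold_ExIn in H. simpl in H. firstorder. }
  assert (Hzero : exists e, forall w, ~ E w e).
  { assert (H := HKP Infinity (KP_Infinity _) s).
    apply hold_Ex in H as (i & _ & H). apply hold_And in H as [H _].
    apply hold_ExIn in H as (e & _ & _ & H). exists e. intros w Hw. exact (H w I Hw). }
  assert (Hadj : forall x y, exists p, forall w, E w p <-> E w x \/ w = y).
  { intros x y. destruct (Hpair y y) as [q Hq], (Hpair x q) as [r Hr], (Hunion r) as [p Hp].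
    exists p. intros w. rewrite Hp. split.
    - intros (v & Hv & Hw). apply Hr in Hv as [->| ->]; auto. apply Hq in Hw; tauto.
    - intros [Hw| ->]; [exists x|exists q]; rewrite Hr; auto. rewrite Hq; auto. }
  destruct (constructive_indefinite_description _ Hzero) as [e He].
  set (ad := fun x y => proj1_sig (constructive_indefinite_description _ (Hadj x y))).
  assert (Had : forall w x y, E w (ad x y) <-> E w x \/ w = y).
  { intros w x y. exact (proj2_sig (constructive_indefinite_description _ (Hadj x y)) w). }
  exact (inhabits (Build_adjunctive M E e ad Hext He Had)).
Qed.

Lemma Pi1_induction A s : Delta0 A ->
  (forall x, (forall y, E y x -> forall z, sat E (z ▹ y ▹ s) A) -> forall z, sat E (z ▹ x ▹ s) A) ->
  forall x z, sat E (z ▹ x ▹ s) A.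
Proof.
  intros HA H x z.
  assert (K : KP1 (Ind (All A))) by (apply KP_Ind; right; exists A; auto).
  apply (HKP _ K s); auto. clear x z. intros x _ Hx z _. apply H.
  intros y Hy z' . apply (proj1 (hold_shift1 E _ y x s (All A)) (Hx y I Hy)); auto.
Qed.

(** A vacuous universal quantifier puts the Δ0 formula into the Π1 form that the induction schema
    demands. *)
Lemma Delta0_induction A s : Delta0 A ->
  (forall x, (forall y, E y x -> sat E (y ▹ s) A) -> sat E (x ▹ s) A) ->
  forall x, sat E (x ▹ s) A.
Proof.
  intros HA H x. rewrite <- (hold_shift _ _ _ x). apply Pi1_induction.
  - rewrite shift0_ren. apply Delta0_ren; auto.
  - intros y Hy z. rewrite hold_shift. apply H. intros y' Hy'.
    specialize (Hy y' Hy' z). rewrite hold_shift in Hy; auto.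
Qed.

End KP1Basics.

Section Models.
Variables (M : Type) (E : M -> M -> Prop) (W : adjunctive M E).
Implicit Types (P : M -> Prop) (s : nat -> M).
Local Notation zero := (zero W).
Local Notation adj := (adj W).
Local Notation univ := (fun _ : M => True).

Lemma not_in_zero w : ~ E w zero.
Proof. apply zero_spec. Qed.

Definition upr x y : M := adj (adj zero x) y.
Definition pr x y : M := upr (upr x x) (upr x y).
Definition suc x : M := adj x x.

Fixpoint tv (s : nat -> M) (t : hterm) : M :=
  match t with
  | hvar i => s i
  | hzero => zero
  | hsucc t => suc (tv s t)
  | hpair t u => pr (tv s t) (tv s u)
  end.

Definition numM (n : nat) : M := tv (fun _ => zero) (num n).
Definition codeM (A : form) : M := tv (fun _ => zero) (quote A).

Lemma upr_spec w x y : E w (upr x y) <-> w = x \/ w = y.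
Proof.
  unfold upr. rewrite !adj_spec. pose proof (not_in_zero w). tauto.
Qed.

Lemma pr_spec w x y : E w (pr x y) <-> w = upr x x \/ w = upr x y.
Proof. apply upr_spec. Qed.

Lemma upr_inj x y x' y' : upr x y = upr x' y' -> (x = x' /\ y = y') \/ (x = y' /\ y = x').
Proof.
  intros H.
  assert (H1 := upr_spec x x y). assert (H2 := upr_spec y x y).
  assert (H3 := upr_spec x' x y). assert (H4 := upr_spec y' x y).
  rewrite H, upr_spec in H1, H2, H3, H4.
  destruct H1 as [_ H1]; destruct H2 as [_ H2]; destruct H3 as [H3 _]; destruct H4 as [H4 _].
  destruct H1, H2, H3, H4; auto; subst; auto.
Qed.

Lemma pr_inj x y x' y' : pr x y = pr x' y' -> x = x' /\ y = y'.
Proof.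
  intros H. apply upr_inj in H. destruct H as [[H1 H2]|[H1 H2]];
    apply upr_inj in H1; apply upr_inj in H2; intuition congruence.
Qed.

Lemma suc_spec w x : E w (suc x) <-> E w x \/ w = x.
Proof. apply adj_spec. Qed.

Lemma tv_num s n : tv s (num n) = numM n.
Proof. unfold numM; induction n; simpl; congruence. Qed.

Lemma tv_quote s A : tv s (quote A) = codeM A.
Proof.
  unfold codeM; induction A; simpl; rewrite ?tv_num; try rewrite IHA1, IHA2; try rewrite IHA; auto.
Qed.

Lemma numM_S n : numM (S n) = suc (numM n).
Proof. reflexivity. Qed.

Lemma numM_spec n x : E x (numM n) <-> exists k, k < n /\ x = numM k.
Proof.
  induction n.
  - split; [intros H; apply not_in_zero in H; tauto|]. intros (k & H & _); lia.
  - rewrite numM_S, suc_spec, IHn. split.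
    + intros [(k & H & ->)| ->]; [exists k|exists n]; split; auto; lia.
    + intros (k & H & ->). destruct (Nat.eq_dec k n) as [->|]; auto.
      left; exists k; split; auto; lia.
Qed.

Lemma numM_lt i j : i < j -> E (numM i) (numM j).
Proof. intros H; apply numM_spec; eauto. Qed.

(** Only standard numerals are concerned, so induction on [n] outside the model takes the place of
    foundation. *)
Lemma numM_irrefl n : ~ E (numM n) (numM n).
Proof.
  induction n; intros H.
  - apply not_in_zero in H; auto.
  - apply numM_spec in H as (k & Hk & H'). apply IHn.
    assert (X := numM_lt n (S n) (Nat.lt_succ_diag_r n)).
    rewrite H' in X. apply numM_spec in X as (j & Hj & X).
    rewrite X at 1. apply numM_lt; lia.
Qed.

Lemma numM_inj i j : numM i = numM j -> i = j.
Proof.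
  intros H. destruct (Nat.lt_trichotomy i j) as [L|[->|L]]; auto;
    apply numM_lt in L; rewrite H in L; apply numM_irrefl in L; tauto.
Qed.

Lemma numM_mem i j : E (numM i) (numM j) <-> i < j.
Proof.
  rewrite numM_spec. split; [intros (k & Hk & H); apply numM_inj in H; lia|eauto].
Qed.

Lemma suc_eq_numM x n : suc x = numM n -> exists m, n = S m /\ x = numM m.
Proof.
  intros H. assert (X : E x (numM n)) by (rewrite <- H; apply suc_spec; auto).
  apply numM_spec in X as (k & Hk & ->). exists k; split; auto.
  change (numM (S k) = numM n) in H. apply numM_inj in H; auto.
Qed.

(** * Syntax and finite sets inside a model *)

Definition mMem i j := pr (numM 0) (pr i j).
Definition mEqu i j := pr (numM 1) (pr i j).
Definition mBot := pr (numM 2) (numM 0).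
Definition mImp u v := pr (numM 3) (pr u v).
Definition mAll u := pr (numM 4) u.
Definition mNeg u := mImp u mBot.
Definition mEx u := mNeg (mAll (mNeg u)).
Definition mAnd u v := mNeg (mImp u (mNeg v)).
Definition mExIn (n : nat) u :=
  mNeg (mAll (mImp (mMem (numM 0) (numM (S n))) (mNeg u))).
Definition hv (b : nat) (g t : M) := pr (numM b) (pr g t).

(** Two instances matter: the universe, and the elements of a set u satisfying [fClosed].
    Specifications relative to a closed class serve both [fPr], read in the model, and the formulas
    relativized to u. *)
Record closed P : Prop := {
  closed_trans : forall x y, E x y -> P y -> P x;
  closed_zero : P zero;
  closed_adj : forall x y, P x -> P y -> P (adj x y) }.

Lemma closed_True : closed (fun _ => True).
Proof. split; auto. Qed.

Section Closed.
Variable P : M -> Prop.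
Hypothesis HP : closed P.

Lemma closed_upr x y : P x -> P y -> P (upr x y).
Proof. intros; unfold upr; repeat apply (closed_adj P HP); auto. apply closed_zero; auto. Qed.
Lemma closed_pr x y : P x -> P y -> P (pr x y).
Proof. intros; unfold pr; repeat apply closed_upr; auto. Qed.
Lemma closed_suc x : P x -> P (suc x).
Proof. intros; apply (closed_adj P HP); auto. Qed.
Lemma closed_tv s t : (forall i, P (s i)) -> P (tv s t).
Proof.
  intros H; induction t; simpl; auto.
  - apply (closed_zero P HP).
  - apply closed_suc; auto.
  - apply closed_pr; auto.
Qed.
Lemma closed_numM n : P (numM n).
Proof. apply closed_tv; intros; apply closed_zero; auto. Qed.
Lemma closed_codeM A : P (codeM A).
Proof. apply closed_tv; intros; apply closed_zero; auto. Qed.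
Lemma closed_pr_l x y : P (pr x y) -> P x.
Proof.
  intros H. apply (closed_trans P HP x (upr x y)); [apply upr_spec; auto|].
  apply (closed_trans P HP _ (pr x y)); auto. apply upr_spec; auto.
Qed.
Lemma closed_pr_r x y : P (pr x y) -> P y.
Proof.
  intros H. apply (closed_trans P HP y (upr x y)); [apply upr_spec; auto|].
  apply (closed_trans P HP _ (pr x y)); auto. apply upr_spec; auto.
Qed.

End Closed.

Fixpoint lset (l : list M) : M :=
  match l with [] => zero | x :: l => adj (lset l) x end.

Lemma lset_spec l x : E x (lset l) <-> In x l.
Proof.
  induction l; simpl.
  - pose proof (not_in_zero x); tauto.
  - rewrite adj_spec, IHl. intuition.
Qed.

Lemma closed_lset P l : closed P -> (forall x, In x l -> P x) -> P (lset l).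
Proof.
  intros HP; induction l; simpl; intros H; [apply closed_zero; auto|].
  apply (closed_adj P HP); auto.
Qed.

(* Elements having a finite justification: every syntactic relation of the
   object language is of the form "x lies in some set all of whose elements are
   justified by elements of that set". *)
Section FiniteJustification.
Variables (P : M -> Prop) (J : (M -> Prop) -> M -> Prop).
Hypothesis HP : closed P.
Hypothesis HJ : forall (X Y : M -> Prop) p, (forall x, X x -> Y x) -> J X p -> J Y p.

Definition fin_just (x : M) : Prop :=
  exists l, (forall p, In p l -> P p) /\ In x l /\
            forall p, In p l -> J (fun y => In y l) p.

Lemma fin_just_list ps :
  (forall p, In p ps -> fin_just p) ->
  exists l, (forall p, In p l -> P p) /\ incl ps l /\
            forall p, In p l -> J (fun y => In y l) p.
Proof.
  induction ps as [|p ps IH]; intros H.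
  - exists []; repeat split; try (simpl; tauto). intros x [].
  - destruct IH as (l & H1 & H2 & H3); [intros; apply H; simpl; auto|].
    destruct (H p) as (l' & H1' & H2' & H3'); [simpl; auto|].
    exists (l' ++ l). repeat split.
    + intros q Hq; apply in_app_or in Hq; intuition.
    + intros q [<-|Hq]; apply in_or_app; auto.
    + intros q Hq; apply in_app_or in Hq; destruct Hq as [Hq|Hq];
        [eapply HJ; [|apply H3'; auto] | eapply HJ; [|apply H3; auto]];
        intros; apply in_or_app; auto.
Qed.

Lemma fin_just_intro x ps :
  P x -> (forall p, In p ps -> fin_just p) -> J (fun y => In y ps) x -> fin_just x.
Proof.
  intros Px H Hx. destruct (fin_just_list ps H) as (l & H1 & H2 & H3).
  exists (x :: l). repeat split; simpl; auto.
  - intros p [<-|Hp]; auto.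
  - intros p [<-|Hp]; eapply HJ; [|eassumption| |apply H3; auto]; simpl; auto.
Qed.

(** A finite list of elements of [P] becomes a set in [P] by repeated adjunction. This is how
    closure under adjunction alone makes a class rich enough for standard syntax. *)
Lemma fin_just_set x :
  fin_just x -> exists S, P S /\ E x S /\ forall p, E p S -> J (fun y => E y S) p.
Proof.
  intros (l & H1 & H2 & H3). exists (lset l). repeat split.
  - apply closed_lset; auto.
  - apply lset_spec; auto.
  - intros p Hp; apply lset_spec in Hp. eapply HJ; [|apply H3; auto].
    intros; apply lset_spec; auto.
Qed.

End FiniteJustification.

(** * Meaning of the object-language formulas *)

Definition env_in P s : Prop := forall i, P (s i).

Lemma env_in_cons P s x : env_in P s -> P x -> env_in P (x ▹ s).
Proof. intros H Px [|i]; simpl; auto. Qed.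

Lemma env_in_True s : env_in (fun _ => True) s.
Proof. red; auto. Qed.

Lemma hs_and P s A B (X Y : Prop) :
  (hold E P s A <-> X) -> (hold E P s B <-> Y) -> hold E P s (A ∧ B) <-> X /\ Y.
Proof. rewrite hold_And; tauto. Qed.
Lemma hs_or P s A B (X Y : Prop) :
  (hold E P s A <-> X) -> (hold E P s B <-> Y) -> hold E P s (A ∨ B) <-> X \/ Y.
Proof. rewrite hold_Or; tauto. Qed.
Lemma hs_imp P s A B (X Y : Prop) :
  (hold E P s A <-> X) -> (hold E P s B <-> Y) -> hold E P s (A ⇒ B) <-> (X -> Y).
Proof. simpl; tauto. Qed.
Lemma hs_iff P s A B (X Y : Prop) :
  (hold E P s A <-> X) -> (hold E P s B <-> Y) -> hold E P s (A ⇔ B) <-> (X <-> Y).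
Proof. rewrite hold_Iff; tauto. Qed.
Lemma hs_neg P s A (X : Prop) :
  (hold E P s A <-> X) -> hold E P s (¬ A) <-> ~ X.
Proof. rewrite hold_Neg; tauto. Qed.
Lemma hs_ex P s A (Q : M -> Prop) : env_in P s ->
  (forall x, env_in P (x ▹ s) -> hold E P (x ▹ s) A <-> Q x) ->
  hold E P s (Ex A) <-> exists x, P x /\ Q x.
Proof.
  intros Hs H. rewrite hold_Ex. split; intros (x & Px & Hx); exists x; split; auto;
    apply H; auto using env_in_cons.
Qed.
Lemma hs_exT s A (Q : M -> Prop) :
  (forall x, sat E (x ▹ s) A <-> Q x) -> sat E s (Ex A) <-> exists x, Q x.
Proof. intros H. rewrite hold_Ex. firstorder. Qed.
Lemma hs_all P s A (Q : M -> Prop) : env_in P s ->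
  (forall x, env_in P (x ▹ s) -> hold E P (x ▹ s) A <-> Q x) ->
  hold E P s (All A) <-> forall x, P x -> Q x.
Proof.
  intros Hs H. simpl. split; intros H' x Px; apply H; auto using env_in_cons.
Qed.
Lemma hs_allT s A (Q : M -> Prop) :
  (forall x, sat E (x ▹ s) A <-> Q x) -> sat E s (All A) <-> forall x, Q x.
Proof. simpl; firstorder. Qed.
Lemma hs_allin P s (y : nat) A (v : M) (Q : M -> Prop) : closed P -> env_in P s -> s y = v ->
  (forall x, env_in P (x ▹ s) -> hold E P (x ▹ s) A <-> Q x) ->
  hold E P s (AllIn y A) <-> forall x, E x v -> Q x.
Proof.
  intros HP Hs <- H. rewrite hold_AllIn.
  assert (X : forall x, E x (s y) -> P x) by (intros x Hx; apply (closed_trans P HP _ _ Hx); auto).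
  split; intros H' x Hx; [|intros Hx']; apply H; auto using env_in_cons.
Qed.
Lemma hs_exin P s (y : nat) A (v : M) (Q : M -> Prop) : closed P -> env_in P s -> s y = v ->
  (forall x, env_in P (x ▹ s) -> hold E P (x ▹ s) A <-> Q x) ->
  hold E P s (ExIn y A) <-> exists x, E x v /\ Q x.
Proof.
  intros HP Hs <- H. rewrite hold_ExIn.
  assert (X : forall x, E x (s y) -> P x) by (intros x Hx; apply (closed_trans P HP _ _ Hx); auto).
  split; intros (x & Hx); exists x; [|split]; intuition; apply H; auto using env_in_cons.
Qed.

Lemma hs_upair P s (z x y : nat) : closed P -> env_in P s ->
  hold E P s (fUPair z x y) <-> s z = upr (s x) (s y).
Proof.
  intros HP Hs. unfold fUPair.
  transitivity (forall w, P w -> (E w (s z) <-> w = s x \/ w = s y)).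
  - apply hs_all; auto. intros w Hw. apply hs_iff; [reflexivity|].
    apply hs_or; reflexivity.
  - split.
    + intros H. apply (ext M E W). intros w. rewrite upr_spec. split.
      * intros Hw. apply H; auto. apply (closed_trans P HP _ _ Hw); auto.
      * intros Hw; apply H; auto. destruct Hw as [->| ->]; auto.
    + intros -> w _. apply upr_spec.
Qed.

Lemma hs_pair P s (p x y : nat) : closed P -> env_in P s ->
  hold E P s (fPair p x y) <-> s p = pr (s x) (s y).
Proof.
  intros HP Hs. unfold fPair.
  transitivity (forall w, P w -> (E w (s p) <-> w = upr (s x) (s x) \/ w = upr (s x) (s y))).
  - apply hs_all; auto. intros w Hw. apply hs_iff; [reflexivity|].
    apply hs_or; [apply (hs_upair P (w ▹ s) 0 (S x) (S x)) | apply (hs_upair P (w ▹ s) 0 (S x) (S y))]; auto.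
  - split.
    + intros H. apply (ext M E W). intros w. unfold pr; rewrite upr_spec. split.
      * intros Hw. apply H; auto. apply (closed_trans P HP _ _ Hw); auto.
      * intros Hw; apply H; auto. destruct Hw as [->| ->]; apply closed_upr; auto.
    + intros -> w _. apply upr_spec.
Qed.

Lemma hs_succ P s (x y : nat) : closed P -> env_in P s ->
  hold E P s (fSucc y x) <-> s y = suc (s x).
Proof.
  intros HP Hs. unfold fSucc.
  transitivity (forall w, P w -> (E w (s y) <-> E w (s x) \/ w = s x)).
  - apply hs_all; auto. intros w Hw. apply hs_iff; [reflexivity|].
    apply hs_or; reflexivity.
  - split.
    + intros H. apply (ext M E W). intros w. rewrite suc_spec. split.
      * intros Hw. apply H; auto. apply (closed_trans P HP _ _ Hw); auto.
      * intros Hw; apply H; auto. destruct Hw as [Hw| ->]; auto.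
        apply (closed_trans P HP _ _ Hw); auto.
    + intros -> w _. apply suc_spec.
Qed.

(** The formula names the values of subterms by quantifiers over [P]; they are found there because
    [P] is closed under successors and pairs. *)
Lemma hs_is P s (k x : nat) t : closed P -> env_in P s ->
  hold E P s (fIs k x t) <-> s x = tv (fun i => s (k + i)) t.
Proof.
  intros HP; revert k x s; induction t; intros k x s Hs; cbn [fIs tv].
  - reflexivity.
  - rewrite hold_AllIn. split.
    + intros H. apply (ext M E W). intros w. split; intros Hw.
      * exfalso. apply (H w); auto. apply (closed_trans P HP _ _ Hw); auto.
      * apply not_in_zero in Hw; tauto.
    + intros -> w _ Hw. apply not_in_zero in Hw; tauto.
  - transitivity (exists y, P y /\ (y = tv (fun i => s (k + i)) t /\ s x = suc y)).
    + apply hs_ex; auto. intros y Hy. apply hs_and.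
      * apply (IHt (1 + k) 0 (y ▹ s)); auto.
      * apply (hs_succ P (y ▹ s) 0 (S x)); auto.
    + split; [intros (y & _ & -> & H); auto|].
      intros H. eexists; repeat split; eauto. apply closed_tv; auto.
  - transitivity (exists y, P y /\ exists z, P z /\ (y = tv (fun i => s (k + i)) t1 /\
        z = tv (fun i => s (k + i)) t2 /\ s x = pr y z)).
    + apply hs_ex; auto. intros y Hy. apply hs_ex; auto. intros z Hz.
      apply hs_and; [|apply hs_and].
      * apply (IHt1 (2 + k) 1 (z ▹ y ▹ s)); auto.
      * apply (IHt2 (2 + k) 0 (z ▹ y ▹ s)); auto.
      * apply (hs_pair P (z ▹ y ▹ s) (2 + x) 1 0); auto.
    + split; [intros (y & _ & z & _ & -> & -> & H); auto|].
      intros H. exists (tv (fun i => s (k + i)) t1); split;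
        [apply closed_tv; auto; intros i; auto|].
      exists (tv (fun i => s (k + i)) t2); split; [|auto].
      apply closed_tv; auto; intros i; auto.
Qed.

Lemma hs_in P s t (y : nat) : closed P -> env_in P s ->
  hold E P s (t ∊ y) <-> E (tv s t) (s y).
Proof.
  intros HP Hs. transitivity (exists x, P x /\ (x = tv s t /\ E x (s y))).
  - apply hs_ex; auto. intros x Hx. apply hs_and; [|reflexivity].
    apply (hs_is P (x ▹ s) 1 0); auto.
  - split; [intros (x & _ & -> & H); auto|]. intros H; eexists; repeat split; eauto.
    apply closed_tv; auto.
Qed.

(** Descends through connectives and quantifiers while keeping [env_in] available, and leaves as
    goals the subformulas that have a specification of their own. The pattern for [t ∊ y] precedes
    that for [Ex], since the notation unfolds to an existential; the patterns for the universal
    class avoid trivial bounds. *)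
Ltac hspec :=
  lazymatch goal with
  | |- hold _ _ _ (Ex (And (fIs 1 0 ?t) (Mem 0 (S ?y)))) <-> _ =>
      eapply iff_trans; [eapply hs_in; [eassumption|assumption]|]; rewrite ?tv_quote, ?tv_num; cbn [tv]; reflexivity
  | |- hold _ _ _ (And _ _) <-> _ => apply hs_and; hspec
  | |- hold _ _ _ (Or _ _) <-> _ => apply hs_or; hspec
  | |- hold _ _ _ (Iff _ _) <-> _ => apply hs_iff; hspec
  | |- hold _ _ _ (Neg _) <-> _ => apply hs_neg; hspec
  | |- hold _ _ _ (Imp _ _) <-> _ => apply hs_imp; hspec
  | |- hold _ _ _ (Mem _ _) <-> _ => reflexivity
  | |- hold _ _ _ (Equ _ _) <-> _ => reflexivity
  | |- hold _ (fun _ => True) ?s (Ex _) <-> _ =>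
      apply hs_exT; let x := fresh "x" in let H := fresh in
        intros x; assert (H := env_in_True (x ▹ s)); hspec
  | |- hold _ (fun _ => True) ?s (All _) <-> _ =>
      apply hs_allT; let x := fresh "x" in let H := fresh in
        intros x; assert (H := env_in_True (x ▹ s)); hspec
  | |- hold _ _ _ (Ex _) <-> _ =>
      apply hs_ex; [assumption|]; let x := fresh "x" in let H := fresh in intros x H; hspec
  | |- hold _ _ _ (All _) <-> _ =>
      apply hs_all; [assumption|]; let x := fresh "x" in let H := fresh in intros x H; hspec
  | |- hold _ _ _ (AllIn _ _) <-> _ =>
      eapply hs_allin; [eassumption|assumption|reflexivity|];
        let x := fresh "x" in let H := fresh in intros x H; hspec
  | |- hold _ _ _ (ExIn _ _) <-> _ =>
      eapply hs_exin; [eassumption|assumption|reflexivity|];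
        let x := fresh "x" in let H := fresh in intros x H; hspec
  | |- hold _ _ _ (fIs 0 _ _) <-> _ =>
      eapply iff_trans; [eapply hs_is; [eassumption|assumption]|];
      rewrite ?tv_quote, ?tv_num; cbn [tv]; reflexivity
  | |- hold _ _ _ (fSucc _ _) <-> _ =>
      eapply iff_trans; [eapply hs_succ; [eassumption|assumption]|]; reflexivity
  | |- _ => idtac
  end.

Definition Trans (x : M) : Prop := forall y, E y x -> forall z, E z y -> E z x.
Definition Ord (x : M) : Prop := Trans x /\ forall y, E y x -> Trans y.
Definition zero_or_suc (m : M) : Prop := m = zero \/ exists k, E k m /\ m = suc k.
Definition Nat (m : M) : Prop :=
  Ord m /\ zero_or_suc m /\ forall x, E x m -> zero_or_suc x.

Lemma spec_Trans P s (x : nat) : closed P -> env_in P s ->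
  hold E P s (fTrans x) <-> Trans (s x).
Proof. intros HP Hs. unfold fTrans, Trans. hspec. Qed.

Lemma spec_Ord P s (x : nat) : closed P -> env_in P s ->
  hold E P s (fOrd x) <-> Ord (s x).
Proof.
  intros HP Hs. unfold fOrd, Ord. hspec; [apply spec_Trans; auto|].
  apply (spec_Trans P (x0 ▹ s)); auto.
Qed.

Lemma spec_Nat P s (x : nat) : closed P -> env_in P s ->
  hold E P s (fNat x) <-> Nat (s x).
Proof.
  intros HP Hs. unfold fNat, Nat, zero_or_suc. hspec. apply spec_Ord; auto.
Qed.

Definition Fun (s n : M) : Prop :=
  (forall q, E q s -> exists i y, E i n /\ q = pr i y) /\
  forall i, E i n -> exists y, E (pr i y) s /\ forall z, E (pr i z) s -> z = y.

Lemma spec_Fun P s (f n : nat) : closed P -> env_in P s ->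
  hold E P s (fFun f n) <-> Fun (s f) (s n).
Proof.
  intros HP Hs.
  transitivity ((forall q, E q (s f) -> exists i, P i /\ exists y, P y /\ (E i (s n) /\ q = pr i y)) /\
    forall i, E i (s n) -> exists y, P y /\ (E (pr i y) (s f) /\
       forall z, P z -> E (pr i z) (s f) -> z = y)).
  - unfold fFun. hspec.
  - assert (X : forall i y, E (pr i y) (s f) -> P i /\ P y).
    { intros i y H. assert (P (pr i y)) by (apply (closed_trans P HP _ _ H); auto).
      split; [eapply closed_pr_l|eapply closed_pr_r]; eauto. }
    split; intros [H1 H2]; split.
    + intros q Hq. destruct (H1 q Hq) as (i & _ & y & _ & H); eauto.
    + intros i Hi. destruct (H2 i Hi) as (y & _ & H3 & H4). exists y; split; auto.
      intros z Hz; apply H4; auto. apply (X i); auto.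
    + intros q Hq. destruct (H1 q Hq) as (i & y & Hi & ->).
      exists i. destruct (X i y Hq). split; auto. exists y; auto.
    + intros i Hi. destruct (H2 i Hi) as (y & H3 & H4). exists y. destruct (X i y H3); auto.
Qed.

Definition Into (s z : M) : Prop := forall i y, E (pr i y) s -> E y z.

(** One justification step, with the set S of the object-language formula replaced by a predicate
    [X] in which the step is monotone. This is the shape that [fin_just] handles; the other
    relations prefixed [just_] follow it. *)
Definition just_fv P (X : M -> Prop) (p : M) : Prop :=
  exists m, P m /\ exists g, P g /\ (p = pr m g /\ Nat m /\
    ((exists i, E i m /\ exists j, E j m /\ (g = mMem i j \/ g = mEqu i j))
     \/ g = mBot
     \/ (exists u, P u /\ exists v, P v /\ (g = mImp u v /\ X (pr m u) /\ X (pr m v)))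
     \/ (exists u, P u /\ (g = mAll u /\ X (pr (suc m) u))))).

Definition justified P (J : (M -> Prop) -> M -> Prop) (x : M) : Prop :=
  exists S, P S /\ (E x S /\ forall p, E p S -> J (fun y => E y S) p).

Definition FvLt P (n f : M) : Prop := justified P (just_fv P) (pr n f).

Lemma spec_FvLt P s (n f : nat) : closed P -> env_in P s ->
  hold E P s (fFvLt n f) <-> FvLt P (s n) (s f).
Proof.
  intros HP Hs. unfold fFvLt, FvLt, justified, just_fv. hspec.
  apply (spec_Nat P (x2 ▹ x1 ▹ x0 ▹ x ▹ s) 1); auto.
Qed.

Definition Form P (f : M) : Prop := exists n, P n /\ FvLt P n f.
Definition FormIn P (n : nat) (f : M) : Prop := exists k, P k /\ (k = numM n /\ FvLt P k f).

Lemma spec_Form P s (f : nat) : closed P -> env_in P s ->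
  hold E P s (fForm f) <-> Form P (s f).
Proof.
  intros HP Hs. unfold fForm, Form. hspec. apply (spec_FvLt P (x ▹ s) 0 (S f)); auto.
Qed.

Lemma spec_FormIn P s n (f : nat) : closed P -> env_in P s ->
  hold E P s (fFormIn n f) <-> FormIn P n (s f).
Proof.
  intros HP Hs. unfold fFormIn, FormIn. hspec. apply (spec_FvLt P (x ▹ s) 0 (S f)); auto.
Qed.

Definition just_D0 P (X : M -> Prop) (g : M) : Prop :=
  (exists i, P i /\ exists j, P j /\ (g = mMem i j \/ g = mEqu i j))
  \/ g = mBot
  \/ (exists u, P u /\ exists v, P v /\ (X u /\ X v /\ g = mImp u v))
  \/ (exists i, P i /\ exists u, P u /\ (X u /\ g = mAll (mImp (mMem zero (suc i)) u))).

Definition IsDelta0 P (f : M) : Prop := Form P f /\ justified P (just_D0 P) f.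

Lemma spec_Delta0 P s (f : nat) : closed P -> env_in P s ->
  hold E P s (fDelta0 f) <-> IsDelta0 P (s f).
Proof.
  intros HP Hs. unfold fDelta0, IsDelta0, justified, just_D0. hspec.
  apply spec_Form; auto.
Qed.

Definition ShiftVar (d i j : M) : Prop := (E i d /\ j = i) \/ (~ E i d /\ j = suc i).

Lemma spec_ShiftVar P s (d i j : nat) : closed P -> env_in P s ->
  hold E P s (fShiftVar d i j) <-> ShiftVar (s d) (s i) (s j).
Proof. intros HP Hs. unfold fShiftVar, ShiftVar. hspec. Qed.

Definition just_shift P (X : M -> Prop) (p : M) : Prop :=
  exists d, P d /\ exists u, P u /\ exists v, P v /\ (p = pr d (pr u v) /\
   ((exists i, P i /\ exists j, P j /\ exists i', P i' /\ exists j', P j' /\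
       (ShiftVar d i i' /\ ShiftVar d j j' /\
         ((u = mMem i j /\ v = mMem i' j') \/ (u = mEqu i j /\ v = mEqu i' j'))))
    \/ (u = mBot /\ v = mBot)
    \/ (exists u1, P u1 /\ exists u2, P u2 /\ exists v1, P v1 /\ exists v2, P v2 /\
         (u = mImp u1 u2 /\ v = mImp v1 v2 /\ X (pr d (pr u1 v1)) /\ X (pr d (pr u2 v2))))
    \/ (exists u1, P u1 /\ exists v1, P v1 /\
         (u = mAll u1 /\ v = mAll v1 /\ X (pr (suc d) (pr u1 v1)))))).

Definition IsShift P (c f g : M) : Prop :=
  Form P f /\ justified P (just_shift P) (pr c (pr f g)).

Definition IsShiftNum P (c : nat) (f g : M) : Prop :=
  exists k, P k /\ (k = numM c /\ IsShift P k f g).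

Lemma spec_ShiftNum P s c (f g : nat) : closed P -> env_in P s ->
  hold E P s (fShiftNum c f g) <-> IsShiftNum P c (s f) (s g).
Proof.
  intros HP Hs. unfold fShiftNum, IsShiftNum, fShift, IsShift, justified, just_shift. hspec.
  - apply (spec_Form P (x ▹ s) (S f)); auto.
  - apply (spec_ShiftVar P (x8 ▹ x7 ▹ x6 ▹ x5 ▹ x4 ▹ x3 ▹ x2 ▹ x1 ▹ x0 ▹ x ▹ s) 6 3 1); auto.
  - apply (spec_ShiftVar P (x8 ▹ x7 ▹ x6 ▹ x5 ▹ x4 ▹ x3 ▹ x2 ▹ x1 ▹ x0 ▹ x ▹ s) 6 2 0); auto.
Qed.

Definition Logical P (f : M) : Prop :=
  (exists A, P A /\ exists B, P B /\ (Form P A /\ Form P B /\ f = mImp A (mImp B A)))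
  \/ (exists A, P A /\ exists B, P B /\ exists C, P C /\ (Form P A /\ Form P B /\ Form P C /\
       f = mImp (mImp A (mImp B C)) (mImp (mImp A B) (mImp A C))))
  \/ (exists A, P A /\ (Form P A /\ f = mImp (mImp (mImp A mBot) mBot) A))
  \/ (exists A, P A /\ exists B, P B /\ (Form P A /\ Form P B /\
       f = mImp (mAll (mImp A B)) (mImp (mAll A) (mAll B))))
  \/ (exists A, P A /\ exists A', P A' /\ (IsShiftNum P 0 A A' /\ f = mImp A (mAll A')))
  \/ (exists i, P i /\ (Nat i /\ f = mEx (mEqu zero (suc i))))
  \/ (exists i, P i /\ exists j, P j /\ exists k, P k /\ (Nat i /\ Nat j /\ Nat k /\
       (f = mImp (mEqu i j) (mImp (mEqu i k) (mEqu j k))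
        \/ f = mImp (mEqu i j) (mImp (mMem i k) (mMem j k))
        \/ f = mImp (mEqu i j) (mImp (mMem k i) (mMem k j))))).

Lemma spec_Logical P s (f : nat) : closed P -> env_in P s ->
  hold E P s (fLogical f) <-> Logical P (s f).
Proof.
  intros HP Hs. unfold fLogical, Logical. hspec.
  - apply (spec_Form P (x0 ▹ x ▹ s) 1); auto.
  - apply (spec_Form P (x0 ▹ x ▹ s) 0); auto.
  - apply (spec_Form P (x1 ▹ x0 ▹ x ▹ s) 2); auto.
  - apply (spec_Form P (x1 ▹ x0 ▹ x ▹ s) 1); auto.
  - apply (spec_Form P (x1 ▹ x0 ▹ x ▹ s) 0); auto.
  - apply (spec_Form P (x ▹ s) 0); auto.
  - apply (spec_Form P (x0 ▹ x ▹ s) 1); auto.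
  - apply (spec_Form P (x0 ▹ x ▹ s) 0); auto.
  - apply (spec_ShiftNum P (x0 ▹ x ▹ s) 0 1 0); auto.
  - apply (spec_Nat P (x ▹ s) 0); auto.
  - apply (spec_Nat P (x1 ▹ x0 ▹ x ▹ s) 2); auto.
  - apply (spec_Nat P (x1 ▹ x0 ▹ x ▹ s) 1); auto.
  - apply (spec_Nat P (x1 ▹ x0 ▹ x ▹ s) 0); auto.
Qed.

Definition by_mp P (p i g : M) : Prop :=
  exists j, E j i /\ exists k, E k i /\ exists e, P e /\ (E (pr j (mImp e g)) p /\ E (pr k e) p).
Definition by_gen P (p i g : M) : Prop :=
  exists j, E j i /\ exists e, P e /\ (E (pr j e) p /\ g = mAll e).

Definition Pr (tau : M -> Prop) (f : M) : Prop :=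
  exists m n p, Nat n /\ n = suc m /\ Fun p n /\ E (pr m f) p /\
    forall i, E i n -> forall g, E (pr i g) p ->
      Logical univ g \/ (FormIn univ 0 g /\ tau g) \/ by_mp univ p i g \/ by_gen univ p i g.

Lemma spec_Pr s tau (f : nat) (Tau : M -> Prop) :
  (forall c s', sat E (c ▹ s') tau <-> Tau c) ->
  sat E s (fPr tau f) <-> Pr Tau (s f).
Proof.
  intros HT. assert (HP := closed_True). unfold fPr, Pr.
  apply hs_exT; intros m. apply hs_exT; intros n. apply hs_exT; intros p.
  assert (He := env_in_True (p ▹ n ▹ m ▹ s)).
  apply hs_and; [apply (spec_Nat univ (p ▹ n ▹ m ▹ s) 1); auto|].
  apply hs_and; [apply (hs_succ univ (p ▹ n ▹ m ▹ s) 2 1); auto|].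
  apply hs_and; [apply (spec_Fun univ (p ▹ n ▹ m ▹ s) 0 1); auto|].
  apply hs_and; [hspec|].
  eapply hs_allin; [eassumption|assumption|reflexivity|]; intros i Hi.
  apply hs_allT; intros g. assert (Hg := env_in_True (g ▹ i ▹ p ▹ n ▹ m ▹ s)).
  apply hs_imp; [hspec|].
  apply hs_or; [apply (spec_Logical univ (g ▹ i ▹ p ▹ n ▹ m ▹ s) 0); auto|].
  apply hs_or; [apply hs_and|].
  - apply (spec_FormIn univ (g ▹ i ▹ p ▹ n ▹ m ▹ s) 0 0); auto.
  - transitivity (exists c, c = g /\ Tau c).
    + apply hs_exT; intros c. apply hs_and; [reflexivity|auto].
    + split; [intros (c & -> & H); auto|eauto].
  - assert (X : forall Q : M -> Prop, (exists e, True /\ Q e) <-> exists e, Q e) by firstorder.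
    unfold by_mp, by_gen. setoid_rewrite X. hspec.
Qed.

Definition Cons (t' a t : M) : Prop :=
  forall q, E q t' <-> q = pr zero a \/ exists i y, E (pr i y) t /\ q = pr (suc i) y.

Lemma spec_Cons s (t' a t : nat) : sat E s (fCons t' a t) <-> Cons (s t') (s a) (s t).
Proof.
  assert (HP := closed_True). unfold fCons, Cons. hspec.
Qed.

Definition just_sat (z : M) (X : M -> Prop) (p : M) : Prop :=
  exists g t,
    (exists i j a b, E (pr i a) t /\ E (pr j b) t /\
       ((g = mMem i j /\ ((p = hv 1 g t /\ E a b) \/ (p = hv 0 g t /\ ~ E a b)))
        \/ (g = mEqu i j /\ ((p = hv 1 g t /\ a = b) \/ (p = hv 0 g t /\ ~ a = b)))))
    \/ (g = mBot /\ p = hv 0 g t)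
    \/ (exists u v, g = mImp u v /\
         ((p = hv 1 g t /\ (X (hv 0 u t) \/ X (hv 1 v t)))
          \/ (p = hv 0 g t /\ X (hv 1 u t) /\ X (hv 0 v t))))
    \/ (exists u, g = mAll u /\
         ((p = hv 1 g t /\ forall a, E a z -> exists t', Cons t' a t /\ X (hv 1 u t'))
          \/ (p = hv 0 g t /\ exists a, E a z /\ exists t', Cons t' a t /\ X (hv 0 u t')))).

Definition Sat (z f t : M) : Prop := justified univ (just_sat z) (hv 1 f t).

Lemma spec_Sat s (z f t : nat) : sat E s (fSat z f t) <-> Sat (s z) (s f) (s t).
Proof.
  assert (HP := closed_True). assert (Hs := env_in_True s).
  unfold fSat, Sat, justified, just_sat, hev.
  assert (X : forall Q : M -> Prop, (exists e, True /\ Q e) <-> exists e, Q e) by firstorder.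
  rewrite X. hspec.
  - apply (spec_Cons (x5 ▹ x4 ▹ x3 ▹ x2 ▹ x1 ▹ x0 ▹ x ▹ s) 0 1 3).
  - apply (spec_Cons (x5 ▹ x4 ▹ x3 ▹ x2 ▹ x1 ▹ x0 ▹ x ▹ s) 0 1 3).
Qed.

Definition IsDef (x y : M) : Prop :=
  exists n m f t, m = suc n /\ FvLt univ m f /\ Fun t n /\ Into t x /\
    forall w, E w y <-> E w x /\ exists t', Cons t' w t /\ Sat x f t'.

Lemma spec_Into s (t z : nat) : sat E s (fInto t z) <-> Into (s t) (s z).
Proof. assert (HP := closed_True). unfold fInto, Into. hspec. Qed.

Lemma spec_Def s (x y : nat) : sat E s (fDef x y) <-> IsDef (s x) (s y).
Proof.
  assert (HP := closed_True). assert (Hs := env_in_True s).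
  unfold fDef, IsDef. hspec.
  - apply (spec_FvLt univ (x3 ▹ x2 ▹ x1 ▹ x0 ▹ s) 2 1); auto.
  - apply (spec_Fun univ (x3 ▹ x2 ▹ x1 ▹ x0 ▹ s) 0 3); auto.
  - apply (spec_Into (x3 ▹ x2 ▹ x1 ▹ x0 ▹ s) 0 (4 + x)).
  - apply (spec_Cons (x5 ▹ x4 ▹ x3 ▹ x2 ▹ x1 ▹ x0 ▹ s) 0 1 2).
  - apply (spec_Sat (x5 ▹ x4 ▹ x3 ▹ x2 ▹ x1 ▹ x0 ▹ s) (6 + x) 3 0).
Qed.

(* h enumerates the levels L_b for b in d. *)
Definition levels (h d : M) : Prop :=
  Fun h d /\ forall b w, E (pr b w) h ->
    forall y, E y w <-> exists c, E c b /\ exists v, E (pr c v) h /\ IsDef v y.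

Definition IsL (a z : M) : Prop :=
  Ord a /\ exists h, levels h (suc a) /\ E (pr a z) h.

Lemma spec_L s (a z : nat) : sat E s (fL a z) <-> IsL (s a) (s z).
Proof.
  assert (HP := closed_True). assert (Hs := env_in_True s).
  transitivity (Ord (s a) /\ exists d h, d = suc (s a) /\ Fun h d /\ E (pr (s a) (s z)) h /\
    forall b w, E (pr b w) h ->
      forall y, E y w <-> exists c, E c b /\ exists v, E (pr c v) h /\ IsDef v y).
  - unfold fL. hspec.
    + apply spec_Ord; auto.
    + apply (spec_Fun univ (x0 ▹ x ▹ s) 0 1); auto.
    + apply (spec_Def (x5 ▹ x4 ▹ x3 ▹ x2 ▹ x1 ▹ x0 ▹ x ▹ s) 0 2).
  - unfold IsL, levels. split.
    + intros (H & d & h & -> & H1 & H2 & H3); split; eauto.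
    + intros (H & h & [H1 H3] & H2). split; auto. exists (suc (s a)), h; auto.
Qed.

Definition models_of (z f : M) : Prop :=
  forall n t, FvLt univ n f /\ Fun t n /\ Into t z -> Sat z f t.

(** The class [Q] singles out some codes known to satisfy [fKP], so that only the instances actually
    used have to be recognized as axioms inside the model. *)
Lemma spec_Admissible s (x : nat) (Q : M -> Prop) :
  (forall f, Q f -> forall s', sat E (f ▹ s') (fKP 0)) ->
  sat E s (fAdmissible x) ->
  Ord (s x) /\ exists z, IsL (s x) z /\ forall f, Q f -> models_of z f.
Proof.
  intros HQ H. assert (HP := closed_True). assert (Hs := env_in_True s).
  unfold fAdmissible in H. apply hold_And in H as [H0 H].
  apply (spec_Ord univ) in H0; auto. split; auto.
  apply hold_Ex in H as (z & _ & H). apply hold_And in H as [H1 H].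
  apply (spec_L (z ▹ s) (S x) 0) in H1. exists z; split; auto.
  intros f Hf n t Ht. specialize (H f I (HQ f Hf _) n I t I).
  apply (spec_Sat (t ▹ n ▹ f ▹ z ▹ s) 3 2 0). apply H.
  destruct Ht as (A & B & C). assert (He := env_in_True (t ▹ n ▹ f ▹ z ▹ s)).
  apply hold_And; split; [|apply hold_And; split].
  - apply (spec_FvLt univ (t ▹ n ▹ f ▹ z ▹ s) 1 2); auto.
  - apply (spec_Fun univ (t ▹ n ▹ f ▹ z ▹ s) 0 1); auto.
  - apply (spec_Into (t ▹ n ▹ f ▹ z ▹ s) 0 3); auto.
Qed.

Section Represented.
Variables (R : form) (a : M).
Hypothesis HR : forall x s, sat E (x ▹ s) R <-> x = a.

Lemma spec_R s A (Q : Prop) :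
  (sat E (a ▹ s) A <-> Q) -> sat E s (All (R ⇒ A)) <-> Q.
Proof.
  intros H. rewrite <- H. split.
  - intros H1. apply H1; auto. apply HR; auto.
  - intros H1 x _ Hx. apply HR in Hx as ->; auto.
Qed.

Lemma spec_TrueEx s (f : nat) :
  sat E s (fTrueEx R f) <-> exists z, IsL a z /\ Sat z (mEx (s f)) zero.
Proof.
  assert (HP := closed_True). assert (Hs := env_in_True s).
  transitivity (exists e, e = mEx (s f) /\ exists z, IsL a z /\
    exists t, t = zero /\ Sat z e t).
  - unfold fTrueEx. apply hs_exT; intros e. assert (He := env_in_True (e ▹ s)).
    apply hs_and; [hspec|]. apply spec_R. hspec.
    + apply (spec_L (x ▹ a ▹ e ▹ s) 1 0).
    + apply (spec_Sat (x0 ▹ x ▹ a ▹ e ▹ s) 1 3 0).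
  - split; [intros (e & -> & z & H & t & -> & H'); eauto|].
    intros (z & H & H'); eauto 10.
Qed.

Lemma spec_atL s F z : (forall z', IsL a z' <-> z' = z) ->
  sat E s (atL R F) <-> hold E (fun x => E x z) s F.
Proof.
  intros Hz. unfold atL. apply spec_R.
  transitivity (exists z', IsL a z' /\ hold E (fun x => E x z') s F).
  - apply hs_exT. intros z'. apply hs_and; [apply (spec_L (z' ▹ a ▹ s) 1 0)|].
    rewrite hold_rel by auto. rewrite !hold_shift. reflexivity.
  - split; [intros (z' & H & H'); apply Hz in H as ->; auto|].
    intros H; exists z; split; auto. apply Hz; auto.
Qed.

Lemma spec_ExInL s A z : (forall z', IsL a z' <-> z' = z) ->
  sat E s (ExInL R A) <-> exists x, E x z /\ sat E (x ▹ z ▹ a ▹ s) A.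
Proof.
  intros Hz. unfold ExInL. apply spec_R. assert (HP := closed_True).
  transitivity (exists z', IsL a z' /\ exists x, E x z' /\ sat E (x ▹ z' ▹ a ▹ s) A).
  - apply hs_exT. intros z'. apply hs_and; [apply (spec_L (z' ▹ a ▹ s) 1 0)|].
    eapply hs_exin; [eassumption|apply env_in_True|reflexivity|].
    intros x Hx. reflexivity.
  - split; [intros (z' & H & H'); apply Hz in H as ->; auto|].
    intros H; exists z; split; auto. apply Hz; auto.
Qed.

Definition mExInL (f : M) : M :=
  mAll (mImp (codeM R) (mEx (mAnd (codeM (fL 1 0)) (mExIn 0 f)))).

Lemma tv_cExInL t : tv t (cExInL R 1) = mExInL (t 1).
Proof.
  change (mAll (mImp (tv t (quote R))
            (mEx (mAnd (tv t (quote (fL 1 0))) (mExIn 0 (t 1))))) = mExInL (t 1)).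
  rewrite !tv_quote. reflexivity.
Qed.

Lemma RFN_elim F s f Tau :
  (forall c s', sat E (c ▹ s') (atL R F) <-> Tau c) ->
  sat E s (RFN R F) -> FormIn univ 1 f -> IsDelta0 univ f ->
  Pr Tau (mExInL f) -> exists z, IsL a z /\ Sat z (mEx f) zero.
Proof.
  intros HT H H1 H2 H3. assert (HP := closed_True).
  apply (spec_TrueEx (mExInL f ▹ f ▹ s) 1).
  apply (H f I); auto.
  - apply hold_And; split.
    + apply (spec_FormIn univ (f ▹ s) 1 0); auto. apply env_in_True.
    + apply (spec_Delta0 univ (f ▹ s) 0); auto. apply env_in_True.
  - eapply (hs_is univ); [auto|apply env_in_True|].
    symmetry. apply (tv_cExInL (fun i => (mExInL f ▹ f ▹ s) i)).
  - apply (spec_Pr _ _ 0 Tau); auto.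
Qed.

End Represented.

(** * Codes of standard formulas, and passage from closed classes to the universe *)

Lemma Trans_numM n : Trans (numM n).
Proof.
  intros y Hy z Hz. apply numM_spec in Hy as (k & Hk & ->).
  apply numM_spec in Hz as (j & Hj & ->). apply numM_lt; lia.
Qed.

Lemma zero_or_suc_numM n : zero_or_suc (numM n).
Proof.
  destruct n; [left; reflexivity|right]. exists (numM n); split; [apply numM_lt; lia|reflexivity].
Qed.

Lemma Nat_numM n : Nat (numM n).
Proof.
  split; [split; [apply Trans_numM|] | split; [apply zero_or_suc_numM|]];
    intros y Hy; apply numM_spec in Hy as (k & Hk & ->);
    auto using Trans_numM, zero_or_suc_numM.
Qed.

Section InClosed.
Variable P : M -> Prop.
Hypothesis HP : closed P.

Lemma just_fv_mono (X Y : M -> Prop) p :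
  (forall x, X x -> Y x) -> just_fv P X p -> just_fv P Y p.
Proof.
  intros H (m & Pm & g & Pg & Hp & Hm & HJ). exists m; split; auto. exists g; split; auto.
  split; auto. split; auto. destruct HJ as [HJ|[HJ|[(u & Pu & v & Pv & A & B & C)|(u & Pu & A & B)]]]; auto.
  - right; right; left. exists u; split; auto. exists v; auto.
  - right; right; right. exists u; auto.
Qed.

Lemma just_D0_mono (X Y : M -> Prop) p :
  (forall x, X x -> Y x) -> just_D0 P X p -> just_D0 P Y p.
Proof.
  intros H. unfold just_D0.
  intros [HJ|[HJ|[(u & Pu & v & Pv & A & B & C)|(u & Pu & v & Pv & A & B)]]]; auto.
  - right; right; left. exists u; split; auto. exists v; auto.
  - right; right; right. exists u; split; auto. exists v; auto.
Qed.

Lemma just_shift_mono (X Y : M -> Prop) p :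
  (forall x, X x -> Y x) -> just_shift P X p -> just_shift P Y p.
Proof.
  intros H (d & Pd & u & Pu & v & Pv & Hp & HJ).
  exists d; split; auto. exists u; split; auto. exists v; split; auto. split; auto.
  destruct HJ as [HJ|[HJ|[(u1 & P1 & u2 & P2 & v1 & P3 & v2 & P4 & A & B & C & D)|
     (u1 & P1 & v1 & P2 & A & B & C)]]]; auto.
  - right; right; left. exists u1; split; auto. exists u2; split; auto.
    exists v1; split; auto. exists v2; auto 10.
  - right; right; right. exists u1; split; auto. exists v1; auto 10.
Qed.

Let Pnum := closed_numM P HP.
Let Pcode := closed_codeM P HP.
Let Ppr := closed_pr P HP.

(** Induction on A outside the model: at each node the pairs for the immediate subformulas are the
    justification, and [fin_just_intro] merges the finite lists that justify these in turn. *)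
Lemma FvLt_code n A : fv_lt n A -> FvLt P (numM n) (codeM A).
Proof.
  intros H. refine (fin_just_set P _ HP just_fv_mono _ _).
  revert n H; induction A; intros n H.
  - apply (fin_just_intro _ _ just_fv_mono _ []); [auto|simpl; tauto|].
    exists (numM n); split; [auto|]. exists (codeM (Mem i j)); split; [auto|].
    split; [auto|]. split; [apply Nat_numM|]. left. destruct H.
    exists (numM i); split; [apply numM_lt; auto|]. exists (numM j); split; [apply numM_lt; auto|].
    left; reflexivity.
  - apply (fin_just_intro _ _ just_fv_mono _ []); [auto|simpl; tauto|].
    exists (numM n); split; [auto|]. exists (codeM (Equ i j)); split; [auto|].
    split; [auto|]. split; [apply Nat_numM|]. left. destruct H.
    exists (numM i); split; [apply numM_lt; auto|]. exists (numM j); split; [apply numM_lt; auto|].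
    right; reflexivity.
  - apply (fin_just_intro _ _ just_fv_mono _ []); [auto|simpl; tauto|].
    exists (numM n); split; [auto|]. exists (codeM Bot); split; [auto|].
    split; [auto|]. split; [apply Nat_numM|]. right; left; reflexivity.
  - apply (fin_just_intro _ _ just_fv_mono _ [pr (numM n) (codeM A1); pr (numM n) (codeM A2)]); [auto| |].
    + destruct H. intros p [<-|[<-|[]]]; auto.
    + exists (numM n); split; [auto|]. exists (codeM (A1 ⇒ A2)); split; [auto|].
      split; [auto|]. split; [apply Nat_numM|]. right; right; left.
      exists (codeM A1); split; [auto|]. exists (codeM A2); split; [auto|]. simpl; auto 10.
  - apply (fin_just_intro _ _ just_fv_mono _ [pr (numM (S n)) (codeM A)]); [auto| |].
    + intros p [<-|[]]; auto.
    + exists (numM n); split; [auto|]. exists (codeM (All A)); split; [auto|].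
      split; [auto|]. split; [apply Nat_numM|]. right; right; right.
      exists (codeM A); split; [auto|]. simpl; auto 10.
Qed.

Lemma Form_code A : Form P (codeM A).
Proof. destruct (fv_lt_bound A) as [n Hn]. exists (numM n); auto using FvLt_code. Qed.

Lemma FormIn_code n A : fv_lt n A -> FormIn P n (codeM A).
Proof. intros H; exists (numM n); auto using FvLt_code. Qed.

Lemma IsDelta0_code A : Delta0 A -> IsDelta0 P (codeM A).
Proof.
  intros H. split; [apply Form_code|].
  refine (fin_just_set P _ HP just_D0_mono _ _).
  induction H.
  - apply (fin_just_intro _ _ just_D0_mono _ []); [auto|simpl; tauto|].
    left. exists (numM i); split; [auto|]. exists (numM j); split; [auto|]. left; reflexivity.
  - apply (fin_just_intro _ _ just_D0_mono _ []); [auto|simpl; tauto|].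
    left. exists (numM i); split; [auto|]. exists (numM j); split; [auto|]. right; reflexivity.
  - apply (fin_just_intro _ _ just_D0_mono _ []); [auto|simpl; tauto|].
    right; left; reflexivity.
  - apply (fin_just_intro _ _ just_D0_mono _ [codeM A; codeM B]); [auto| |].
    + intros p [<-|[<-|[]]]; auto.
    + right; right; left. exists (codeM A); split; [auto|]. exists (codeM B); split; [auto|].
      simpl; auto 10.
  - apply (fin_just_intro _ _ just_D0_mono _ [codeM A]); [auto| |].
    + intros p [<-|[]]; auto.
    + right; right; right. exists (numM y); split; [auto|]. exists (codeM A); split; [auto|].
      simpl; auto 10.
Qed.

Lemma ShiftVar_num d i : ShiftVar (numM d) (numM i) (numM (shift_var d i)).
Proof.
  unfold shift_var. destruct (i <? d) eqn:X; [left|right]; rewrite numM_mem.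
  - apply Nat.ltb_lt in X; auto.
  - apply Nat.ltb_ge in X; split; [lia|reflexivity].
Qed.

Lemma IsShift_code c A : IsShift P (numM c) (codeM A) (codeM (shift c A)).
Proof.
  split; [apply Form_code|].
  refine (fin_just_set P _ HP just_shift_mono _ _).
  revert c; induction A; intros c.
  - apply (fin_just_intro _ _ just_shift_mono _ []); [auto|simpl; tauto|].
    exists (numM c); split; [auto|]. eexists; split; [apply Pcode|].
    eexists; split; [apply Pcode|split; [reflexivity|]].
    left. exists (numM i); split; [auto|]. exists (numM j); split; [auto|].
    exists (numM (shift_var c i)); split; [auto|]. exists (numM (shift_var c j)); split; [auto|].
    split; [apply ShiftVar_num|]. split; [apply ShiftVar_num|]. left; split; reflexivity.
  - apply (fin_just_intro _ _ just_shift_mono _ []); [auto|simpl; tauto|].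
    exists (numM c); split; [auto|]. eexists; split; [apply Pcode|].
    eexists; split; [apply Pcode|split; [reflexivity|]].
    left. exists (numM i); split; [auto|]. exists (numM j); split; [auto|].
    exists (numM (shift_var c i)); split; [auto|]. exists (numM (shift_var c j)); split; [auto|].
    split; [apply ShiftVar_num|]. split; [apply ShiftVar_num|]. right; split; reflexivity.
  - apply (fin_just_intro _ _ just_shift_mono _ []); [auto|simpl; tauto|].
    exists (numM c); split; [auto|]. eexists; split; [apply Pcode|].
    eexists; split; [apply Pcode|split; [reflexivity|]].
    right; left; split; reflexivity.
  - apply (fin_just_intro _ _ just_shift_mono _
      [pr (numM c) (pr (codeM A1) (codeM (shift c A1)));
       pr (numM c) (pr (codeM A2) (codeM (shift c A2)))]); [auto 10| |].
    + intros p [<-|[<-|[]]]; auto.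
    + exists (numM c); split; [auto|]. eexists; split; [apply Pcode|].
      eexists; split; [apply Pcode|split; [reflexivity|]].
      right; right; left. exists (codeM A1); split; [auto|]. exists (codeM A2); split; [auto|].
      exists (codeM (shift c A1)); split; [auto|]. exists (codeM (shift c A2)); split; [auto|].
      simpl; auto 10.
  - apply (fin_just_intro _ _ just_shift_mono _
      [pr (numM (S c)) (pr (codeM A) (codeM (shift (S c) A)))]); [auto 10| |].
    + intros p [<-|[]]; auto.
    + exists (numM c); split; [auto|]. eexists; split; [apply Pcode|].
      eexists; split; [apply Pcode|split; [reflexivity|]].
      right; right; right. exists (codeM A); split; [auto|].
      exists (codeM (shift (S c) A)); split; [auto|]. simpl; auto 10.
Qed.

Lemma IsShiftNum_code c A : IsShiftNum P c (codeM A) (codeM (shift c A)).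
Proof. exists (numM c); auto using IsShift_code. Qed.

Lemma Logical_code A : logical A -> Logical P (codeM A).
Proof.
  assert (PF : forall A, P (codeM A) /\ Form P (codeM A)) by (split; auto using Form_code).
  intros H; destruct H.
  - left. exists (codeM A); split; [auto|]. exists (codeM B); split; [auto|].
    repeat split; auto; apply PF.
  - right; left. exists (codeM A); split; [auto|]. exists (codeM B); split; [auto|].
    exists (codeM C); split; [auto|]. repeat split; auto; apply PF.
  - do 2 right; left. exists (codeM A); split; [auto|]. repeat split; auto; apply PF.
  - do 3 right; left. exists (codeM A); split; [auto|]. exists (codeM B); split; [auto|].
    repeat split; auto; apply PF.
  - do 4 right; left. exists (codeM A); split; [auto|]. exists (codeM (shift 0 A)); split; [auto|].
    split; [apply IsShiftNum_code|reflexivity].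
  - do 5 right; left. exists (numM i); split; [auto|]. split; [apply Nat_numM|reflexivity].
  - do 6 right. exists (numM i); split; [auto|]. exists (numM j); split; [auto|].
    exists (numM k); split; [auto|]. repeat (split; [apply Nat_numM|]). left; reflexivity.
  - do 6 right. exists (numM i); split; [auto|]. exists (numM j); split; [auto|].
    exists (numM k); split; [auto|]. repeat (split; [apply Nat_numM|]). right; left; reflexivity.
  - do 6 right. exists (numM i); split; [auto|]. exists (numM j); split; [auto|].
    exists (numM k); split; [auto|]. repeat (split; [apply Nat_numM|]). right; right; reflexivity.
Qed.

(** The justifying set and the witnesses in [P] serve unchanged in the universe. No induction on f
    takes place, so the argument covers nonstandard codes; the same holds for the next lemmas. *)
Lemma FvLt_univ n f : FvLt P n f -> FvLt univ n f.
Proof.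
  intros (S & _ & H & HS). exists S; split; auto. split; auto.
  intros p Hp. destruct (HS p Hp) as (m & _ & g & _ & A & B & C).
  exists m; split; auto. exists g; split; auto. split; auto. split; auto.
  destruct C as [C|[C|[(u & _ & v & _ & C)|(u & _ & C)]]]; auto.
  - right; right; left. exists u; split; auto. exists v; auto.
  - right; right; right. exists u; auto.
Qed.

Lemma Form_univ f : Form P f -> Form univ f.
Proof. intros (n & _ & H); exists n; auto using FvLt_univ. Qed.

Lemma FormIn_univ n f : FormIn P n f -> FormIn univ n f.
Proof. intros (k & _ & H1 & H2); exists k; auto using FvLt_univ. Qed.

Lemma IsShiftNum_univ c f g : IsShiftNum P c f g -> IsShiftNum univ c f g.
Proof.
  intros (k & _ & Hk & HF & S & _ & H & HS). exists k; split; auto. split; auto.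
  split; [apply Form_univ; auto|]. exists S; split; auto. split; auto.
  intros p Hp. destruct (HS p Hp) as (d & _ & u & _ & v & _ & A & B).
  exists d; split; auto. exists u; split; auto. exists v; split; auto. split; auto.
  destruct B as [(i & _ & j & _ & i' & _ & j' & _ & B)|
    [B|[(u1 & _ & u2 & _ & v1 & _ & v2 & _ & B)|(u1 & _ & v1 & _ & B)]]].
  - left. exists i; split; auto. exists j; split; auto. exists i'; split; auto. exists j'; auto.
  - auto.
  - do 2 right; left. exists u1; split; auto. exists u2; split; auto.
    exists v1; split; auto. exists v2; auto.
  - do 3 right. exists u1; split; auto. exists v1; auto.
Qed.

Lemma Logical_univ f : Logical P f -> Logical univ f.
Proof.
  assert (X := Form_univ).
  intros [(A & _ & B & _ & H)|[(A & _ & B & _ & C & _ & H)|[(A & _ & H)|[(A & _ & B & _ & H)|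
    [(A & _ & B & _ & H)|[(i & _ & H)|(i & _ & j & _ & k & _ & H)]]]]]].
  - left. exists A; split; auto. exists B; intuition.
  - right; left. exists A; split; auto. exists B; split; auto. exists C; intuition.
  - do 2 right; left. exists A; intuition.
  - do 3 right; left. exists A; split; auto. exists B; intuition.
  - do 4 right; left. exists A; split; auto. exists B; split; auto.
    destruct H; split; auto using IsShiftNum_univ.
  - do 5 right; left. exists i; auto.
  - do 6 right. exists i; split; auto. exists j; split; auto. exists k; auto.
Qed.

End InClosed.

Lemma KP_code_Infinity s : sat E (codeM Infinity ▹ s) (fKP 0).
Proof.
  assert (HP := closed_True). unfold fKP. apply hold_Or; right.
  apply hold_Or; right. apply hold_Or; right. apply hold_Or; left.
  eapply (hs_is univ); [auto|apply env_in_True|]. rewrite tv_quote; reflexivity.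
Qed.

Lemma KP_code_Pairing s : sat E (codeM Pairing ▹ s) (fKP 0).
Proof.
  assert (HP := closed_True). unfold fKP. apply hold_Or; right. apply hold_Or; left.
  eapply (hs_is univ); [auto|apply env_in_True|]. rewrite tv_quote; reflexivity.
Qed.

Lemma KP_code_Coll A s : Sigma1 A -> sat E (codeM (Coll A) ▹ s) (fKP 0).
Proof.
  intros (B & HB & ->). assert (HP := closed_True). unfold fKP.
  do 5 (apply hold_Or; right). apply hold_Or; left.
  apply hold_Ex; exists (codeM B); split; auto.
  apply hold_Ex; exists (codeM (Ex B)); split; auto.
  apply hold_Ex; exists (codeM (shift 2 (Ex B))); split; auto.
  assert (He := env_in_True (codeM (shift 2 (Ex B)) ▹ codeM (Ex B) ▹ codeM B ▹ codeM (Coll (Ex B)) ▹ s)).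
  apply hold_And; split; [|apply hold_And; split; [|apply hold_And; split]].
  - apply (spec_Delta0 univ); auto. apply IsDelta0_code; auto.
  - apply (hs_is univ); auto.
  - apply (spec_ShiftNum univ); auto. apply (IsShiftNum_code _ HP 2 (Ex B)).
  - apply (hs_is univ); auto.
Qed.

(** * Satisfaction of standard formulas *)

(** Agreement where t is defined. In particular the empty assignment, used by [fTrueEx], agrees with
    every s. *)
Definition assigns (t : M) (s : nat -> M) : Prop :=
  forall i a, E (pr (numM i) a) t -> a = s i.

Lemma pr_num_inj i j x y : pr (numM i) x = pr (numM j) y -> i = j /\ x = y.
Proof. intros H; apply pr_inj in H as [H1 H2]; apply numM_inj in H1; auto. Qed.

Lemma hv_inj b c g t g' t' : hv b g t = hv c g' t' -> b = c /\ g = g' /\ t = t'.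
Proof.
  intros H. apply pr_num_inj in H as [-> H]. apply pr_inj in H as [-> ->]; auto.
Qed.

Lemma assigns_Cons t' a t s : Cons t' a t -> assigns t s -> assigns t' (a ▹ s).
Proof.
  intros HC Ht i b H. apply HC in H as [H|(k & y & H & Heq)].
  - apply (pr_num_inj i 0) in H as [-> ->]. reflexivity.
  - apply pr_inj in Heq as [H1 ->]. symmetry in H1. apply suc_eq_numM in H1 as (m & -> & ->).
    simpl. auto.
Qed.

Lemma just_sat_Imp z X b A B t : just_sat z X (hv b (codeM (A ⇒ B)) t) ->
  (b = 1 /\ (X (hv 0 (codeM A) t) \/ X (hv 1 (codeM B) t))) \/
  (b = 0 /\ X (hv 1 (codeM A) t) /\ X (hv 0 (codeM B) t)).
Proof.
  change (codeM (A ⇒ B)) with (mImp (codeM A) (codeM B)).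
  intros (g & t1 & [(i & j & a & c & _ & _ & [[-> [[H _]|[H _]]]|[-> [[H _]|[H _]]]])|
    [[-> H]|[(u & v & -> & [[H K]|[H K]])|(u & -> & [[H _]|[H _]])]]]);
    apply hv_inj in H as (-> & H & ->); apply pr_num_inj in H as [H H']; try discriminate;
    apply pr_inj in H' as [-> ->]; auto.
Qed.

Lemma just_sat_All z X b A t : just_sat z X (hv b (codeM (All A)) t) ->
  (b = 1 /\ forall a, E a z -> exists t', Cons t' a t /\ X (hv 1 (codeM A) t')) \/
  (b = 0 /\ exists a, E a z /\ exists t', Cons t' a t /\ X (hv 0 (codeM A) t')).
Proof.
  change (codeM (All A)) with (mAll (codeM A)).
  intros (g & t1 & [(i & j & a & c & _ & _ & [[-> [[H _]|[H _]]]|[-> [[H _]|[H _]]]])|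
    [[-> H]|[(u & v & -> & [[H K]|[H K]])|(u & -> & [[H K]|[H K]])]]]);
    apply hv_inj in H as (-> & H & ->); apply pr_num_inj in H as [H H']; try discriminate;
    subst u; auto.
Qed.

Lemma just_sat_Bot z X b t : just_sat z X (hv b (codeM Bot) t) -> b = 0.
Proof.
  change (codeM Bot) with mBot.
  intros (g & t1 & [(i & j & a & c & _ & _ & [[-> [[H _]|[H _]]]|[-> [[H _]|[H _]]]])|
    [[-> H]|[(u & v & -> & [[H K]|[H K]])|(u & -> & [[H K]|[H K]])]]]);
    apply hv_inj in H as (-> & H & ->); auto;
    apply pr_num_inj in H as [H H']; discriminate.
Qed.

Lemma just_sat_Mem z X b i j t s : assigns t s -> just_sat z X (hv b (codeM (Mem i j)) t) ->
  (b = 1 /\ E (s i) (s j)) \/ (b = 0 /\ ~ E (s i) (s j)).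
Proof.
  change (codeM (Mem i j)) with (mMem (numM i) (numM j)). intros Ht.
  intros (g & t1 & [(i' & j' & a & c & Hi & Hj & [[-> [[H K]|[H K]]]|[-> [[H K]|[H K]]]])|
    [[-> H]|[(u & v & -> & [[H K]|[H K]])|(u & -> & [[H K]|[H K]])]]]);
    apply hv_inj in H as (-> & H & ->); apply pr_num_inj in H as [H H']; try discriminate;
    apply pr_inj in H' as [<- <-]; apply Ht in Hi, Hj; subst; auto.
Qed.

Lemma just_sat_Equ z X b i j t s : assigns t s -> just_sat z X (hv b (codeM (Equ i j)) t) ->
  (b = 1 /\ s i = s j) \/ (b = 0 /\ ~ s i = s j).
Proof.
  change (codeM (Equ i j)) with (mEqu (numM i) (numM j)). intros Ht.
  intros (g & t1 & [(i' & j' & a & c & Hi & Hj & [[-> [[H K]|[H K]]]|[-> [[H K]|[H K]]]])|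
    [[-> H]|[(u & v & -> & [[H K]|[H K]])|(u & -> & [[H K]|[H K]])]]]);
    apply hv_inj in H as (-> & H & ->); apply pr_num_inj in H as [H H']; try discriminate;
    apply pr_inj in H' as [<- <-]; apply Ht in Hi, Hj; subst; auto.
Qed.

(** Induction on the standard formula A. Truth and falsity are treated together, because an
    implication may be justified by the falsity of its premise. *)
Lemma just_sat_sound z S A :
  (forall p, E p S -> just_sat z (fun y => E y S) p) ->
  forall t s, assigns t s ->
    (E (hv 1 (codeM A) t) S -> hold E (fun x => E x z) s A) /\
    (E (hv 0 (codeM A) t) S -> ~ hold E (fun x => E x z) s A).
Proof.
  intros HS; induction A; intros t s Ht.
  - split; intros H; apply HS in H; apply (just_sat_Mem _ _ _ _ _ _ s) in H;
      auto; simpl; intuition congruence.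
  - split; intros H; apply HS in H; apply (just_sat_Equ _ _ _ _ _ _ s) in H;
      auto; simpl; intuition congruence.
  - split; intros H; apply HS in H; apply just_sat_Bot in H; [discriminate|simpl; auto].
  - destruct (IHA1 t s Ht), (IHA2 t s Ht).
    split; intros H'; apply HS in H'; apply just_sat_Imp in H'; simpl;
      intuition (try discriminate); auto.
  - split; intros H'; apply HS in H'; apply just_sat_All in H';
      destruct H' as [[H' K]|[H' K]]; try discriminate.
    + intros x Hx. destruct (K x Hx) as (t' & HC & H).
      apply (IHA t'); auto. apply (assigns_Cons t' x t); auto.
    + intros H. destruct K as (x & Hx & t' & HC & K).
      apply (IHA t' (x ▹ s)) in K; auto. apply (assigns_Cons t' x t); auto.
Qed.

Lemma Sat_sound z A t s : Sat z (codeM A) t -> assigns t s -> hold E (fun x => E x z) s A.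
Proof.
  intros (S & _ & H & HS) Ht. apply (just_sat_sound z S A HS t s Ht); auto.
Qed.

Fixpoint graph (k : nat) (l : list M) : list M :=
  match l with [] => [] | a :: l => pr (numM k) a :: graph (S k) l end.

Definition seqM (l : list M) : M := lset (graph 0 l).

Lemma in_graph k l q : In q (graph k l) <->
  exists i a, nth_error l i = Some a /\ q = pr (numM (k + i)) a.
Proof.
  revert k; induction l as [|b l IH]; intros k; simpl.
  - split; [tauto|]. intros ([|i] & a & H & _); discriminate.
  - rewrite IH. split.
    + intros [<-|(i & a & H & ->)]; [exists 0, b|exists (S i), a]; simpl; split; auto.
      * rewrite Nat.add_0_r; auto.
      * rewrite Nat.add_succ_r; auto.
    + intros ([|i] & a & H & ->); simpl in H.
      * injection H as ->. rewrite Nat.add_0_r; auto.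
      * right. exists i, a. rewrite Nat.add_succ_r; auto.
Qed.

Lemma seqM_spec l q : E q (seqM l) <-> exists i a, nth_error l i = Some a /\ q = pr (numM i) a.
Proof. unfold seqM. rewrite lset_spec, in_graph. reflexivity. Qed.

Lemma seqM_pr l x y : E (pr x y) (seqM l) <-> exists i, x = numM i /\ nth_error l i = Some y.
Proof.
  rewrite seqM_spec. split.
  - intros (i & a & H & Heq). apply pr_inj in Heq as [-> ->]; eauto.
  - intros (i & -> & H); eauto.
Qed.

Lemma Fun_seqM l : Fun (seqM l) (numM (length l)).
Proof.
  split.
  - intros q Hq. apply seqM_spec in Hq as (i & a & H & ->). exists (numM i), a. split; auto.
    apply numM_lt. apply nth_error_Some; congruence.
  - intros x Hx. apply numM_spec in Hx as (i & Hi & ->).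
    destruct (nth_error l i) as [a|] eqn:Ha; [|apply nth_error_Some in Ha; tauto].
    exists a. split; [apply seqM_pr; eauto|].
    intros z Hz. apply seqM_pr in Hz as (j & Hj & H). apply numM_inj in Hj. congruence.
Qed.

Lemma Cons_seqM a l : Cons (seqM (a :: l)) a (seqM l).
Proof.
  intros q. rewrite seqM_spec. split.
  - intros ([|i] & b & H & ->); simpl in H.
    + left. injection H as ->; reflexivity.
    + right. exists (numM i), b. split; [apply seqM_pr; eauto|reflexivity].
  - intros [->|(x & y & H & ->)]; [exists 0, a; auto|].
    apply seqM_pr in H as (i & -> & H). exists (S i), y; auto.
Qed.

Lemma Cons_unique t1 t2 a t : Cons t1 a t -> Cons t2 a t -> t1 = t2.
Proof. intros H1 H2. apply (ext M E W). intros q. rewrite (H1 q), (H2 q); tauto. Qed.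

Lemma closed_seqM P l : closed P -> (forall x, In x l -> P x) -> P (seqM l).
Proof.
  intros HP H. apply (closed_lset P (graph 0 l)); auto. intros q Hq.
  apply in_graph in Hq as (i & a & Ha & ->). apply (closed_pr P HP).
  - apply (closed_numM P HP).
  - apply H. eapply nth_error_In; eauto.
Qed.

Lemma assigns_seqM l s : (forall i a, nth_error l i = Some a -> a = s i) -> assigns (seqM l) s.
Proof. intros H i a Ha. apply seqM_pr in Ha as (j & Hj & Ha). apply numM_inj in Hj as ->. auto. Qed.

Lemma nth_error_map_seq (s : nat -> M) n i :
  i < n -> nth_error (map s (seq 0 n)) i = Some (s i).
Proof.
  intros H. rewrite nth_error_map, nth_error_seq.
  apply Nat.ltb_lt in H. rewrite H. reflexivity.
Qed.

Lemma assigns_map_seq s n : assigns (seqM (map s (seq 0 n))) s.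
Proof.
  apply assigns_seqM. intros i a. rewrite nth_error_map, nth_error_seq.
  destruct (i <? n); simpl; congruence.
Qed.

Lemma models_hold z n A s :
  models_of z (codeM A) -> fv_lt n A -> (forall i, i < n -> E (s i) z) ->
  hold E (fun x => E x z) s A.
Proof.
  intros H Hn Hs.
  assert (HP := closed_True).
  apply (Sat_sound z A (seqM (map s (seq 0 n)))); [|apply assigns_map_seq].
  apply (H (numM n)). split; [apply FvLt_code; auto|split].
  - assert (X := Fun_seqM (map s (seq 0 n))). rewrite length_map, length_seq in X; auto.
  - intros x y Hy. apply seqM_pr in Hy as (i & -> & Hy).
    apply nth_error_In, in_map_iff in Hy as (k & <- & Hk). apply in_seq in Hk.
    apply Hs; lia.
Qed.

Lemma just_sat_mono z (X Y : M -> Prop) p :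
  (forall x, X x -> Y x) -> just_sat z X p -> just_sat z Y p.
Proof.
  intros H (g & t & HJ). exists g, t.
  destruct HJ as [HJ|[HJ|[(u & v & -> & [[-> [K|K]]|[-> [K1 K2]]])|(u & -> & [[-> K]|[-> K]])]]];
    auto.
  - do 2 right; left. exists u, v; auto 10.
  - do 2 right; left. exists u, v; auto 10.
  - do 2 right; left. exists u, v; auto 10.
  - do 3 right. exists u; split; auto. left; split; auto.
    intros a Ha. destruct (K a Ha) as (t' & K1 & K2); eauto.
  - do 3 right. exists u; split; auto. right; split; auto.
    destruct K as (a & Ha & t' & K1 & K2); eauto 10.
Qed.

Fixpoint quantifier_free (A : form) : Prop :=
  match A with
  | Imp A B => quantifier_free A /\ quantifier_free B
  | All _ => False
  | _ => True
  end.

(** For a quantifier-free formula finitely many truth values form a justification, whereas a true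
    universal formula would need an evaluation for each element of z. *)
Lemma Sat_complete z n A t s :
  quantifier_free A -> fv_lt n A -> (forall i, i < n -> E (pr (numM i) (s i)) t) ->
  sat E s A -> Sat z (codeM A) t.
Proof.
  intros Hq Hfv Ht HA.
  assert (X : (sat E s A -> fin_just univ (just_sat z) (hv 1 (codeM A) t)) /\
              (~ sat E s A -> fin_just univ (just_sat z) (hv 0 (codeM A) t))).
  { clear HA. induction A; simpl in Hq; [| | | |tauto].
    - destruct Hfv as [Hi Hj]; simpl.
      split; intros H; apply (fin_just_intro _ _ (just_sat_mono z) _ []); auto;
        try (simpl; tauto);
        exists (mMem (numM i) (numM j)), t; left; exists (numM i), (numM j), (s i), (s j);
        auto 10.
    - destruct Hfv as [Hi Hj]; simpl.
      split; intros H; apply (fin_just_intro _ _ (just_sat_mono z) _ []); auto;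
        try (simpl; tauto);
        exists (mEqu (numM i) (numM j)), t; left; exists (numM i), (numM j), (s i), (s j);
        auto 10.
    - split; [intros []|]. intros _.
      apply (fin_just_intro _ _ (just_sat_mono z) _ []); auto; try (simpl; tauto).
      exists mBot, t; right; left; split; reflexivity.
    - destruct Hfv as [H1 H2], Hq as [Q1 Q2].
      destruct (IHA1 Q1 H1) as [P1 N1], (IHA2 Q2 H2) as [P2 N2]. split; intros H.
      + destruct (classic (sat E s A1)) as [T|T].
        * apply (fin_just_intro _ _ (just_sat_mono z) _ [hv 1 (codeM A2) t]); auto.
          -- intros p [<-|[]]; auto.
          -- exists (mImp (codeM A1) (codeM A2)), t. do 2 right; left.
             exists (codeM A1), (codeM A2). split; auto. left; split; [reflexivity|].
             right; simpl; auto.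
        * apply (fin_just_intro _ _ (just_sat_mono z) _ [hv 0 (codeM A1) t]); auto.
          -- intros p [<-|[]]; auto.
          -- exists (mImp (codeM A1) (codeM A2)), t. do 2 right; left.
             exists (codeM A1), (codeM A2). split; auto. left; split; [reflexivity|].
             left; simpl; auto.
      + simpl in H.
        apply (fin_just_intro _ _ (just_sat_mono z) _ [hv 1 (codeM A1) t; hv 0 (codeM A2) t]); auto.
        * intros p [<-|[<-|[]]]; tauto.
        * exists (mImp (codeM A1) (codeM A2)), t. do 2 right; left.
          exists (codeM A1), (codeM A2). split; auto. right; split; [reflexivity|].
          simpl; auto. }
  apply (fin_just_set univ _ closed_True (just_sat_mono z)). apply X; auto.
Qed.

Lemma Sat_qf z n A t s :
  quantifier_free A -> fv_lt n A -> (forall i, i < n -> E (pr (numM i) (s i)) t) ->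
  assigns t s -> Sat z (codeM A) t <-> sat E s A.
Proof.
  intros Hq Hfv Ht Ht'. split; [|apply (Sat_complete z n); auto].
  intros H. apply (Sat_sound _ _ _ s) in H; auto.
  clear - H Hq. assert (X : hold E (fun x => E x z) s A <-> sat E s A); [|tauto].
  clear H. induction A; simpl in *; tauto.
Qed.

(** Quantifier-free definitions with parameters give all the sets needed from the levels: an element
    of a level, the empty set, an adjunction, and the level itself. *)
Lemma IsDef_qf x y n A s :
  quantifier_free A -> fv_lt (S n) A -> (forall i, i < n -> E (s i) x) ->
  (forall w, E w y <-> E w x /\ sat E (w ▹ s) A) -> IsDef x y.
Proof.
  intros Hq Hfv Hs Hy. set (l := map s (seq 0 n)).
  assert (HP := closed_True).
  exists (numM n), (numM (S n)), (codeM A), (seqM l).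
  split; [reflexivity|]. split; [apply FvLt_code; auto|]. split; [|split].
  - assert (X := Fun_seqM l). unfold l in X at 2. rewrite length_map, length_seq in X; auto.
  - intros i a H. apply seqM_pr in H as (k & -> & H). unfold l in H.
    rewrite nth_error_map, nth_error_seq in H.
    destruct (k <? n) eqn:Hk; simpl in H; [|discriminate].
    injection H as <-. apply Hs, Nat.ltb_lt; auto.
  - intros w. rewrite Hy.
    assert (X : Sat x (codeM A) (seqM (w :: l)) <-> sat E (w ▹ s) A).
    { apply (Sat_qf x (S n)); auto.
      - intros i Hi. apply seqM_pr. exists i; split; auto.
        destruct i as [|i]; simpl; auto. apply nth_error_map_seq; lia.
      - apply (assigns_Cons _ w (seqM l)); [apply Cons_seqM|apply assigns_map_seq]. }
    split; intros [H1 H2]; split; auto.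
    + exists (seqM (w :: l)). split; [apply Cons_seqM|apply X; auto].
    + destruct H2 as (t' & HC & H2). apply X.
      rewrite (Cons_unique _ _ _ _ (Cons_seqM w l) HC); auto.
Qed.

Lemma IsDef_sub x y w : IsDef x y -> E w y -> E w x.
Proof. intros (n & m & f & t & _ & _ & _ & _ & H) Hw. apply H in Hw; tauto. Qed.

(** * Constructible levels in models of KP1 *)

Hypothesis HKP : forall A, KP1 A -> forall s, sat E s A.

Lemma Delta0_fTrans x : Delta0 (fTrans x).
Proof. repeat constructor. Qed.

Lemma Delta0_fOrd x : Delta0 (fOrd x).
Proof. repeat constructor. Qed.

Lemma sat_Trans s (x : nat) : sat E s (fTrans x) <-> Trans (s x).
Proof. apply spec_Trans; [apply closed_True|apply env_in_True]. Qed.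

Lemma sat_Ord s (x : nat) : sat E s (fOrd x) <-> Ord (s x).
Proof. apply spec_Ord; [apply closed_True|apply env_in_True]. Qed.

Lemma mem_irrefl x : ~ E x x.
Proof.
  apply (Delta0_induction _ _ HKP (¬ Mem 0 0) (fun _ => x)).
  - repeat constructor.
  - intros y H Hy. apply (H y Hy Hy).
Qed.

Lemma Ord_mem x y : Ord x -> E y x -> Ord y.
Proof.
  intros [H1 H2] Hy. split; [apply H2; auto|]. intros z Hz. apply H2. apply (H1 y); auto.
Qed.

Lemma Ord_suc x : Ord x -> Ord (suc x).
Proof.
  intros [H1 H2]. split.
  - intros y Hy z Hz. apply suc_spec in Hy as [Hy| ->]; apply suc_spec; left; auto.
    apply (H1 y); auto.
  - intros y Hy. apply suc_spec in Hy as [Hy| ->]; auto.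
Qed.

Lemma Ord_zero : Ord zero.
Proof. split; intros y Hy; apply not_in_zero in Hy; tauto. Qed.

(** A double induction within the strength of KP_1: the outer one, on x, is for a Π1 formula
    quantifying over all y, and the inner one, on y, is for a Δ0 formula. If no element of either
    ordinal reaches the other, the two have the same elements. *)
Lemma Ord_trichotomy x y : Ord x -> Ord y -> E x y \/ x = y \/ E y x.
Proof.
  set (B := fOrd 0 ⇒ (Mem 1 0 ∨ Equ 1 0 ∨ Mem 0 1)).
  assert (HB : forall z w s, sat E (z ▹ w ▹ s) B <-> (Ord z -> E w z \/ w = z \/ E z w)).
  { intros z w s. unfold B. apply hs_imp; [apply (sat_Ord (z ▹ w ▹ s) 0)|].
    apply hs_or; [|apply hs_or]; reflexivity. }
  assert (DB : Delta0 B).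
  { repeat constructor. }
  assert (X : forall x y, sat E (y ▹ x ▹ (fun _ => zero)) (fOrd 1 ⇒ B)).
  { clear x y. intros x y.
    apply (Pi1_induction _ _ HKP); [constructor; [apply Delta0_fOrd|auto]|].
    clear x y. intros x IHx z Hx. apply (sat_Ord _ 1) in Hx. simpl in Hx.
    revert z. apply (Delta0_induction _ _ HKP); auto.
    intros y IHy. apply HB. intros Hy.
    destruct (classic (exists y', E y' y /\ (x = y' \/ E x y'))) as [(y' & H & H')|N1].
    { left. destruct H' as [->|H']; auto. apply (proj1 Hy y'); auto. }
    destruct (classic (exists x', E x' x /\ (x' = y \/ E y x'))) as [(x' & H & H')|N2].
    { right; right. destruct H' as [<-|H']; auto. apply (proj1 Hx x'); auto. }
    right; left. apply (ext M E W). intros w; split; intros Hw.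
    - assert (K := IHx w Hw y (proj2 (sat_Ord (y ▹ w ▹ _) 1) (Ord_mem _ _ Hx Hw))).
      apply HB in K; auto. destruct K as [K|[K|K]]; auto; exfalso; apply N2; eauto.
    - assert (K := IHy w Hw). apply HB in K; [|apply (Ord_mem y); auto].
      destruct K as [K|[K|K]]; auto; exfalso; apply N1; eauto. }
  intros Hx Hy. apply (HB y x (fun _ => zero)); auto. apply X. apply (sat_Ord _ 1); auto.
Qed.

(** Access to the first component by a quantifier bounded by the pair itself; this keeps the
    induction formulas about levels Δ0. *)
Lemma first_component b i y : (forall c, E c (pr i y) -> E b c) <-> b = i.
Proof.
  split.
  - intros H. specialize (H (upr i i)). rewrite upr_spec in H.
    destruct H; auto. apply pr_spec; auto.
  - intros -> c Hc. apply pr_spec in Hc as [->| ->]; apply upr_spec; auto.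
Qed.

Lemma component c w i y : E c (pr i y) -> E w c -> w = i \/ w = y.
Proof. intros Hc Hw. apply pr_spec in Hc as [->| ->]; apply upr_spec in Hw; tauto. Qed.

Lemma component_r i y : exists c, E c (pr i y) /\ E y c.
Proof. exists (upr i y). split; [apply pr_spec|apply upr_spec]; auto. Qed.

(** The induction formula says that every pair in h with first component b lies in h'. It does not
    mention definability and is Δ0 in the parameters h and h'; the recursion equation for levels
    enters only in the inductive step. *)
Lemma levels_unique h h' d : Trans d -> levels h d -> levels h' d ->
  forall q, E q h -> E q h'.
Proof.
  intros Hd [[Hh1 Hh2] Hh] [[Hh1' Hh2'] Hh'].
  set (A := AllIn 1 (AllIn 0 (Mem 2 0) ⇒ Mem 0 3)).
  assert (HA : forall b s, sat E (b ▹ h ▹ h' ▹ s) A <->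
            forall q, E q h -> (forall c, E c q -> E b c) -> E q h').
  { intros b s. split; intros H q; [intros Hq H'; apply (H q I Hq)|intros _ Hq H'; apply (H q Hq)];
      intros c Hc; try intros Hc'; apply H'; auto. }
  assert (X : forall b, sat E (b ▹ h ▹ h' ▹ (fun _ => h)) A).
  { apply (Delta0_induction _ _ HKP); [repeat constructor|].
    intros b IH. apply HA. intros q Hq Hb.
    destruct (Hh1 q Hq) as (i & w & Hi & ->). apply first_component in Hb as <-.
    assert (IH' : forall c v, E c b -> E (pr c v) h -> E (pr c v) h').
    { intros c v Hc Hv. apply (proj1 (HA c _) (IH c Hc)); auto. apply first_component; auto. }
    destruct (Hh2' b Hi) as (w' & Hw' & _).
    replace w with w'; auto. apply (ext M E W). intros y.
    rewrite (Hh b w Hq), (Hh' b w' Hw'). split; intros (c & Hc & v & Hv & HD).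
    - exists c; split; auto. destruct (Hh2 c) as (v0 & Hv0 & _); [apply (Hd b); auto|].
      assert (Hv0' := IH' c v0 Hc Hv0).
      destruct (Hh2' c) as (v1 & _ & U); [apply (Hd b); auto|].
      rewrite (U v Hv), <- (U v0 Hv0') in HD. eauto.
    - exists c; split; auto. eauto. }
  intros q Hq. destruct (Hh1 q Hq) as (b & w & Hb & ->).
  apply (proj1 (HA b _) (X b)); auto. apply first_component; auto.
Qed.

Lemma IsL_unique a z z' : IsL a z -> IsL a z' -> z = z'.
Proof.
  intros [Ha (h & Hh & Hz)] [_ (h' & Hh' & Hz')].
  assert (H := levels_unique h h' (suc a) (proj1 (Ord_suc a Ha)) Hh Hh' _ Hz).
  destruct Hh' as [[_ F] _]. destruct (F a) as (w & _ & U); [apply suc_spec; auto|].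
  rewrite (U z), (U z'); auto.
Qed.

Section Levels.
Variables (a h : M).
Hypotheses (Ha : Ord a) (Hh : levels h (suc a)).

Lemma level_dom b w : E (pr b w) h -> E b (suc a).
Proof.
  intros H. destruct Hh as [[H1 _] _].
  destruct (H1 _ H) as (i & y & Hi & Heq). apply pr_inj in Heq as [<- <-]; auto.
Qed.

Lemma level_Ord b w : E (pr b w) h -> Ord b.
Proof. intros H. apply (Ord_mem (suc a)); [apply Ord_suc; auto|]. apply (level_dom b w); auto. Qed.

Lemma level_total b : E b (suc a) -> exists w, E (pr b w) h.
Proof. intros H. destruct Hh as [[_ H2] _]. destruct (H2 b H) as (w & Hw & _); eauto. Qed.

Lemma level_spec b w y : E (pr b w) h ->
  E y w <-> exists c, E c b /\ exists v, E (pr c v) h /\ IsDef v y.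
Proof. intros H. apply (proj2 Hh); auto. Qed.

(* Induction on the index of a level, for properties Q b w of [w = L_b] that
   are uniformly Delta0 (and hold trivially of b itself, the other element of an
   element of the pair (b, w)). *)
Lemma level_induction (A : form) (Q : M -> M -> Prop) :
  Delta0 A ->
  (forall w c q b s, sat E (w ▹ c ▹ q ▹ b ▹ s) A <-> Q b w) ->
  (forall b, Ord b -> Q b b) ->
  (forall b w, E (pr b w) h ->
     (forall c v, E c b -> E (pr c v) h -> Q c v) -> Q b w) ->
  forall b w, E (pr b w) h -> Q b w.
Proof.
  intros DA HA Hself Hstep.
  set (B := AllIn 1 (AllIn 0 (Mem 2 0) ⇒ AllIn 0 (AllIn 0 A))).
  assert (HB : forall b s, sat E (b ▹ h ▹ s) B <-> forall w, E (pr b w) h -> Q b w).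
  { intros b s. split.
    - intros H w Hw. destruct (component_r b w) as (c & Hc & Hcw).
      apply (HA w c (pr b w) b (h ▹ s)).
      apply (H (pr b w) I Hw); auto. intros c' _ Hc'.
      apply (proj2 (first_component b b w) eq_refl c' Hc').
    - intros H q _ Hq Hb c _ Hc w _ Hw. apply (HA w c q b (h ▹ s)).
      destruct (proj1 (proj1 Hh) q Hq) as (i & y & Hi & ->).
      assert (b = i) as <-.
      { apply (first_component b i y). intros c' Hc'. apply (Hb c' I Hc'). }
      simpl in Hq, Hc, Hw. destruct (component _ _ _ _ Hc Hw) as [->| ->]; auto.
      apply Hself. apply (level_Ord b y); auto. }
  assert (X : forall b, sat E (b ▹ h ▹ (fun _ => h)) B).
  { apply (Delta0_induction _ _ HKP); [repeat constructor; auto|].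
    intros b IH. apply HB. intros w Hw. apply Hstep; auto.
    intros c v Hc Hv. apply (proj1 (HB c _) (IH c Hc)); auto. }
  intros b w Hw. apply (proj1 (HB b _) (X b)); auto.
Qed.

(** If z ∈ y with y definable over L_c, then z ∈ L_c. As L_c is transitive by induction, z is {x ∈
    L_c : x ∈ z} and so is definable over L_c as well. *)
Lemma level_Trans b w : E (pr b w) h -> Trans w.
Proof.
  revert b w. apply (level_induction (fTrans 0) (fun _ w => Trans w)).
  - apply Delta0_fTrans.
  - intros w c q b s; apply (sat_Trans (w ▹ c ▹ q ▹ b ▹ s) 0).
  - intros b [H _]; auto.
  - intros b w Hw IH y Hy z Hz.
    apply (level_spec b w y Hw) in Hy as (c & Hc & v & Hv & HD).
    assert (Tv := IH c v Hc Hv).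
    apply (level_spec b w z Hw). exists c; split; auto. exists v; split; auto.
    assert (Hzv : E z v) by (apply (IsDef_sub v y); auto).
    apply (IsDef_qf v z 1 (Mem 0 1) (fun _ => z)); simpl; auto.
    intros x. split; [|tauto]. intros Hx; split; auto. apply (Tv z); auto.
Qed.

(** Let y be definable over L_c with c below b. By trichotomy only c ∈ y has to be excluded; it
    would give c ∈ L_c, and then c ∈ c by induction. *)
Lemma level_rank b w : E (pr b w) h -> forall y, E y w -> Ord y -> E y b.
Proof.
  revert b w.
  apply (level_induction (AllIn 0 (fOrd 0 ⇒ Mem 0 4)) (fun b w => forall y, E y w -> Ord y -> E y b)).
  - repeat constructor.
  - intros w c q b s. rewrite hold_AllIn.
    split; intros H y; [intros Hy Ho; apply (H y I Hy)|intros _ Hy Ho; apply (H y Hy)].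
    + apply (proj2 (sat_Ord (y ▹ w ▹ c ▹ q ▹ b ▹ s) 0)); auto.
    + apply (proj1 (sat_Ord (y ▹ w ▹ c ▹ q ▹ b ▹ s) 0)); auto.
  - auto.
  - intros b w Hw IH y Hy Ho.
    apply (level_spec b w y Hw) in Hy as (c & Hc & v & Hv & HD).
    assert (Oc := level_Ord c v Hv). assert (Ob := level_Ord b w Hw).
    destruct (Ord_trichotomy y c Ho Oc) as [H|[H|H]].
    + apply (proj1 Ob c); auto.
    + subst; auto.
    + exfalso. apply (mem_irrefl c). apply (IH c v Hc Hv); auto.
      apply (IsDef_sub v y); auto.
Qed.

(** The inductive set i is definable over L_c for some c below a, and c ∉ i because L_c contains no
    ordinal from c on. Hence some ordinal up to c is missing from i, and the least one is neither
    zero nor a successor. *)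
Lemma limit_below z i : E (pr a z) h -> E i z -> E zero i ->
  (forall x, E x i -> E (suc x) i) ->
  exists l, E l a /\ E zero l /\ forall x, E x l -> E (suc x) l.
Proof.
  intros Hz Hi H0 HS.
  apply (level_spec a z i Hz) in Hi as (c & Hc & v & Hv & HD).
  assert (Oc := level_Ord c v Hv).
  assert (Hci : ~ E c i).
  { intros H. apply (mem_irrefl c). apply (level_rank c v); auto.
    apply (IsDef_sub v i); auto. }
  (* l is the least ordinal outside the inductive set i *)
  assert (Hl : exists l, E l (suc c) /\ ~ E l i /\ forall x, E x l -> E x i).
  { apply NNPP; intros N. apply Hci.
    assert (X : forall x, sat E (x ▹ i ▹ suc c ▹ (fun _ => i)) (Mem 0 2 ⇒ Mem 0 1)).
    { apply (Delta0_induction _ _ HKP); [repeat constructor|].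
      intros x IH Hx. simpl in Hx |- *. apply NNPP; intros Hxi. apply N.
      exists x; repeat split; auto. intros y Hy. apply (IH y Hy). simpl.
      apply (proj1 (Ord_suc c Oc) x); auto. }
    apply (X c). simpl. apply suc_spec; auto. }
  destruct Hl as (l & Hlc & Hli & Hl).
  assert (Ol : Ord l) by (apply (Ord_mem (suc c)); auto; apply Ord_suc; auto).
  exists l. split; [|split].
  - apply suc_spec in Hlc as [H| ->]; auto. apply (proj1 Ha c); auto.
  - destruct (Ord_trichotomy zero l Ord_zero Ol) as [H|[H|H]]; auto.
    + subst; tauto.
    + apply not_in_zero in H; tauto.
  - intros x Hx.
    destruct (Ord_trichotomy (suc x) l) as [H|[H|H]]; auto.
    + apply Ord_suc. apply (Ord_mem l); auto.
    + subst. exfalso; auto.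
    + exfalso. apply suc_spec in H as [H| ->]; apply (mem_irrefl x); auto.
      apply (proj2 Ol x Hx l); auto.
Qed.

(** If x and y are definable over L_m and L_n, both belong to L_(k+1) with k the maximum of m and n.
    By transitivity of that level x ∪ {y} is definable over it, and k + 1 is still below l. *)
Lemma level_limit_closed l u : E (pr l u) h -> E zero l -> (forall x, E x l -> E (suc x) l) ->
  closed (fun x => E x u).
Proof.
  intros Hu H0 HS. assert (Tu := level_Trans l u Hu). assert (Ol := level_Ord l u Hu).
  assert (tot : forall c, E c l -> exists v, E (pr c v) h).
  { intros c Hc. apply level_total. apply (proj1 (Ord_suc a Ha) l); auto.
    apply (level_dom l u); auto. }
  split.
  - intros x y Hxy Hy. apply (Tu y); auto.
  - destruct (tot zero H0) as [v Hv]. apply (level_spec l u zero Hu).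
    exists zero; split; auto. exists v; split; auto.
    apply (IsDef_qf v zero 0 Bot (fun _ => zero)); simpl; auto; try lia.
    intros w. split; [|tauto]. intros Hw; apply not_in_zero in Hw; tauto.
  - intros x y Hx Hy.
    assert (X : exists k v, E k l /\ E (pr k v) h /\ E x v /\ E y v).
    { apply (level_spec l u x Hu) in Hx as (m & Hm & v & Hv & Dx).
      apply (level_spec l u y Hu) in Hy as (n & Hn & w & Hw & Dy).
      assert (Om := level_Ord m v Hv). assert (On := level_Ord n w Hw).
      assert (K : exists k, E k l /\ (m = k \/ E m k) /\ (n = k \/ E n k)).
      { destruct (Ord_trichotomy m n Om On) as [H|[H|H]];
          [exists n|exists n|exists m]; auto. }
      destruct K as (k & Hk & Hmk & Hnk). destruct (tot (suc k)) as [v' Hv']; auto.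
      exists (suc k), v'. repeat split; auto.
      - apply (level_spec (suc k) v' x Hv'). exists m; split; [|eauto].
        apply suc_spec; destruct Hmk; auto.
      - apply (level_spec (suc k) v' y Hv'). exists n; split; [|eauto].
        apply suc_spec; destruct Hnk; auto. }
    destruct X as (k & v & Hk & Hv & Hxv & Hyv).
    apply (level_spec l u _ Hu). exists k; split; auto. exists v; split; auto.
    apply (IsDef_qf v _ 2 (Mem 0 1 ∨ Equ 0 2) (x ▹ (fun _ => y))).
    + simpl; auto.
    + simpl; lia.
    + intros [|j] _; simpl; auto.
    + intros w. rewrite adj_spec, hold_Or. simpl. split; [|tauto].
      intros [Hw| ->]; split; auto. apply (level_Trans k v Hv x); auto.
Qed.

End Levels.

Lemma IsL_Trans a z : IsL a z -> Trans z.
Proof. intros [Ha (h & Hh & Hz)]. apply (level_Trans a h Ha Hh a z); auto. Qed.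

(** The set u is L_l for the limit l below a that an inductive set in L_a provides. It belongs to
    L_a because it is defined over itself by a tautology. *)
Lemma IsL_closed_set a z : IsL a z -> models_of z (codeM Infinity) ->
  exists u, E u z /\ closed (fun x => E x u).
Proof.
  intros HL HI. assert (Tz := IsL_Trans a z HL). destruct HL as [Ha (h & Hh & Hz)].
  apply (models_hold z 0 Infinity (fun _ => z)) in HI; [|simpl; repeat split; lia|lia].
  apply hold_Ex in HI as (i & Hi & HI). apply hold_And in HI as [H0 HS].
  apply hold_ExIn in H0 as (e & He & Hei & H0).
  assert (e = zero) as ->.
  { apply (ext M E W). intros w; split; intros Hw.
    - exfalso. apply (H0 w); auto. apply (Tz e); auto.
    - apply not_in_zero in Hw; tauto. }
  simpl in Hei.
  destruct (limit_below a h Ha Hh z i Hz Hi Hei) as (l & Hla & Hl0 & HlS).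
  { intros x Hx. assert (Hxz : E x z) by (apply (Tz i); auto).
    specialize (HS x Hxz Hx). apply hold_ExIn in HS as (y & Hy & Hyi & HS).
    replace (suc x) with y; auto. apply (ext M E W). intros w. rewrite suc_spec.
    split; intros Hw.
    - specialize (HS w (Tz y Hy w Hw)). apply hold_Iff in HS. rewrite hold_Or in HS.
      simpl in HS; tauto.
    - assert (Hwz : E w z) by (destruct Hw as [Hw| ->]; auto; apply (Tz x); auto).
      specialize (HS w Hwz). apply hold_Iff in HS. rewrite hold_Or in HS.
      simpl in HS; tauto. }
  destruct (level_total a h Hh l) as [u Hu]; [apply suc_spec; auto|].
  exists u. split; [|apply (level_limit_closed a h Ha Hh l u); auto].
  apply (level_spec a h Hh a z u Hz). exists l; split; auto. exists u; split; auto.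
  apply (IsDef_qf u u 0 (Bot ⇒ Bot) (fun _ => u)); simpl; auto; try lia. tauto.
Qed.

(** * Δ0 definitions of codes and the meaning of the fixed point *)

Lemma sat_succ_bounded s (y x : nat) :
  sat E s (succ_bounded y x) <-> s y = suc (s x).
Proof.
  assert (HP := closed_True). assert (Hs := env_in_True s).
  transitivity ((forall w, E w (s y) -> E w (s x) \/ w = s x) /\
     (forall w, E w (s x) -> E w (s y)) /\ E (s x) (s y)).
  - unfold succ_bounded. hspec.
  - split.
    + intros (H1 & H2 & H3). apply (ext M E W). intros w. rewrite suc_spec.
      split; auto. intros [H| ->]; auto.
    + intros ->. split; [|split]; [intros w; apply suc_spec| |]; try intros w Hw; apply suc_spec; auto.
Qed.

Lemma sat_upair_bounded s (z x y : nat) :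
  sat E s (upair_bounded z x y) <-> s z = upr (s x) (s y).
Proof.
  assert (HP := closed_True). assert (Hs := env_in_True s).
  transitivity ((forall w, E w (s z) -> w = s x \/ w = s y) /\
     E (s x) (s z) /\ E (s y) (s z)).
  - unfold upair_bounded. hspec.
  - split.
    + intros (H1 & H2 & H3). apply (ext M E W). intros w. rewrite upr_spec.
      split; auto. intros [->| ->]; auto.
    + intros ->. split; [|split]; [intros w; apply upr_spec| |]; try intros w Hw; apply upr_spec; auto.
Qed.

Lemma sat_pair_bounded s (p x y : nat) :
  sat E s (pair_bounded p x y) <-> s p = pr (s x) (s y).
Proof.
  assert (HP := closed_True). assert (Hs := env_in_True s).
  transitivity ((forall w, E w (s p) -> w = upr (s x) (s x) \/ w = upr (s x) (s y)) /\
     (exists w, E w (s p) /\ w = upr (s x) (s x)) /\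
     (exists w, E w (s p) /\ w = upr (s x) (s y))).
  - unfold pair_bounded. hspec.
    + apply (sat_upair_bounded (x0 ▹ s) 0 (S x) (S x)).
    + apply (sat_upair_bounded (x0 ▹ s) 0 (S x) (S y)).
    + apply (sat_upair_bounded (x0 ▹ s) 0 (S x) (S x)).
    + apply (sat_upair_bounded (x0 ▹ s) 0 (S x) (S y)).
  - split.
    + intros (H1 & (w1 & H2 & ->) & (w2 & H3 & ->)). apply (ext M E W).
      intros w. rewrite pr_spec. split; auto. intros [->| ->]; auto.
    + intros ->. split; [intros w; apply pr_spec|].
      split; eexists; split; try reflexivity; apply pr_spec; auto.
Qed.

Lemma sat_theta t v s : canonical t -> sat E (v ▹ s) (theta t) <-> v = tv (fun _ => zero) t.
Proof.
  assert (HP := closed_True). revert v s; induction t; intros v s Ht; simpl in Ht.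
  - tauto.
  - transitivity (forall w, E w v -> False).
    + simpl. split; intros H w; [intros Hw; apply (H w I Hw)|intros _ Hw; apply (H w Hw)].
    + simpl. split.
      * intros H. apply (ext M E W). intros w; split; intros Hw.
        -- destruct (H w Hw).
        -- apply not_in_zero in Hw; tauto.
      * intros -> w Hw. apply not_in_zero in Hw; auto.
  - destruct Ht as [n ->]. assert (IH := fun v s => IHt v s (canonical_num n)).
    transitivity (exists w, E w v /\ (w = tv (fun _ => zero) (num n) /\ v = suc w)).
    + cbn [theta]. eapply hs_exin; [eassumption|apply env_in_True|reflexivity|].
      intros w Hw. apply hs_and; [apply IH|]. apply (sat_succ_bounded (w ▹ v ▹ s) 1 0).
    + simpl. split; [intros (w & _ & -> & ->); auto|].
      intros ->. eexists; split; [|split; reflexivity]. apply suc_spec; auto.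
  - destruct Ht as [H1 H2].
    transitivity (exists c, E c v /\ exists a, E a c /\ (a = tv (fun _ => zero) t1 /\
       exists d, E d v /\ exists b, E b d /\ (b = tv (fun _ => zero) t2 /\ v = pr a b))).
    + cbn [theta]. eapply hs_exin; [eassumption|apply env_in_True|reflexivity|]. intros c Hc.
      eapply hs_exin; [eassumption|apply env_in_True|reflexivity|]. intros a Ha.
      apply hs_and; [apply IHt1; auto|].
      eapply hs_exin; [eassumption|apply env_in_True|reflexivity|]. intros d Hd.
      eapply hs_exin; [eassumption|apply env_in_True|reflexivity|]. intros b Hb.
      apply hs_and; [apply IHt2; auto|].
      apply (sat_pair_bounded (b ▹ d ▹ a ▹ c ▹ v ▹ s) 4 2 0).
    + simpl. split; [intros (c & _ & a & _ & -> & d & _ & b & _ & -> & ->); auto|].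
      intros ->. set (a := tv (fun _ => zero) t1). set (b := tv (fun _ => zero) t2).
      exists (upr a a). split; [apply pr_spec; auto|].
      exists a; split; [apply upr_spec; auto|]. split; auto.
      exists (upr a b). split; [apply pr_spec; auto|].
      exists b; split; [apply upr_spec; auto|]. auto.
Qed.

Definition mThetaSucc (q : M) : M := mExIn 0 (mAnd q (codeM (succ_bounded 1 0))).
Definition mThetaPair (q r : M) : M :=
  mExIn 0 (mExIn 0 (mAnd q (mExIn 2 (mExIn 0 (mAnd r (codeM (pair_bounded 4 2 0))))))).

Definition just_quote P (X : M -> Prop) (r : M) : Prop :=
  exists e, P e /\ exists q, P q /\ (r = pr e q /\
    ((e = zero /\ q = codeM (theta hzero))
     \/ (exists e1, P e1 /\ exists q1, P q1 /\
          (e = suc e1 /\ q = mThetaSucc q1 /\ X (pr e1 q1) /\ E zero e))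
     \/ (exists e1, P e1 /\ exists q1, P q1 /\ exists e2, P e2 /\ exists q2, P q2 /\
          (e = pr e1 e2 /\ q = mThetaPair q1 q2 /\ X (pr e1 q1) /\ X (pr e2 q2))))).

Definition QuoteRel P (v q : M) : Prop := justified P (just_quote P) (pr v q).

Lemma spec_QuoteRel P s (v q : nat) : closed P -> env_in P s ->
  hold E P s (fQuoteRel v q) <-> QuoteRel P (s v) (s q).
Proof.
  intros HP Hs. unfold fQuoteRel, QuoteRel, justified, just_quote. hspec.
Qed.

Lemma just_quote_mono P (X Y : M -> Prop) r :
  (forall x, X x -> Y x) -> just_quote P X r -> just_quote P Y r.
Proof.
  intros H (e & Pe & q & Pq & Hr & HJ). exists e; split; auto. exists q; split; auto.
  split; auto.
  destruct HJ as [HJ|[(e1 & P1 & q1 & P2 & A & B & C & D)|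
    (e1 & P1 & q1 & P2 & e2 & P3 & q2 & P4 & A & B & C & D)]]; auto.
  - right; left. exists e1; split; auto. exists q1; auto 10.
  - right; right. exists e1; split; auto. exists q1; split; auto.
    exists e2; split; auto. exists q2; auto 10.
Qed.

Local Notation tv0 := (tv (fun _ => zero)).

Lemma QuoteRel_theta P t : closed P -> canonical t -> QuoteRel P (tv0 t) (codeM (theta t)).
Proof.
  intros HP Ht. refine (fin_just_set P _ HP (just_quote_mono P) _ _).
  assert (Pc := closed_codeM P HP). assert (Pp := closed_pr P HP).
  assert (Pt : forall t, P (tv0 t)).
  { intros t'. apply closed_tv; auto. intros _. apply (closed_zero P HP). }
  induction t; simpl in Ht.
  - tauto.
  - apply (fin_just_intro _ _ (just_quote_mono P) _ []); [auto|simpl; tauto|].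
    exists zero; split; [apply (Pt hzero)|]. exists (codeM (theta hzero)); split; [auto|].
    split; auto.
  - apply (fin_just_intro _ _ (just_quote_mono P) _ [pr (tv0 t) (codeM (theta t))]); [auto| |].
    + intros p [<-|[]]. apply IHt. destruct Ht as [n ->]; apply canonical_num.
    + exists (tv0 (hsucc t)); split; [auto|]. exists (codeM (theta (hsucc t))); split; [auto|].
      split; [auto|]. right; left. exists (tv0 t); split; [auto|].
      exists (codeM (theta t)); split; [auto|]. repeat split; [simpl; auto|].
      destruct Ht as [n ->]. change (E (numM 0) (numM (S n))). apply numM_lt; lia.
  - destruct Ht.
    apply (fin_just_intro _ _ (just_quote_mono P) _
             [pr (tv0 t1) (codeM (theta t1)); pr (tv0 t2) (codeM (theta t2))]); [auto| |].
    + intros p [<-|[<-|[]]]; auto.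
    + exists (tv0 (hpair t1 t2)); split; [auto|].
      exists (codeM (theta (hpair t1 t2))); split; [auto|].
      split; [auto|]. right; right. exists (tv0 t1); split; [auto|].
      exists (codeM (theta t1)); split; [auto|]. exists (tv0 t2); split; [auto|].
      exists (codeM (theta t2)); split; [auto|]. repeat split; simpl; auto.
Qed.

(** Separates the clauses of [fQuoteRel]: the one for successors demands that zero be an element,
    which no pair satisfies. *)
Lemma zero_notin_pr x y : ~ E zero (pr x y).
Proof.
  intros H. apply pr_spec in H. apply (not_in_zero x).
  destruct H as [->| ->]; apply upr_spec; auto.
Qed.

(** On values of canonical terms the three clauses exclude one another: zero is empty, a positive
    numeral contains zero, a pair is nonempty without zero. Within a clause the components are
    determined, as pairing is injective and so is the successor on numerals. *)
Lemma QuoteRel_unique t q : canonical t -> QuoteRel univ (tv0 t) q -> q = codeM (theta t).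
Proof.
  intros Ht (S & _ & H & HS).
  revert q Ht H; induction t; intros q Ht H; simpl in Ht.
  - tauto.
  - destruct (HS _ H) as (e & _ & q' & _ & Heq & HJ). apply pr_inj in Heq as [<- <-].
    destruct HJ as [[_ HJ]|[(e1 & _ & q1 & _ & A & _)|(e1 & _ & q1 & _ & e2 & _ & q2 & _ & A & _)]]; auto.
    + exfalso. apply (not_in_zero e1). simpl in A. rewrite A. apply suc_spec; auto.
    + exfalso. apply (not_in_zero (upr e1 e1)). simpl in A. rewrite A.
      apply pr_spec; auto.
  - destruct Ht as [n ->].
    destruct (HS _ H) as (e & _ & q' & _ & Heq & HJ). apply pr_inj in Heq as [<- <-].
    destruct HJ as [[A _]|[(e1 & _ & q1 & _ & A & B & C & _)|
       (e1 & _ & q1 & _ & e2 & _ & q2 & _ & A & _)]].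
    + exfalso. change (numM (Datatypes.S n) = numM 0) in A. apply numM_inj in A. discriminate.
    + change (numM (Datatypes.S n) = suc e1) in A. symmetry in A.
      apply suc_eq_numM in A as (m & Hm & ->). injection Hm as <-.
      rewrite B. rewrite (IHt q1); auto using canonical_num.
    + exfalso. apply (zero_notin_pr e1 e2). simpl in A. rewrite <- A.
      change (E (numM 0) (numM (Datatypes.S n))). apply numM_lt; lia.
  - destruct Ht as [H1 H2].
    destruct (HS _ H) as (e & _ & q' & _ & Heq & HJ). apply pr_inj in Heq as [<- <-].
    destruct HJ as [[A _]|[(e1 & _ & q1 & _ & A & B & C & D)|
       (e1 & _ & q1 & _ & e2 & _ & q2 & _ & A & B & C & D)]].
    + exfalso. simpl in A.
      assert (X : E (upr (tv0 t1) (tv0 t1)) (pr (tv0 t1) (tv0 t2))) by (apply pr_spec; auto).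
      rewrite A in X. apply not_in_zero in X; auto.
    + exfalso. apply (zero_notin_pr (tv0 t1) (tv0 t2)). exact D.
    + simpl in A. apply pr_inj in A as [<- <-].
      rewrite B. rewrite (IHt1 q1), (IHt2 q2); auto.
Qed.

Lemma QuoteRel_univ P v q : QuoteRel P v q -> QuoteRel univ v q.
Proof.
  intros (S & _ & H & HS). exists S; split; auto. split; auto. intros p Hp.
  destruct (HS p Hp) as (e & _ & q' & _ & Hr & HJ). exists e; split; auto. exists q'; split; auto.
  split; auto.
  destruct HJ as [HJ|[(e1 & _ & q1 & _ & A)|(e1 & _ & q1 & _ & e2 & _ & q2 & _ & A)]]; auto.
  - right; left. exists e1; split; auto. exists q1; auto.
  - right; right. exists e1; split; auto. exists q1; split; auto.
    exists e2; split; auto. exists q2; auto.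
Qed.

Lemma sat_Closed s (u : nat) : sat E s (fClosed u) <-> closed (fun x => E x (s u)).
Proof.
  assert (HP := closed_True). assert (Hs := env_in_True s).
  transitivity (Trans (s u) /\ (exists e, E e (s u) /\ forall w, E w e -> False) /\
    forall a, E a (s u) -> forall b, E b (s u) -> exists c, E c (s u) /\
      ((forall w, E w c -> E w a \/ w = b) /\ (forall w, E w a -> E w c) /\ E b c)).
  - unfold fClosed. hspec.
    + apply (spec_Trans univ); auto.
    + reflexivity.
  - split.
    + intros (H1 & (e & He & H2) & H3). split.
      * intros x y Hxy Hy. apply (H1 y); auto.
      * replace zero with e; auto. apply (ext M E W). intros w; split; intros Hw.
        -- destruct (H2 w Hw).
        -- apply not_in_zero in Hw; tauto.
      * intros a b Ha Hb. destruct (H3 a Ha b Hb) as (c & Hc & K1 & K2 & K3).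
        replace (adj a b) with c; auto. apply (ext M E W). intros w.
        rewrite adj_spec. split; auto. intros [Hw| ->]; auto.
    + intros [H1 H2 H3]. split; [|split].
      * intros y Hy z Hz. apply (H1 z y); auto.
      * exists zero; split; auto. apply not_in_zero.
      * intros a Ha b Hb. exists (adj a b). split; auto.
        setoid_rewrite adj_spec. auto.
Qed.

Section FixedPointSpec.
Variables R F0 : form.

Definition mGamma (q e : M) : M :=
  mExInL R (mExIn 0 (mExIn 0 (mAnd q e))).

Definition SeqFor P (p v : M) : Prop :=
  exists q, P q /\ exists f, P f /\ (QuoteRel P v q /\ f = mGamma q v /\
    exists m, P m /\ exists n, P n /\ (Nat n /\ n = suc m /\ Fun p n /\ E (pr m f) p)).

Lemma tv_cGamma s (q e : nat) : tv s (cGamma R q e) = mGamma (s q) (s e).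
Proof.
  change (mAll (mImp (tv s (quote R))
            (mEx (mAnd (tv s (quote (fL 1 0)))
               (mExIn 0 (mExIn 0 (mExIn 0 (mAnd (s q) (s e)))))))) = mGamma (s q) (s e)).
  rewrite !tv_quote. reflexivity.
Qed.

Lemma spec_SeqFor P s (p v : nat) : closed P -> env_in P s ->
  hold E P s (fSeqFor R p v) <-> SeqFor P (s p) (s v).
Proof.
  intros HP Hs. unfold fSeqFor, SeqFor.
  apply hs_ex; auto; intros q Hq. apply hs_ex; auto; intros f Hf.
  apply hs_and; [|apply hs_and].
  - apply (spec_QuoteRel P (f ▹ q ▹ s) (2 + v) 1); auto.
  - rewrite (hs_is P) by auto.
    change (fun i => (f ▹ q ▹ s) (0 + i)) with (f ▹ q ▹ s). rewrite tv_cGamma. reflexivity.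
  - hspec.
    + apply (spec_Nat P (x0 ▹ x ▹ f ▹ q ▹ s) 0); auto.
    + apply (spec_Fun P (x0 ▹ x ▹ f ▹ q ▹ s) (4 + p) 0); auto.
Qed.

Definition F0_holds (w g : M) : Prop := sat E (w ▹ (fun _ => g)) F0.

(** Syntax is evaluated among the elements of u, but [F0] in the model itself. The sets y bounding
    the witnesses w are what collection gathers into one set. *)
Definition BadLine (u y p : M) : Prop :=
  let P := fun x => E x u in
  exists i, E i u /\ exists g, E g u /\
    ((E (pr i g) p /\ ~ Logical P g /\ ~ by_mp P p i g /\ ~ by_gen P p i g) /\
     ~ (FormIn P 0 g /\ forall w, E w y -> F0_holds w g)).

Hypothesis HF0 : fv_lt 2 F0.

Lemma sat_F0 w g s : sat E (w ▹ g ▹ s) F0 <-> F0_holds w g.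
Proof.
  apply (hold_fv _ _ _ 2); auto. intros [|[|i]] Hi; try reflexivity; lia.
Qed.

Lemma sat_rel_ren (z : nat) r s A :
  sat E s (rel z (ren r A)) <-> hold E (fun x => E x (s z)) (fun i => s (r i)) A.
Proof. rewrite hold_rel by auto. apply hold_ren. Qed.

Lemma spec_NonLogicalLine P s (p : nat) : closed P -> env_in P s ->
  hold E P s (fNonLogicalLine p) <->
  (E (pr (s 1) (s 0)) (s p) /\ ~ Logical P (s 0) /\
   ~ by_mp P (s p) (s 1) (s 0) /\ ~ by_gen P (s p) (s 1) (s 0)).
Proof.
  intros HP Hs. unfold fNonLogicalLine, by_mp, by_gen. hspec.
  apply (spec_Logical P); auto.
Qed.

Lemma sat_SeqFor s (u p v : nat) :
  closed (fun x => E x (s u)) -> E (s p) (s u) -> E (s v) (s u) ->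
  sat E s (rel u (ren (pick3 p v v) (fSeqFor R 0 1))) <-> SeqFor (fun x => E x (s u)) (s p) (s v).
Proof.
  intros HP Hp Hv. rewrite sat_rel_ren.
  apply (spec_SeqFor _ (fun i => s (pick3 p v v i)) 0 1); auto.
  intros [|[|i]]; simpl; auto.
Qed.

Lemma sat_BadLine s (y p u : nat) :
  closed (fun x => E x (s u)) -> E (s p) (s u) ->
  sat E s (fBadLine F0 y p u) <-> BadLine (s u) (s y) (s p).
Proof.
  intros HP Hp. unfold fBadLine, BadLine.
  assert (HU := closed_True).
  assert (K : forall i g, E i (s u) -> E g (s u) ->
    sat E (g ▹ i ▹ s) (rel (2 + u) (ren (pick3 0 1 (2 + p)) (fNonLogicalLine 2))
       ∧ ¬ (rel (2 + u) (ren (pick3 0 0 0) (fFormIn 0 0)) ∧ AllIn (2 + y) F0)) <->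
    ((E (pr i g) (s p) /\ ~ Logical (fun x => E x (s u)) g /\
      ~ by_mp (fun x => E x (s u)) (s p) i g /\ ~ by_gen (fun x => E x (s u)) (s p) i g) /\
     ~ (FormIn (fun x => E x (s u)) 0 g /\ forall w, E w (s y) -> F0_holds w g))).
  { intros i g Hi Hg. apply hs_and; [|apply hs_neg, hs_and].
    - rewrite sat_rel_ren.
      apply (spec_NonLogicalLine _ (fun k => (g ▹ i ▹ s) (pick3 0 1 (2 + p) k)) 2); auto.
      intros [|[|k]]; simpl; auto.
    - rewrite sat_rel_ren.
      apply (spec_FormIn _ (fun k => (g ▹ i ▹ s) (pick3 0 0 0 k)) 0 0); auto.
      intros [|[|k]]; simpl; auto.
    - eapply hs_allin; [eassumption|apply env_in_True|reflexivity|].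
      intros w _. apply sat_F0. }
  rewrite hold_ExIn. split.
  - intros (i & _ & Hi & H). apply hold_ExIn in H as (g & _ & Hg & H).
    exists i; split; auto. exists g; split; auto. apply K; auto.
  - intros (i & Hi & g & Hg & H). exists i; split; auto. split; auto.
    apply hold_ExIn. exists g; split; auto. split; auto. apply K; auto.
Qed.

Definition Beta (v u x : M) : Prop :=
  closed (fun z => E z u) /\
  exists b, E b x /\ forall p, E p u -> SeqFor (fun z => E z u) p v ->
    exists y, E y b /\ BadLine u y p.

Lemma sat_beta v u x s : E v u ->
  sat E (v ▹ u ▹ x ▹ s) (beta R F0) <-> Beta v u x.
Proof.
  intros Hv. unfold beta, beta0, Beta. rewrite hold_ren.
  set (s' := fun i => (v ▹ u ▹ x ▹ s) (Nat.min i 2)).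
  assert (HU := closed_True). rewrite hold_And, (sat_Closed s' 1).
  enough (X : closed (fun z => E z u) ->
    sat E s' (ExIn 2 (AllIn 2 (rel 3 (ren (pick3 0 2 2) (fSeqFor R 0 1)) ⇒
                          ExIn 1 (fBadLine F0 0 1 4)))) <->
    exists b, E b x /\ forall p, E p u -> SeqFor (fun z => E z u) p v ->
      exists y, E y b /\ BadLine u y p).
  { change (s' 1) with u. split; intros [HP H]; split; auto; apply X; auto. }
  intros HP.
  eapply hs_exin; [eassumption|apply env_in_True|reflexivity|]. intros b _.
  rewrite hold_AllIn. split; intros H p.
  - intros Hp HS. specialize (H p I Hp).
    destruct (proj1 (hold_ExIn _ E univ (p ▹ b ▹ s') 1 (fBadLine F0 0 1 4))
      (H (proj2 (sat_SeqFor (p ▹ b ▹ s') 3 0 2 HP Hp Hv) HS))) as (y & _ & Hy & HB).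
    exists y; split; auto. apply (sat_BadLine (y ▹ p ▹ b ▹ s') 0 1 4) in HB; auto.
  - intros _ Hp HS. apply (sat_SeqFor (p ▹ b ▹ s') 3 0 2 HP Hp Hv) in HS.
    destruct (H p Hp HS) as (y & Hy & HB). apply hold_ExIn. exists y; split; auto; split; auto.
    apply (sat_BadLine (y ▹ p ▹ b ▹ s') 0 1 4); auto.
Qed.

Lemma sat_coll_matrix y p u v s : closed (fun z => E z u) -> E p u -> E v u ->
  sat E (y ▹ p ▹ u ▹ v ▹ s) (coll_matrix R F0) <->
  (SeqFor (fun z => E z u) p v -> BadLine u y p).
Proof.
  intros HP Hp Hv. apply hs_imp.
  - apply (sat_SeqFor (y ▹ p ▹ u ▹ v ▹ s) 2 1 3); auto.
  - apply (sat_BadLine (y ▹ p ▹ u ▹ v ▹ s) 0 1 2); auto.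
Qed.

Lemma sat_delta x s :
  sat E (x ▹ s) (delta R F0) <->
  exists u, E u x /\ E (codeM (beta R F0)) u /\ Beta (codeM (beta R F0)) u x.
Proof.
  unfold delta. rewrite hold_ExIn. split.
  - intros (u & _ & Hu & H). apply hold_ExIn in H as (v & _ & Hv & H).
    apply hold_And in H as [H1 H2]. apply sat_theta in H1; [|apply canonical_quote].
    change (v = codeM (beta R F0)) in H1. subst v. apply sat_beta in H2; eauto.
  - intros (u & Hu & Hv & H). exists u; split; auto; split; auto. apply hold_ExIn.
    exists (codeM (beta R F0)); split; auto; split; auto. apply hold_And. split.
    + apply sat_theta; [apply canonical_quote|reflexivity].
    + apply sat_beta; auto.
Qed.

End FixedPointSpec.

(** * The fixed point holds in models of T *)

(* The represented ordinal a together with z = L_a. *)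
Record L_stage (R : form) (a z : M) : Prop := {
  stage_R : forall x s, sat E (x ▹ s) R <-> x = a;
  stage_L : forall z', IsL a z' <-> z' = z;
  stage_trans : Trans z;
  stage_closed : exists u, E u z /\ closed (fun x => E x u);
  stage_pair : forall x y, E x z -> E y z -> E (upr x y) z;
  stage_coll : forall A, Sigma1 A -> models_of z (codeM (Coll A)) }.

Lemma L_stage_exists R :
  representation R -> provably_admissible R -> (forall s, sat E s (Exists R)) ->
  exists a z, L_stage R a z.
Proof.
  intros (_ & Rfv & Runique) Radm Rex.
  assert (sound : forall A, prv KP1 A -> forall s, sat E s A).
  { intros A HA. apply (soundness _ _ KP1); auto. }
  set (s0 := fun _ : nat => zero).
  destruct (proj1 (hold_Ex _ _ _ _ _) (Rex s0)) as (a & _ & Ha).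
  assert (HR : forall x s, sat E (x ▹ s) R <-> x = a).
  { assert (Hind : forall x s s', sat E (x ▹ s) R -> sat E (x ▹ s') R).
    { intros x s s'. apply (hold_fv _ _ _ 1); auto. intros [|i] Hi; [reflexivity|lia]. }
    intros x s. split; [|intros ->; apply (Hind _ s0); auto].
    intros Hx. apply (sound _ Runique s0 x I a I). apply hold_And. split.
    - apply hold_shift. apply (Hind _ s); auto.
    - apply (Hind _ s0); auto. }
  (* Infinity will give the closed set u, Pairing the two-element witnesses such as {u, b}, and
     Σ1-Collection the bound b. *)
  set (Q := fun f => f = codeM Infinity \/ f = codeM Pairing \/
                     exists A, Sigma1 A /\ f = codeM (Coll A)).
  assert (HQ : forall f, Q f -> forall s', sat E (f ▹ s') (fKP 0)).
  { intros f [->|[->|(A & HA & ->)]] s'.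
    - apply KP_code_Infinity.
    - apply KP_code_Pairing.
    - apply KP_code_Coll; auto. }
  assert (Hadm := sound _ Radm s0 a I (proj2 (HR a s0) eq_refl)).
  apply (spec_Admissible _ _ Q HQ) in Hadm as (Oa & z & Hz & HM). simpl in Hz.
  assert (Tz := IsL_Trans a z Hz).
  exists a, z. split; auto.
  - intros z'. split; [|intros ->; auto]. intros H. apply (IsL_unique a); auto.
  - apply (IsL_closed_set a z Hz). apply HM. left; auto.
  - assert (HP : models_of z (codeM Pairing)) by (apply HM; right; left; auto).
    apply (models_hold z 0 Pairing (fun _ => z)) in HP; [|simpl; repeat split; lia|lia].
    intros x y Hx Hy. specialize (HP x Hx y Hy). apply hold_Ex in HP as (p & Hp & HP).
    replace (upr x y) with p; auto. apply (ext M E W). intros w. rewrite upr_spec.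
    split; intros Hw.
    + specialize (HP w (Tz p Hp w Hw)). apply hold_Iff in HP. rewrite hold_Or in HP.
      simpl in HP; tauto.
    + assert (Hwz : E w z) by (destruct Hw as [->| ->]; auto).
      specialize (HP w Hwz). apply hold_Iff in HP. rewrite hold_Or in HP.
      simpl in HP; tauto.
  - intros A HA. apply HM. right; right. exists A; auto.
Qed.

Section Stage.
Variables (R F0 : form) (a z : M).
Hypothesis HS : L_stage R a z.
Hypotheses (DF0 : Delta0 F0) (F0fv : fv_lt 2 F0).

Lemma hold_stage s A : Delta0 A -> (forall i, E (s i) z) ->
  hold E (fun x => E x z) s A <-> sat E s A.
Proof.
  intros DA Hs. apply Delta0_absolute; auto.
  intros x y Hxy Hy. apply (stage_trans _ _ _ HS y); auto.
Qed.

Lemma hold_F w g : E w z -> E g z -> forall s,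
  hold E (fun x => E x z) (w ▹ g ▹ s) F0 <-> F0_holds F0 w g.
Proof.
  intros Hw Hg s.
  transitivity (hold E (fun x => E x z) (w ▹ (fun _ => g)) F0).
  - apply (hold_fv _ _ _ 2); auto. intros [|[|i]] Hi; try reflexivity; lia.
  - apply hold_stage; auto. intros [|i]; auto.
Qed.

Lemma sat_gamma s : sat E s (gamma R F0) <->
  exists x, E x z /\ exists u, E u x /\ E (codeM (beta R F0)) u /\
     Beta R F0 (codeM (beta R F0)) u x.
Proof.
  unfold gamma. rewrite (spec_ExInL R a (stage_R _ _ _ HS) s _ z (stage_L _ _ _ HS)).
  split; intros (x & Hx & H); exists x; split; auto; apply (sat_delta R F0 F0fv x (z ▹ a ▹ s)); exact H.
Qed.

(** Collection inside L_a over the set u of candidate sequences. It applies because the matrix is Δ0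
    and therefore means the same in L_a as in the model. *)
Lemma collect u v : E u z -> closed (fun x => E x u) -> E v u ->
  (forall p, E p u -> SeqFor R (fun x => E x u) p v -> exists y, E y z /\ BadLine F0 u y p) ->
  exists b, E b z /\ forall p, E p u -> SeqFor R (fun x => E x u) p v ->
     exists y, E y b /\ BadLine F0 u y p.
Proof.
  intros Hu Cu Hv H.
  assert (Tz := stage_trans _ _ _ HS).
  assert (Hvz : E v z) by (apply (Tz u); auto).
  (* The vacuous quantifier produces the Σ1 form required by the schema. *)
  set (D := coll_matrix R F0). set (A := Ex (shift 0 D)).
  assert (DD : Delta0 D) by (apply Delta0_coll_matrix; auto).
  assert (HA : Sigma1 A).
  { exists (shift 0 D); split; auto. rewrite shift0_ren. apply Delta0_ren; auto. }
  assert (HC := stage_coll _ _ _ HS A HA).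
  destruct (fv_lt_bound (Coll A)) as [n Hn].
  apply (models_hold z n (Coll A) (fun _ => v)) in HC; auto.
  assert (HD : forall y p, E y z -> E p u ->
    hold E (fun x => E x z) (y ▹ p ▹ u ▹ (fun _ => v)) A <->
      (SeqFor R (fun x => E x u) p v -> BadLine F0 u y p)).
  { intros y p Hy Hp. rewrite <- (sat_coll_matrix R F0 F0fv y p u v (fun _ => v) Cu Hp Hv).
    unfold A. rewrite hold_Ex.
    transitivity (hold E (fun x => E x z) (y ▹ p ▹ u ▹ (fun _ => v)) D).
    - split; [intros (d & _ & Hd)|intros Hd; exists y; split; auto];
        revert Hd; rewrite hold_shift; exact (fun K => K).
    - replace (y ▹ p ▹ u ▹ v ▹ (fun _ => v)) with (y ▹ p ▹ u ▹ (fun _ => v))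
        by (extensionality i; destruct i as [|[|[|[|i]]]]; reflexivity).
      apply hold_stage; auto. intros [|[|[|i]]]; simpl; auto. apply (Tz u); auto. }
  specialize (HC u Hu).
  change (hold E (fun x => E x z) (u ▹ (fun _ => v)) (AllIn 0 (Ex A)) ->
     hold E (fun x => E x z) (u ▹ (fun _ => v)) (Ex (AllIn 1 (ExIn 1 (shift 2 A))))) in HC.
  assert (HC' : hold E (fun x => E x z) (u ▹ (fun _ => v)) (AllIn 0 (Ex A))).
  { intros p Hp Hpu. apply hold_Ex.
    destruct (classic (SeqFor R (fun x => E x u) p v)) as [X|X].
    - destruct (H p Hpu X) as (y & Hy & HB). exists y; split; auto. apply HD; auto.
    (* If p is not a sequence of the relevant kind, the matrix holds vacuously and any element of z
       will do. *)
    - exists u; split; auto. apply HD; auto. tauto. }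
  apply HC, hold_Ex in HC' as (b & Hb & HB).
  exists b; split; auto. intros p Hp HSq.
  assert (HB' := HB p (Tz u Hu p Hp) Hp).
  apply (hold_ExIn _ E (fun x => E x z) (p ▹ b ▹ u ▹ (fun _ => v)) 1) in HB' as (y & Hy & Hyb & HA').
  exists y; split; auto.
  apply (proj1 (HD y p Hy Hp)); [|exact HSq].
  rewrite shift_ren, hold_ren in HA'.
  replace (y ▹ p ▹ u ▹ (fun _ => v))
    with (fun i => (y ▹ p ▹ b ▹ u ▹ (fun _ => v)) (shift_var 2 i)); auto.
  extensionality i; destruct i as [|[|[|i]]]; reflexivity.
Qed.

(* If gamma fails, collection produces a sequence p that is an actual proof of
   gamma; so T proves [¬ gamma ⇒ Pr(gamma)]. *)
Lemma refuted_gamma_provable s :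
  ~ sat E s (gamma R F0) ->
  Pr (fun c => hold E (fun x => E x z) (fun _ => c) (All F0)) (codeM (gamma R F0)).
Proof.
  intros N. destruct (stage_closed _ _ _ HS) as (u & Hu & Cu).
  set (v := codeM (beta R F0)).
  assert (Hv : E v u) by apply (closed_codeM _ Cu).
  assert (Hp : exists p, E p u /\ SeqFor R (fun x => E x u) p v /\
            forall y, E y z -> ~ BadLine F0 u y p).
  { apply NNPP; intros N'. apply N.
    destruct (collect u v Hu Cu Hv) as (b & Hb & HB).
    { intros p Hp HSq. apply NNPP; intros N2. apply N'. exists p; repeat split; auto.
      intros y Hy HB. apply N2; eauto. }
    (* If every relevant p had a bad line, {u, b} would witness [gamma]. *)
    apply sat_gamma. exists (upr u b). split; [apply (stage_pair _ _ _ HS); auto|].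
    exists u. split; [apply upr_spec; auto|]. split; auto. split; auto.
    exists b. split; [apply upr_spec; auto|]. auto. }
  destruct Hp as (p & Hpu & (q & _ & f & _ & HQ & Hf & m & _ & n & _ & Nn & Hmn & Fp & Hm) & HB).
  apply QuoteRel_univ in HQ.
  apply (QuoteRel_unique (quote (beta R F0))) in HQ; [|apply canonical_quote].
  assert (f = codeM (gamma R F0)) as -> by (rewrite Hf, HQ; reflexivity).
  exists m, n, p. repeat (split; [assumption|]). intros i Hi g Hg.
  assert (Hpg := closed_trans _ Cu _ _ Hg Hpu).
  assert (Hiu := closed_pr_l _ Cu _ _ Hpg). assert (Hgu := closed_pr_r _ Cu _ _ Hpg).
  destruct (classic (Logical (fun x => E x u) g)) as [X1|X1].
  { left. apply (Logical_univ (fun x => E x u)); auto. }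
  destruct (classic (by_mp (fun x => E x u) p i g)) as [X2|X2].
  { right; right; left. destruct X2 as (j & Hj & k & Hk & e & _ & He).
    exists j; split; auto. exists k; split; auto. exists e; auto. }
  destruct (classic (by_gen (fun x => E x u) p i g)) as [X3|X3].
  { right; right; right. destruct X3 as (j & Hj & e & _ & He).
    exists j; split; auto. exists e; auto. }
  right; left.
  (* The condition holds for every bound y in L_a: y = u yields that g codes a sentence, and y = {w}
     yields F0(w, g) for an arbitrary w. *)
  assert (K : forall y, E y z ->
     FormIn (fun x => E x u) 0 g /\ forall w, E w y -> F0_holds F0 w g).
  { intros y Hy. apply NNPP; intros N'. apply (HB y Hy).
    exists i; split; auto. exists g; split; auto. }
  split.
  - apply (FormIn_univ (fun x => E x u)). apply (K u Hu).
  - intros w Hw.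
    replace (w ▹ (fun _ => g)) with (w ▹ g ▹ (fun _ => g))
        by (extensionality j; destruct j as [|[|j]]; reflexivity).
    apply hold_F; auto.
    + apply (stage_trans _ _ _ HS u); auto.
    + apply (proj2 (K (upr w w) (stage_pair _ _ _ HS w w Hw Hw))). apply upr_spec; auto.
Qed.

(** If [gamma] failed, it would be provable in the sense of [Pr]. Its code is [mExInL] of the code
    of the Δ0 formula [delta], so reflection would make the existential closure of [delta] true in
    L_a, and this is [gamma]. *)
Lemma gamma_holds s : (forall s', sat E s' (RFN R (All F0))) -> sat E s (gamma R F0).
Proof.
  intros HRFN. apply NNPP; intros N. assert (HPr := refuted_gamma_provable s N).
  assert (HU := closed_True).
  destruct (RFN_elim R a (stage_R _ _ _ HS) (All F0) s (codeM (delta R F0))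
     (fun c => hold E (fun x => E x z) (fun _ => c) (All F0))) as (z' & Hz' & HSat); auto.
  - intros c s'. rewrite (spec_atL R a (stage_R _ _ _ HS) (c ▹ s') _ z (stage_L _ _ _ HS)).
    apply (hold_fv _ _ _ 1); [exact F0fv|]. intros [|i] Hi; [reflexivity|lia].
  - apply FormIn_code; auto. apply fv_lt_delta.
  - apply IsDelta0_code; auto. apply Delta0_delta; auto.
  - apply (stage_L _ _ _ HS) in Hz' as ->. apply N.
    change (Sat z (codeM (Ex (delta R F0))) zero) in HSat.
    apply (Sat_sound z (Ex (delta R F0)) zero (fun _ => zero)) in HSat.
    + apply hold_Ex in HSat as (x & Hx & Hd).
      unfold gamma. apply (spec_ExInL R a (stage_R _ _ _ HS) s _ z (stage_L _ _ _ HS)).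
      exists x; split; auto.
      assert (Hd' : hold E (fun x => E x z) (fun _ => x) (delta R F0)).
      { revert Hd. apply (hold_fv _ _ _ 1); [apply fv_lt_delta|].
        intros [|i] Hi; [reflexivity|lia]. }
      apply (hold_stage (fun _ => x) (delta R F0) (Delta0_delta R F0 DF0) (fun _ => Hx)) in Hd'.
      revert Hd'. apply (hold_fv _ _ _ 1); [apply fv_lt_delta|].
      intros [|i] Hi; [reflexivity|lia].
    + intros i b Hb. apply not_in_zero in Hb; tauto.
Qed.

End Stage.

(** * The axiom refuted by a proof of gamma *)

(** The set u offered by [gamma] is arbitrary but closed, so it contains the codes of the given
    proof and the justifications of its logical lines. The bad line can thus only be an axiom A; as
    A is a sentence, F0(w, A) must fail for some w in y, and transitivity puts w into z. *)
Lemma gamma_refutes_axiom R F0 a z T l s :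
  L_stage R a z -> fv_lt 2 F0 -> theory T ->
  proof_seq T (l ++ [gamma R F0]) -> sat E s (gamma R F0) ->
  exists A, In A (l ++ [gamma R F0]) /\ T A /\ E (codeM A) z /\
    exists w, E w z /\ ~ F0_holds F0 w (codeM A).
Proof.
  intros HS F0fv HT Hl Hg.
  apply (sat_gamma R F0 a z HS F0fv) in Hg as (x & Hx & u & Hu & Hv & Cu & b & Hb & H).
  assert (Tz := stage_trans _ _ _ HS).
  assert (Pc := closed_codeM _ Cu). assert (Pn := closed_numM _ Cu).
  set (ls := l ++ [gamma R F0]) in *.
  set (p := seqM (map codeM ls)).
  assert (Hp : E p u).
  { apply (closed_seqM (fun x => E x u)); auto.
    intros y Hy. apply in_map_iff in Hy as (A & <- & _). apply Pc. }
  assert (Hlast : nth_error ls (length l) = Some (gamma R F0)).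
  { unfold ls. rewrite nth_error_app2, Nat.sub_diag by lia. reflexivity. }
  assert (mem : forall i A, nth_error ls i = Some A -> E (pr (numM i) (codeM A)) p).
  { intros i A HA. apply seqM_pr. exists i; split; auto.
    rewrite nth_error_map, HA; reflexivity. }
  destruct (H p Hp) as (y & Hy & i & Hi & g & Hgu & (Hig & NL & NM & NG) & Hbad).
  { exists (codeM (theta (quote (beta R F0)))); split; [apply Pc|].
    exists (codeM (gamma R F0)); split; [apply Pc|]. split; [|split; [reflexivity|]].
    - apply (QuoteRel_theta (fun x => E x u) (quote (beta R F0)) Cu), canonical_quote.
    - exists (numM (length l)); split; [apply Pn|]. exists (numM (S (length l))); split; [apply Pn|].
      split; [apply Nat_numM|]. split; [reflexivity|]. split; [|apply mem; exact Hlast].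
      assert (X := Fun_seqM (map codeM ls)).
      replace (length (map codeM ls)) with (S (length l)) in X; [exact X|].
      unfold ls. rewrite length_map, length_app, Nat.add_1_r. reflexivity. }
  (* Because p is a standard finite sequence, the bad line has a standard index and is the code of
     an actual formula. *)
  apply seqM_pr in Hig as (k & -> & Hk). rewrite nth_error_map in Hk.
  destruct (nth_error ls k) as [A|] eqn:HA; [|discriminate]. injection Hk as <-.
  destruct (Hl k A HA) as [K|[K|[(j & k' & B & Hj & Hk' & X & Y)|(j & B & Hj & X & ->)]]].
  - exfalso. apply NL. apply (Logical_code _ Cu); auto.
  - exists A. split; [eapply nth_error_In; eauto|]. split; auto.
    assert (Huz : E u z) by (apply (Tz x); auto).
    split; [apply (Tz u); auto|].
    apply NNPP; intros N. apply Hbad. split.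
    + apply (FormIn_code _ Cu). apply HT; auto.
    + intros w Hw. apply NNPP; intros N'. apply N. exists w; split; auto.
      apply (Tz y); auto. apply (Tz b); auto. apply (Tz x); auto.
  - exfalso. apply NM. exists (numM j); split; [apply numM_lt; auto|].
    exists (numM k'); split; [apply numM_lt; auto|]. exists (codeM B); split; [apply Pc|].
    split; [apply (mem j (B ⇒ A)) | apply mem]; auto.
  - exfalso. apply NG. exists (numM j); split; [apply numM_lt; auto|].
    exists (codeM B); split; [apply Pc|]. split; [apply mem; auto|reflexivity].
Qed.

Lemma sat_fRefuted F0 l A x w s :
  fv_lt 2 F0 -> In A l -> E (codeM A) x -> E w x -> ~ F0_holds F0 w (codeM A) ->
  sat E (x ▹ s) (fRefuted F0 l).
Proof.
  intros F0fv HA Hx Hw HF. induction l as [|B l IH]; simpl in HA; [tauto|].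
  apply hold_Or. destruct HA as [->|HA]; [left|right; auto].
  apply hold_ExIn. exists (codeM A). split; auto. split; auto. apply hold_And. split.
  - apply sat_theta; [apply canonical_quote|reflexivity].
  - apply hold_ExIn. exists w. split; auto. split; auto. apply hold_Neg.
    intros K. apply HF. apply (sat_F0 F0 F0fv w (codeM A) (x ▹ s)); auto.
Qed.

End Models.

(** * Bisimilarity of well-founded trees *)

Lemma veq_refl x : veq x x.
Proof. induction x as [X f IH]; simpl; split; eauto. Qed.

Lemma veq_sym x y : veq x y -> veq y x.
Proof.
  revert y; induction x as [X f IH]; intros [Y g]; simpl. intros [H1 H2]; split.
  - intros j. destruct (H2 j) as [i Hi]; eauto.
  - intros i. destruct (H1 i) as [j Hj]; eauto.
Qed.

Lemma veq_trans x y z : veq x y -> veq y z -> veq x z.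
Proof.
  revert y z; induction x as [X f IH]; intros [Y g] [Z h]; simpl. intros [H1 H2] [K1 K2]; split.
  - intros i. destruct (H1 i) as [j Hj], (K1 j) as [k Hk]; eauto.
  - intros k. destruct (K2 k) as [j Hj], (H2 j) as [i Hi]; eauto.
Qed.

Lemma vmem_veq_l x x' y : veq x x' -> vmem x y -> vmem x' y.
Proof.
  destruct y as [Y g]; simpl. intros H [j Hj]. exists j.
  apply veq_trans with x; auto using veq_sym.
Qed.

Lemma vmem_veq_r x y y' : veq y y' -> vmem x y -> vmem x y'.
Proof.
  destruct y as [Y g], y' as [Z h]; simpl. intros [H _] [j Hj].
  destruct (H j) as [k Hk]. exists k. apply veq_trans with (g j); auto.
Qed.

Lemma veq_ext x y :
  (forall w, vmem w x -> vmem w y) -> (forall w, vmem w y -> vmem w x) -> veq x y.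
Proof.
  destruct x as [X f], y as [Y g]; simpl. intros H1 H2; split.
  - intros i. apply H1. exists i; apply veq_refl.
  - intros j. destruct (H2 (g j)) as [i Hi]; [exists j; apply veq_refl|].
    exists i; apply veq_sym; auto.
Qed.

Lemma vmem_vempty x : ~ vmem x vempty.
Proof. intros [[] _]. Qed.

Lemma vmem_vupair w x y : vmem w (vupair x y) <-> veq w x \/ veq w y.
Proof.
  simpl; split; [intros [[|] H]; auto|intros [H|H]; [exists true|exists false]; auto].
Qed.

Lemma vmem_vsucc w x : vmem w (vsucc x) <-> vmem w x \/ veq w x.
Proof.
  destruct x as [X f]; simpl vsucc. split.
  - intros [[i|] H]; [left; exists i; auto|right; auto].
  - intros [[i H]|H]; [exists (Some i); auto|exists None; auto].
Qed.

Lemma veq_vsucc x y : veq x y -> veq (vsucc x) (vsucc y).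
Proof.
  intros H. apply veq_ext; intros w; rewrite !vmem_vsucc; intros [K|K].
  - left; eapply vmem_veq_r; eauto.
  - right; eapply veq_trans; eauto.
  - left; eapply vmem_veq_r; eauto using veq_sym.
  - right; eapply veq_trans; eauto using veq_sym.
Qed.

Lemma veq_vupair x y x' y' : veq x x' -> veq y y' -> veq (vupair x y) (vupair x' y').
Proof.
  intros H K. apply veq_ext; intros w; rewrite !vmem_vupair;
    (intros [J|J]; [left|right]); eapply veq_trans; eauto using veq_sym.
Qed.

Lemma veq_vpair x y x' y' : veq x x' -> veq y y' -> veq (vpair x y) (vpair x' y').
Proof. intros; repeat apply veq_vupair; auto. Qed.

(* Lev a is transitive: an element z of y ∈ Def (Lev b) is definable in Lev b
   with parameter z. *)
Lemma vmem_Def x y w : vmem y (Def x) -> vmem w y -> vmem w x.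
Proof.
  destruct x as [X f]. intros [[[A ps] HA] Hy] Hw. apply (vmem_veq_r _ _ _ Hy) in Hw.
  simpl in Hw. destruct Hw as [[i Hi] Hw]. exists i; auto.
Qed.

Lemma vmem_Def_param x z : vtrans x -> vmem z x -> vmem z (Def x).
Proof.
  destruct x as [X f]. intros Tx [i Hi].
  assert (H : fv_lt (S (length [i])) (Mem 0 1)) by (simpl; lia).
  exists (exist _ (Mem 0 1, [i]) H). simpl. apply veq_ext.
  - intros w Hw. destruct (Tx z w Hw) as [j Hj]; [exists i; auto|].
    assert (K : vmem (f j) (f i)).
    { apply (vmem_veq_l w); auto. apply (vmem_veq_r w z); auto. }
    exists (exist _ j K); auto.
  - intros w [[j K] Hj]. simpl in Hj, K. apply (vmem_veq_r w (f i)); auto using veq_sym.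
    apply (vmem_veq_l (f j)); auto using veq_sym.
Qed.

Lemma vmem_Lev_intro X (f : X -> V) i y : vmem y (Def (Lev (f i))) -> vmem y (Lev (sup X f)).
Proof.
  intros H. simpl. destruct (Def (Lev (f i))) as [Y g] eqn:HD.
  assert (K : exists j : index (Def (Lev (f i))), veq y (elt (Def (Lev (f i))) j)).
  { rewrite HD. simpl in H |- *. auto. }
  destruct K as [j Hj]. exists (existT _ i j). exact Hj.
Qed.

Lemma vmem_Lev_elim X (f : X -> V) y : vmem y (Lev (sup X f)) ->
  exists i, vmem y (Def (Lev (f i))).
Proof.
  intros [[i j] Hj]. exists i. simpl in Hj.
  destruct (Def (Lev (f i))) as [Y g]. exists j; auto.
Qed.

Lemma vtrans_Lev a : vtrans (Lev a).
Proof.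
  induction a as [X f IH]. intros y z Hz Hy.
  apply vmem_Lev_elim in Hy as [i Hy]. apply (vmem_Lev_intro X f i).
  apply vmem_Def_param; auto. apply (vmem_Def _ y); auto.
Qed.

(** * Bounded definitions of codes, evaluated in transitive classes of trees *)

Section HoldsIn.
Variable P : V -> Prop.
Hypothesis HP : forall x y, vmem x y -> P y -> P x.

Lemma holds_And s A B : holds P s (A ∧ B) <-> holds P s A /\ holds P s B.
Proof. simpl; tauto. Qed.
Lemma holds_Or s A B : holds P s (A ∨ B) <-> holds P s A \/ holds P s B.
Proof. simpl; tauto. Qed.
Lemma holds_ExIn s y A : holds P s (ExIn y A) ->
  exists x, P x /\ vmem x (s y) /\ holds P (scons x s) A.
Proof.
  simpl. intros H; apply NNPP; intros N; apply H; intros x Px Hx HA; apply N; eauto.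
Qed.

Lemma holds_fv n s s' A : fv_lt n A -> (forall i, i < n -> s i = s' i) ->
  holds P s A <-> holds P s' A.
Proof.
  revert n s s'; induction A; simpl; intros n s s' H Hs; try tauto.
  - rewrite !Hs by tauto; tauto.
  - rewrite !Hs by tauto; tauto.
  - rewrite (IHA1 n s s'), (IHA2 n s s'); tauto.
  - apply forall_iff; intros x.
    rewrite (IHA (S n) (scons x s) (scons x s')); [tauto|auto|].
    intros [|i] Hi; simpl; auto. apply Hs; lia.
Qed.

Lemma holds_succ_bounded s (y x : nat) : P (s y) -> P (s x) ->
  holds P s (succ_bounded y x) -> veq (s y) (vsucc (s x)).
Proof.
  intros Py Px H. apply holds_And in H as [H1 H]. apply holds_And in H as [H2 H3].
  apply veq_ext; intros w; rewrite vmem_vsucc.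
  - intros Hw. assert (K := H1 w (HP _ _ Hw Py) Hw). apply holds_Or in K. exact K.
  - intros [Hw|Hw].
    + apply (H2 w (HP _ _ Hw Px) Hw).
    + apply (vmem_veq_l (s x)); auto using veq_sym.
Qed.

Lemma holds_upair_bounded s (z x y : nat) : P (s z) ->
  holds P s (upair_bounded z x y) -> veq (s z) (vupair (s x) (s y)).
Proof.
  intros Pz H. apply holds_And in H as [H1 H]. apply holds_And in H as [H2 H3].
  apply veq_ext; intros w; rewrite vmem_vupair.
  - intros Hw. assert (K := H1 w (HP _ _ Hw Pz) Hw). apply holds_Or in K. exact K.
  - intros [Hw|Hw]; eapply vmem_veq_l; eauto using veq_sym.
Qed.

Lemma holds_pair_bounded s (p x y : nat) : P (s p) ->
  holds P s (pair_bounded p x y) -> veq (s p) (vpair (s x) (s y)).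
Proof.
  intros Pp H. apply holds_And in H as [H1 H]. apply holds_And in H as [H2 H3].
  apply veq_ext; intros w; unfold vpair; rewrite vmem_vupair.
  - intros Hw. assert (Pw := HP _ _ Hw Pp). assert (K := H1 w Pw Hw).
    apply holds_Or in K as [K|K]; apply holds_upair_bounded in K; auto.
  - intros [Hw|Hw]; [apply holds_ExIn in H2 as (w' & Pw' & Hw' & K)
                    |apply holds_ExIn in H3 as (w' & Pw' & Hw' & K)];
      apply holds_upair_bounded in K; auto; simpl in K;
      apply (vmem_veq_l w'); auto; apply veq_sym; eapply veq_trans; eauto using veq_sym.
Qed.

(** All quantifiers of [theta] are bounded inside the transitive closure of v, which lies in [P] by
    downward closure; each clause then fixes its value up to [veq] by extensionality. *)
Lemma holds_theta t v s : canonical t -> P v ->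
  holds P (scons v s) (theta t) -> veq v (hval (fun _ => vempty) t).
Proof.
  revert v s; induction t; intros v s Ht Pv H; simpl in Ht.
  - tauto.
  - apply veq_ext; intros w Hw.
    + destruct (H w (HP _ _ Hw Pv) Hw).
    + apply vmem_vempty in Hw; tauto.
  - destruct Ht as [n ->]. cbn [theta] in H.
    apply holds_ExIn in H as (w & Pw & Hw & H). apply holds_And in H as [H1 H2].
    apply IHt in H1; auto using canonical_num.
    apply holds_succ_bounded in H2; auto. simpl in H2 |- *.
    eapply veq_trans; [exact H2|]. apply veq_vsucc; auto.
  - destruct Ht as [C1 C2]. cbn [theta] in H.
    apply holds_ExIn in H as (c & Pc & Hc & H). apply holds_ExIn in H as (a & Pa & Ha & H).
    apply holds_And in H as [H1 H]. apply holds_ExIn in H as (d & Pd & Hd & H).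
    apply holds_ExIn in H as (b & Pb & Hb & H). apply holds_And in H as [H2 H3].
    apply IHt1 in H1; auto. apply IHt2 in H2; auto.
    apply holds_pair_bounded in H3; auto. simpl in H3 |- *.
    eapply veq_trans; [exact H3|]. apply veq_vpair; auto.
Qed.

Lemma holds_fRefuted F0 l x s : P x -> fv_lt 2 F0 ->
  holds P (scons x s) (fRefuted F0 l) ->
  exists A g w, In A l /\ P g /\ P w /\ veq g (code A) /\
    ~ holds P (scons w (fun _ => g)) F0.
Proof.
  intros Px F0fv. induction l as [|B l IH]; [intros []|].
  intros H. apply holds_Or in H as [H|H].
  - apply holds_ExIn in H as (g & Pg & Hg & H). apply holds_And in H as [H1 H2].
    apply holds_ExIn in H2 as (w & Pw & Hw & H2).
    apply holds_theta in H1; auto using canonical_quote.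
    exists B, g, w. split; [left; reflexivity|]. repeat (split; [assumption|]).
    intros K. apply H2. revert K. apply (holds_fv 2); auto.
    intros [|[|i]] Hi; try reflexivity; lia.
  - destruct (IH H) as (A & g & w & HA & K). exists A, g, w. split; [right|]; auto.
Qed.

End HoldsIn.

(** * Unprovability of reflection, by contradiction with soundness *)

Theorem mainTheorem6
  (R : form) (HR : representation R) (Hadm : provably_admissible R)
  (alpha : V) (Halpha : represents R alpha)
  (T : form -> Prop) (HT : theory T)
  (Hext : extends T (KP1_Exists R))
  (Hsound : Sigma1_sound R alpha T)
  (F : form) (HF : Pi1_defines alpha F T) :
  ~ prv T (RFN R F).
Proof.
  intros HRFN. destruct HF as ((F0 & DF0 & ->) & Ffv & HF).
  assert (F0fv : fv_lt 2 F0) by exact Ffv.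
  assert (models : forall M (E : M -> M -> Prop),
    (forall B, T B -> forall s, sat E s B) -> forall s : nat -> M,
    exists (W : adjunctive M E) a z, L_stage M E W R a z /\
      (forall A, KP1 A -> forall s, sat E s A) /\
      (forall A, prv T A -> forall s, sat E s A)).
  { intros M E HM s.
    assert (sound : forall A, prv T A -> forall s, sat E s A).
    { intros A HA. apply (soundness _ _ T); auto. }
    assert (HKP : forall A, KP1 A -> forall s, sat E s A).
    { intros A HA. apply sound, Hext. left; auto. }
    destruct (KP1_adjunctive M E HKP (inhabits (s 0))) as [W]. exists W.
    destruct (L_stage_exists M E W HKP R HR Hadm) as (a & z & HS); [|eauto].
    apply sound, Hext. right; auto. }
  assert (Hgamma : prv T (gamma R F0)).
  { apply completeness; auto. intros M E HM s.
    destruct (models M E HM s) as (W & a & z & HS & HKP & sound).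
    apply (gamma_holds M E W R F0 a z); auto. }
  destruct (prv_proof_seq T _ Hgamma) as [l Hl]. set (ls := l ++ [gamma R F0]) in *.
  (* Only lines that really are axioms may enter the disjunction, since each disjunct has to
     contradict the definition of T; excluded middle selects them. *)
  assert (Hax : forall L, exists axs, forall A, In A axs <-> In A L /\ T A).
  { clear. induction L as [|B L [axs IH]]; [exists []; simpl; tauto|].
    destruct (classic (T B)) as [HB|HB]; [exists (B :: axs)|exists axs];
      intros A; simpl; rewrite IH; intuition (subst; tauto). }
  destruct (Hax ls) as [axs Haxs].
  assert (Href : prv T (atL R (Ex (fRefuted F0 axs)))).
  { apply completeness; auto. intros M E HM s.
    destruct (models M E HM s) as (W & a & z & HS & HKP & sound).
    apply (spec_atL M E W R a (stage_R _ _ _ _ _ _ HS) s _ z (stage_L _ _ _ _ _ _ HS)).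
    destruct (gamma_refutes_axiom M E W R F0 a z T l s HS F0fv HT Hl (sound _ Hgamma s))
      as (A & HA & TA & HAz & w & Hw & Hbad).
    (* Collecting the code and the witness in one set leaves a single unbounded quantifier, as the
       literal form of Σ1 requires. *)
    set (x := upr M E W (codeM M E W A) w).
    assert (Hx : E x z) by (apply (stage_pair _ _ _ _ _ _ HS); auto).
    apply hold_Ex. exists x; split; auto.
    (* [hold_stage] needs every value of the assignment in z; the variables that do not occur are
       therefore set to x. *)
    apply (hold_fv _ _ _ 1 _ (fun _ => x)); [apply fv_lt_fRefuted; auto| |].
    { intros [|i] Hi; [reflexivity|lia]. }
    apply (hold_stage M E W R a z HS (fun _ => x)); [apply Delta0_fRefuted; auto|auto|].
    apply (hold_fv _ _ _ 1 (x ▹ (fun _ => x))); [apply fv_lt_fRefuted; auto| |].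
    { intros [|i] Hi; [reflexivity|lia]. }
    apply (sat_fRefuted M E W F0 axs A x w); auto; try (apply upr_spec; auto).
    apply Haxs; auto. }
  assert (HS1 : Sigma1 (Ex (fRefuted F0 axs))).
  { exists (fRefuted F0 axs); split; auto. apply Delta0_fRefuted; auto. }
  assert (Hsent : sentence (Ex (fRefuted F0 axs))).
  { split; [split; [apply fv_lt_fRefuted; auto|exact I]|exact I]. }
  apply (Hsound _ HS1 Hsent Href). intros x Px Hx.
  apply (holds_fRefuted (fun y => vmem y (Lev alpha))) in Hx
    as (A & g & w & HA & Pg & Pw & Hg & Hbad);
    auto; [|intros y y' Hy Hy'; apply (vtrans_Lev alpha y'); auto].
  apply Hbad. apply Haxs in HA as [_ TA].
  apply (proj2 (HF g Pg) (ex_intro _ A (conj TA Hg)) w Pw).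
Qed.
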